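(* Let $D$ be a connected graded algebra generated as a $\Bbbk$-algebra by $D_1$. Let $\Omega\in D$ be a homogeneous normal regular element of degree $\ge2$ and let $A=D/(\Omega)$. If $A$ is twisted Calabi-Yau then so is $D$, and in that case the following hold: (1) on the common space of generators $A_1=D_1$, $\nu_A=\tau^{-1}\nu_D$, where $\tau$ is the unique automorphism of $D$ such that $\Omega x=\tau(x)\Omega$ for all $x\in D$, and $\nu_A,\nu_D$ are the Nakayama automorphisms; (2) $\Omega$ is an eigenvector for the Nakayama automorphism $\nu_D$; (3) if $\sigma$ is a degree-preserving automorphism of $D$ such that $\sigma(\Omega)=\lambda\Omega$ with $\lambda\in\Bbbk$, then $\mathrm{hdet}_D(\sigma)=\lambda\,\mathrm{hdet}_A(\sigma|_A)$, where $\sigma|_A$ is the automorphism of $A$ induced by $\sigma$.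
   Context: Fix a field $\Bbbk$. Graded algebras are $\mathbb{N}$-graded, connected, finitely presented over $\Bbbk$ and generated in degree one. An element $\Omega$ is normal if $\Omega D=D\Omega$ and regular if it is not a zero-divisor. For a graded algebra $A$ let $A^e=A\otimes A^{\circ}$; bimodules are left $A^e$-modules via $(a\otimes b)\cdot x=axb$ and right $A^e$-modules via $x\cdot(a\otimes b)=bxa$. For a graded automorphism $\nu$, ${}_\nu A_1$ is $A$ with bimodule action $a\cdot c\cdot b=\nu(a)cb$. $A$ is twisted Calabi-Yau of dimension $d$ if, as a left $A^e$-module, $A$ has a finite-length resolution by finitely generated projectives and $\mathrm{Ext}^i_{A^e}(A,A^e)$ is $0$ for $i\ne d$ and isomorphic to ${}_\nu A_1(\ell)$ for $i=d$ as graded right $A^e$-modules, for some $\ell\in\mathbb{Z}$ and some graded algebra automorphism $\nu=\nu_A$, which is unique and called the Nakayama automorphism. For connected graded algebras this is equivalent to Artin-Schelter regularity of dimension $d$ (finite global dimension $d$, left self-injective dimension $d$, and $\mathrm{Ext}^i_A(\Bbbk,A)\cong\Bbbk(\ell)$ for $i=d$, $0$ otherwise), with the same $\ell$. Homological determinant (J{\o}rgensen-Zhang): let $A$ be Artin-Schelter regular of dimension $d$ and $\sigma$ a degree-preserving automorphism. For a left module $M$, ${}_\sigma M$ is $M$ with action $a\cdot x=\sigma(a)x$. The map $\sigma\colon A\to{}_\sigma A$ is left $A$-linear. The composite of $\sigma_*\colon\mathrm{Ext}^d_A(\Bbbk,A)\to\mathrm{Ext}^d_A(\Bbbk,{}_\sigma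 A)$ with the twisting isomorphism ${}_{\sigma^{-1}}(-)\colon\mathrm{Ext}^d_A(\Bbbk,{}_\sigma A)\to\mathrm{Ext}^d_A({}_{\sigma^{-1}}\Bbbk,A)=\mathrm{Ext}^d_A(\Bbbk,A)$ is multiplication by a non-zero scalar on this one-dimensional space; $\mathrm{hdet}_A(\sigma)$ is the inverse of that scalar. (Equivalently it is the scalar defined through the action of $\sigma$ on the top local cohomology group $H^d_{\mathfrak m}(A)$.) *)

(* Defs.v *)
From HB Require Import structures.
From mathcomp Require Import all_boot all_order all_algebra generic_quotient.
From mathcomp Require Import boolp classical_sets.
From mathcomp Require Import monalg.

Set Implicit Arguments.
Unset Strict Implicit.
Unset Printing Implicit Defensive.

Import GRing.Theory.
Local Open Scope ring_scope.
Local Open Scope quotient_scope.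

Definition two_sided_ideal (R : nzRingType) (S : R -> Prop) (x : R) : Prop :=
  exists s : seq (R * R * R),
    (forall t, t \in s -> S t.1.2) /\ x = \sum_(t <- s) t.1.1 * t.1.2 * t.2.

Definition normal_elt (R : nzRingType) (w : R) : Prop :=
  (forall x, exists y, w * x = y * w) /\ (forall x, exists y, x * w = w * y).

Definition regular_elt (R : nzRingType) (w : R) : Prop :=
  GRing.lreg w /\ GRing.rreg w.

(* [{malg k[{fmonom 'I_n}]}] is the free associative algebra on n letters. *)
Definition finitely_presented (k : fieldType) (A : algType k) : Prop :=
  exists (n : nat) (phi : {lrmorphism {malg k[{fmonom 'I_n}]} -> A})
         (rels : seq {malg k[{fmonom 'I_n}]}),
    (forall a, exists p, phi p = a) /\
    (forall p, phi p = 0 <-> two_sided_ideal (fun r => r \in rels) p).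

Definition direct_sum (I : choiceType) (M : zmodType) (H : I -> M -> Prop) :=
  [/\ forall i, H i 0,
      forall i x y, H i x -> H i y -> H i (x - y),
      forall x, exists (s : seq I) (f : I -> M),
        (forall i, H i (f i)) /\ x = \sum_(i <- s) f i
    & forall (s : seq I) (f : I -> M), uniq s -> (forall i, H i (f i)) ->
        \sum_(i <- s) f i = 0 -> forall i, i \in s -> f i = 0].

(* Since [gcomp 0] is the line of scalars, every [gcomp n] is a k-subspace. *)
Record gralg (k : fieldType) := GrAlg {
  gralg_sort :> algType k;
  gcomp : nat -> gralg_sort -> Prop;
  gcomp_direct : direct_sum gcomp;
  gcompM : forall i j x y, gcomp i x -> gcomp j y -> gcomp (i + j)%N (x * y);
  gcomp_connected : forall x, gcomp 0%N x <-> exists c : k, x = c%:A }.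

Arguments gcomp {k} g n x : rename.

Definition generated_in_degree_one (k : fieldType) (A : gralg k) : Prop :=
  forall a : A, exists ws : seq (k * seq A),
    (forall w, w \in ws -> forall x, x \in w.2 -> gcomp A 1 x) /\
    a = \sum_(w <- ws) w.1 *: \prod_(x <- w.2) x.

Definition gcomp_int (k : fieldType) (A : gralg k) (n : int) (a : A) : Prop :=
  match n with Posz m => gcomp A m a | Negz _ => a = 0 end.

Definition graded_aut (k : fieldType) (A : gralg k) (s : A -> A) : Prop :=
  bijective s /\ forall n a, gcomp A n a -> gcomp A n (s a).

Definition trivial_module (k : fieldType) (A : gralg k) : Type := k.

Section Augmentation.
Variables (k : fieldType) (A : gralg k).

Definition positive_part (x : A) : Prop :=
  exists s : seq A, (forall y, y \in s -> exists2 i, (0 < i)%N & gcomp A i y) /\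
    x = \sum_(y <- s) y.

Lemma gcompD i (x y : A) : gcomp A i x -> gcomp A i y -> gcomp A i (x + y).
Proof.
move=> hx hy; have [h0 hB _ _] := gcomp_direct A.
by rewrite -[y]opprK; apply: (hB) => //; rewrite -sub0r; apply: hB.
Qed.

Lemma positive0 : positive_part 0.
Proof. by exists [::]; rewrite big_nil. Qed.

Lemma positiveD x y :
  positive_part x -> positive_part y -> positive_part (x + y).
Proof.
move=> [s [hs ->]] [t [ht ->]]; exists (s ++ t); rewrite big_cat; split=> // z.
by rewrite mem_cat => /orP[/hs|/ht].
Qed.

Lemma positive_hom i x : (0 < i)%N -> gcomp A i x -> positive_part x.
Proof.
move=> i0 hx; exists [:: x]; rewrite big_seq1; split=> // y.
by rewrite inE => /eqP->; exists i.
Qed.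

Lemma positive_sum (I : eqType) (s : seq I) (f : I -> A) :
  (forall i, i \in s -> positive_part (f i)) ->
  positive_part (\sum_(i <- s) f i).
Proof.
elim: s => [|i s IH] h; first by rewrite big_nil; exact: positive0.
rewrite big_cons; apply: positiveD; first by apply: h; rewrite mem_head.
by apply: IH => j js; apply: h; rewrite inE js orbT.
Qed.

Lemma positiveMl a x : positive_part x -> positive_part (a * x).
Proof.
have [_ _ hdec _] := gcomp_direct A.
move=> [s [hs ->]]; rewrite mulr_sumr; apply: positive_sum => y /hs [i i0 hy].
have [t [f [hf ->]]] := hdec a; rewrite mulr_suml; apply: positive_sum => j _.
by apply: (@positive_hom (j + i)); rewrite ?addn_gt0 ?i0 ?orbT //; apply: gcompM.
Qed.

Lemma positiveMr a x : positive_part x -> positive_part (x * a).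
Proof.
have [_ _ hdec _] := gcomp_direct A.
move=> [s [hs ->]]; rewrite mulr_suml; apply: positive_sum => y /hs [i i0 hy].
have [t [f [hf ->]]] := hdec a; rewrite mulr_sumr; apply: positive_sum => j _.
by apply: (@positive_hom (i + j)); rewrite ?addn_gt0 ?i0 //; apply: gcompM.
Qed.

Lemma positive_scalar (c : k) : positive_part (c%:A : A) -> c = 0.
Proof.
have [h0 hB _ hind] := gcomp_direct A.
have dec (s : seq A) :
    (forall y, y \in s -> exists2 i, (0 < i)%N & gcomp A i y) ->
    exists (N : nat) (f : nat -> A), (forall i, gcomp A i.+1 (f i)) /\
      (forall i, (N <= i)%N -> f i = 0) /\ \sum_(y <- s) y = \sum_(i < N) f i.
  elim: s => [|y s IH] hs.
    by exists 0%N, (fun=> 0); rewrite big_nil big_ord0.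
  have /IH[N [f [hf [f0 sE]]]] z : z \in s -> exists2 i, (0 < i)%N & gcomp A i z.
    by move=> zs; apply: hs; rewrite inE zs orbT.
  have [[//|i] _ hy] := hs y (mem_head _ _).
  exists (N + i.+1)%N, (fun j => f j + (if j == i then y else 0)).
  split; first by move=> j; apply: gcompD => //; case: eqP => [->|].
  split=> [j hj|].
    rewrite f0 ?(leq_trans (leq_addr _ _) hj) // add0r ifN //.
    by rewrite neq_ltn (leq_trans (leq_addl _ _) hj) orbT.
  rewrite big_cons sE big_split /= [LHS]addrC; congr (_ + _).
    rewrite big_split_ord /= [X in _ = _ + X]big1 ?addr0 // => j _.
    by rewrite f0 ?leq_addr.
  have iN : (i < N + i.+1)%N by rewrite addnS ltnS leq_addl.
  rewrite (bigD1 (Ordinal iN)) //= eqxx big1 ?addr0 // => j.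
  by rewrite -val_eqE /= => /negPf->.
move=> [s [/dec [N [f [hf [_ e]]]] cE]].
pose g i := if i is j.+1 then f j else - (c%:A : A).
have c0 : gcomp A 0 (c%:A : A) by apply/gcomp_connected; exists c.
have hg i : gcomp A i (g i).
  by case: i => [|i] //=; rewrite -sub0r; apply: hB.
have /hind : uniq (iota 0 N.+1) by rewrite iota_uniq.
move=> /(_ _ hg) h.
have /h/(_ 0%N) : \sum_(i <- iota 0 N.+1) g i = 0.
  rewrite -[iota 0 N.+1]/(index_iota 0 N.+1) big_mkord big_ord_recl /=.
  by rewrite /bump /= -e -cE addNr.
rewrite mem_head /= => /(_ isT)/eqP; rewrite oppr_eq0 scaler_eq0 oner_eq0 orbF.
by move/eqP.
Qed.

Lemma augmentation_ex (a : A) : exists c : k, positive_part (a - c%:A).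
Proof.
have [_ _ hdec _] := gcomp_direct A.
have [s [f [hf ->]]] := hdec a; elim: s => [|i s [c IH]].
  by exists 0; rewrite big_nil scale0r subr0; exact: positive0.
rewrite big_cons; case: i => [|i].
  have /gcomp_connected[c' ->] := hf 0%N; exists (c' + c).
  by rewrite scalerDl opprD addrACA subrr add0r.
exists c; rewrite -addrA; apply: positiveD => //; exact: positive_hom (hf _).
Qed.

(* the projection of A onto A/A_{>0} = k *)
Definition augmentation (a : A) : k := projT1 (cid (augmentation_ex a)).

Lemma augmentationP a : positive_part (a - (augmentation a)%:A).
Proof. by rewrite /augmentation; case: cid. Qed.

Lemma augmentation_uniq a c : positive_part (a - c%:A) -> augmentation a = c.
Proof.
move=> hc; apply/eqP; rewrite -subr_eq0; apply/eqP/positive_scalar.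
rewrite scalerBl.
have -> : (augmentation a)%:A - c%:A =
    (a - c%:A) + (-1) * (a - (augmentation a)%:A).
  by rewrite mulN1r opprB [RHS]addrC addrA subrK.
by apply: positiveD => //; apply: positiveMl; apply: augmentationP.
Qed.

Lemma augmentationD a b :
  augmentation (a + b) = augmentation a + augmentation b.
Proof.
apply: augmentation_uniq; rewrite scalerDl opprD addrACA.
by apply: positiveD; apply: augmentationP.
Qed.

Lemma augmentation1 : augmentation 1 = 1.
Proof.
by apply: augmentation_uniq; rewrite scale1r subrr; exact: positive0.
Qed.

Lemma augmentationM a b :
  augmentation (a * b) = augmentation a * augmentation b.
Proof.
apply: augmentation_uniq.
set c := augmentation a; set d := augmentation b.
have -> : a * b - (c * d)%:A = (a - c%:A) * b + c%:A * (b - d%:A).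
  rewrite mulrBl mulrBr addrA subrK; congr (_ - _).
  by rewrite -scalerAl mul1r scalerA.
apply: positiveD.
  by apply: positiveMr; apply: augmentationP.
by apply: positiveMl; apply: augmentationP.
Qed.


HB.instance Definition _ := GRing.Zmodule.copy (trivial_module A) k.

Definition trivial_scale (a : A) (c : (trivial_module A)) : (trivial_module A) :=
  augmentation a * (c : k).

Fact trivial_scaleA a b c :
  trivial_scale a (trivial_scale b c) = trivial_scale (a * b) c.
Proof. by rewrite /trivial_scale augmentationM mulrA. Qed.
Fact trivial_scale1 : left_id 1 trivial_scale.
Proof. by move=> c; rewrite /trivial_scale augmentation1 mul1r. Qed.
Fact trivial_scaleDr : right_distributive trivial_scale +%R.
Proof. by move=> a c d; apply: mulrDr. Qed.
Fact trivial_scaleDl c : {morph trivial_scale^~ c : a b / a + b}.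
Proof. by move=> a b; rewrite /trivial_scale augmentationD mulrDl. Qed.

HB.instance Definition _ := GRing.Zmodule_isLmodule.Build A (trivial_module A)
  trivial_scaleA trivial_scale1 trivial_scaleDr trivial_scaleDl.

End Augmentation.

Section Enveloping.
Variables (k : fieldType) (A : algType k).

Definition bilinear_map (V : lmodType k) (b : A -> A -> V) : Prop :=
  (forall y, linear (b^~ y)) /\ (forall x, linear (b x)).

Definition tsum (V : lmodType k) (b : A -> A -> V) (s : seq (A * A)) : V :=
  \sum_(p <- s) b p.1 p.2.

(* A formal sum [:: (a1, b1); ...; (an, bn)] stands for the tensor
   a1 (x) b1 + ... + an (x) bn; two of them are identified when no bilinear
   map can tell them apart, so that the universal property of A (x)_k A holds
   by construction (see [tliftE], [tlift_tensor] and [tensor_sum]). *)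
Definition tensor_eq (s t : seq (A * A)) : bool :=
  `[< forall (V : lmodType k) (b : A -> A -> V),
        bilinear_map b -> tsum b s = tsum b t >].

Fact tensor_eq_refl : reflexive tensor_eq.
Proof. by move=> s; apply/asboolP. Qed.
Fact tensor_eq_sym : symmetric tensor_eq.
Proof.
by move=> s t; apply/asboolP/asboolP => h V b hb; apply/esym/h.
Qed.
Fact tensor_eq_trans : transitive tensor_eq.
Proof.
move=> t s u /asboolP h /asboolP h'; apply/asboolP => V b hb.
by rewrite h ?h'.
Qed.

Canonical tensor_equiv :=
  EquivRel tensor_eq tensor_eq_refl tensor_eq_sym tensor_eq_trans.

Definition enveloping : Type := {eq_quot tensor_eq}.
HB.instance Definition _ := Choice.on enveloping.
HB.instance Definition _ : EqQuotient _ tensor_eq enveloping :=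
  EqQuotient.on enveloping.

Implicit Types t u v : enveloping.

Definition tlift (V : lmodType k) (b : A -> A -> V) (t : enveloping) : V :=
  tsum b (repr t).

Lemma tliftE (V : lmodType k) (b : A -> A -> V) (s : seq (A * A)) :
  bilinear_map b -> tlift b (\pi_enveloping s) = tsum b s.
Proof.
move=> hb; have /eqmodP/asboolP := reprK (\pi_enveloping s).
by apply.
Qed.

Lemma tensorP t u :
  (forall (V : lmodType k) (b : A -> A -> V),
     bilinear_map b -> tlift b t = tlift b u) -> t = u.
Proof.
by move=> h; rewrite -[t]reprK -[u]reprK; apply/eqmodP/asboolP.
Qed.

Definition tensor (a b : A) : enveloping := \pi_enveloping [:: (a, b)].
Definition tzero : enveloping := \pi_enveloping [::].
Definition topp t : enveloping :=
  \pi_enveloping [seq (- p.1, p.2) | p <- repr t].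
Definition tadd t u : enveloping := \pi_enveloping (repr t ++ repr u).

(* (a (x) b)(a' (x) b') = a a' (x) b' b *)
Definition tmul t u : enveloping := \pi_enveloping
  [seq (p.1 * q.1, q.2 * p.2) | p <- repr t, q <- repr u].

Section Lift.
Variables (V : lmodType k) (b : A -> A -> V) (hb : bilinear_map b).

Lemma bilinDl x x' y : b (x + x') y = b x y + b x' y.
Proof. by have := hb.1 y 1 x x'; rewrite !scale1r. Qed.
Lemma bilinDr x y y' : b x (y + y') = b x y + b x y'.
Proof. by have := hb.2 x 1 y y'; rewrite !scale1r. Qed.
Lemma bilin0l y : b 0 y = 0.
Proof. by apply: (addrI (b 0 y)); rewrite -bilinDl !addr0. Qed.
Lemma bilinNl x y : b (- x) y = - b x y.
Proof. by apply: (addrI (b x y)); rewrite -bilinDl !subrr bilin0l. Qed.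

Lemma tlift_tensor x y : tlift b (tensor x y) = b x y.
Proof. by rewrite tliftE // /tsum big_seq1. Qed.
Lemma tlift0 : tlift b tzero = 0.
Proof. by rewrite tliftE // /tsum big_nil. Qed.
Lemma tliftN t : tlift b (topp t) = - tlift b t.
Proof.
rewrite tliftE // /tlift /tsum big_map -sumrN.
by apply: eq_bigr => p _; rewrite bilinNl.
Qed.
Lemma tliftD t u : tlift b (tadd t u) = tlift b t + tlift b u.
Proof. by rewrite tliftE // /tsum big_cat. Qed.

Lemma tliftM t u : tlift b (tmul t u) =
  tlift (fun x y => tlift (fun x' y' => b (x * x') (y' * y)) u) t.
Proof.
rewrite tliftE // /tlift /tsum big_allpairs_dep.
by apply: eq_bigr.
Qed.

Lemma bilin_inner x y : bilinear_map (fun x' y' => b (x * x') (y' * y)).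
Proof.
split=> [y'|x'] c z z'.
  by rewrite mulrDr -scalerAr; apply: hb.1.
by rewrite mulrDl -scalerAl; apply: hb.2.
Qed.

Lemma bilin_outer u :
  bilinear_map (fun x y => tlift (fun x' y' => b (x * x') (y' * y)) u).
Proof.
split=> [y|x] c z z'; rewrite /tlift /tsum scaler_sumr -big_split /=.
  by apply: eq_bigr => p _; rewrite mulrDl -scalerAl; apply: hb.1.
by apply: eq_bigr => p _; rewrite mulrDr -scalerAr; apply: hb.2.
Qed.

End Lift.

Lemma eq_tlift (V : lmodType k) (b b' : A -> A -> V) t :
  (forall x y, b x y = b' x y) -> tlift b t = tlift b' t.
Proof. by move=> h; apply: eq_bigr => p _; apply: h. Qed.

Fact taddA : associative tadd.
Proof. by move=> t u v; apply: tensorP => V b hb; rewrite !tliftD ?addrA. Qed.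
Fact taddC : commutative tadd.
Proof. by move=> t u; apply: tensorP => V b hb; rewrite !tliftD // addrC. Qed.
Fact tadd0 : left_id tzero tadd.
Proof. by move=> t; apply: tensorP => V b hb; rewrite tliftD // tlift0 ?add0r. Qed.
Fact taddN : left_inverse tzero topp tadd.
Proof.
by move=> t; apply: tensorP => V b hb; rewrite tliftD // tliftN // tlift0 ?addNr.
Qed.

HB.instance Definition _ :=
  GRing.isZmodule.Build enveloping taddA taddC tadd0 taddN.

Fact tmulA : associative tmul.
Proof.
move=> t u v; apply: tensorP => V b hb.
rewrite (tliftM hb) (tliftM hb) tliftM; last exact: bilin_outer.
apply: eq_tlift => x y; rewrite tliftM; last exact: bilin_inner.
apply: eq_tlift => x' y'; apply: eq_tlift => x'' y''.
by rewrite !mulrA.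
Qed.

Fact tmul1l : left_id (tensor 1 1) tmul.
Proof.
move=> t; apply: tensorP => V b hb.
rewrite tliftM // tlift_tensor; last exact: bilin_outer.
by apply: eq_tlift => x y; rewrite mul1r mulr1.
Qed.

Fact tmul1r : right_id (tensor 1 1) tmul.
Proof.
move=> t; apply: tensorP => V b hb; rewrite tliftM //.
apply: eq_tlift => x y; rewrite tlift_tensor; last exact: bilin_inner.
by rewrite mul1r mulr1.
Qed.

Fact tmulDl : left_distributive tmul tadd.
Proof.
move=> t u v; apply: tensorP => V b hb.
by rewrite tliftD // !tliftM // tliftD //; exact: bilin_outer.
Qed.

Fact tmulDr : right_distributive tmul tadd.
Proof.
move=> t u v; apply: tensorP => V b hb.
rewrite tliftD // !tliftM // /tlift /tsum -big_split /=.
by apply: eq_bigr => p _; apply: (tliftD (bilin_inner hb p.1 p.2)).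
Qed.

Lemma mul_bilinear (x : A) : bilinear_map (fun a b : A => a * x * b).
Proof.
split=> [y|y] c z z'; first by rewrite !mulrDl -!scalerAl.
by rewrite mulrDr -scalerAr.
Qed.

Fact tone_neq0 : tensor 1 1 != tzero.
Proof.
apply/eqP => /(congr1 (tlift (fun a b : A => a * 1 * b))).
rewrite tlift_tensor ?tlift0; try exact: mul_bilinear.
by rewrite !mulr1 => /eqP; rewrite oner_eq0.
Qed.

HB.instance Definition _ := GRing.Zmodule_isNzRing.Build enveloping
  tmulA tmul1l tmul1r tmulDl tmulDr tone_neq0.

Lemma tensor_sum t : t = \sum_(p <- repr t) tensor p.1 p.2.
Proof.
rewrite -{1}[t]reprK; elim: (repr t) => [|p s IH]; first by rewrite big_nil.
rewrite big_cons -IH; apply: tensorP => V b hb.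
by rewrite tliftD // !tliftE // /tsum big_cons big_seq1.
Qed.

(* A as a left module over its enveloping algebra: (a (x) b) x = a x b *)
Definition regular_bimodule : Type := A.
HB.instance Definition _ := GRing.Zmodule.on regular_bimodule.

Definition bimod_scale t (x : regular_bimodule) : regular_bimodule :=
  tlift (fun a b : A => a * (x : A) * b) t.

Fact bimod_scaleA t u x :
  bimod_scale t (bimod_scale u x) = bimod_scale (t * u) x.
Proof.
rewrite /bimod_scale tliftM; last exact: mul_bilinear.
apply: eq_tlift => a b; rewrite /tlift /tsum mulr_sumr mulr_suml.
by apply: eq_bigr => p _; rewrite !mulrA.
Qed.
Fact bimod_scale1 : left_id 1 bimod_scale.
Proof.
move=> x; rewrite /bimod_scale tlift_tensor; last exact: mul_bilinear.
by rewrite mul1r mulr1.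
Qed.
Fact bimod_scaleDr : right_distributive bimod_scale +%R.
Proof.
move=> t x y; rewrite /bimod_scale /tlift /tsum -big_split /=.
by apply: eq_bigr => p _; rewrite mulrDr mulrDl.
Qed.
Fact bimod_scaleDl x : {morph bimod_scale^~ x : t u / t + u}.
Proof. by move=> t u; apply: (tliftD (mul_bilinear x)). Qed.

HB.instance Definition _ := GRing.Zmodule_isLmodule.Build
  enveloping regular_bimodule
  bimod_scaleA bimod_scale1 bimod_scaleDr bimod_scaleDl.

End Enveloping.

Definition gcomp_enveloping (k : fieldType) (A : gralg k)
    (n : int) (e : enveloping A) : Prop :=
  exists s : seq (A * A),
    (forall p, p \in s ->
       exists i j, [/\ gcomp A i p.1, gcomp A j p.2 & (i + j)%N%:Z = n]) /\
    e = \sum_(p <- s) tensor p.1 p.2.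

Definition projective (R : nzRingType) (P : lmodType R) : Prop :=
  forall (X Y : lmodType R) (g : {linear X -> Y}) (f : {linear P -> Y}),
    (forall y, exists x, g x = y) ->
    exists h : {linear P -> X}, forall p, g (h p) = f p.

Definition finitely_generated (R : nzRingType) (M : lmodType R) : Prop :=
  exists (n : nat) (e : 'I_n -> M),
    forall m, exists c : 'I_n -> R, m = \sum_i c i *: e i.

Record resolution (R : nzRingType) (M : lmodType R) := Resolution {
  res_mod :> nat -> lmodType R;
  res_diff : forall n, {linear res_mod n.+1 -> res_mod n};
  res_aug : {linear res_mod 0%N -> M};
  res_projective : forall n, projective (res_mod n);
  res_aug_surj : forall m, exists x, res_aug x = m;
  res_exact0 : forall x, res_aug x = 0 <-> exists y, res_diff 0%N y = x;
  res_exactS : forall n x,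
    res_diff n x = 0 <-> exists y, res_diff n.+1 y = x }.

Arguments res_diff {R M} r n.
Arguments res_aug {R M} r.

Section Ext.
Variables (R : nzRingType) (M N : lmodType R) (P : resolution M).

(* Ext^n_R(M, N) is the group of n-cocycles of Hom_R(P, N) modulo the
   n-coboundaries. *)
Definition cocycle (n : nat) (f : P n -> N) : Prop :=
  linear f /\ forall x, f (res_diff P n x) = 0.

Definition coboundary (n : nat) : (P n -> N) -> Prop :=
  match n with
  | 0 => fun f => forall x, f x = 0
  | m.+1 => fun f =>
      exists g : {linear P m -> N}, forall x, f x = g (res_diff P m x)
  end.

End Ext.

Section TwistedCY.
Variables (k : fieldType) (A : gralg k).

Definition graded_resolution (P : resolution (regular_bimodule A))
    (G : forall n, int -> P n -> Prop) : Prop :=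
  [/\ forall n, direct_sum (G n),
      forall n i j e x, gcomp_enveloping i e -> G n j x -> G n (i + j) (e *: x),
      forall n j x, G n.+1 j x -> G n j (res_diff P n x)
    & forall j x, G 0%N j x -> gcomp_int j (res_aug P x : A)].

(* [Phi] induces an isomorphism of graded right A^e-modules from
   Ext^d_{A^e}(A, A^e) to the twisted bimodule ${}_\nu A_1(l)$: on the left
   A^e acts by (f . e)(x) = f(x) e, on the right by
   c . (a (x) b) = b . c . a = nu(b) c a; a cocycle has degree j when it raises
   degrees by j, and $A(l)_j = A_{l+j}$. *)
Definition ext_iso_twist (P : resolution (regular_bimodule A))
    (G : forall n, int -> P n -> Prop) (d : nat) (nu : A -> A) (l : int)
    (Phi : (P d -> (enveloping A)^o) -> A) : Prop :=
  let cochain := P d -> (enveloping A)^o in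
  [/\ forall f g : cochain, cocycle f -> cocycle g ->
        Phi (fun x => f x + g x) = Phi f + Phi g,
      forall f : cochain, cocycle f -> forall a b : A,
        Phi (fun x => (f x : enveloping A) * tensor a b) = nu b * Phi f * a,
      forall a : A, exists2 f : cochain, cocycle f & Phi f = a,
      forall f : cochain, cocycle f -> (Phi f = 0 <-> coboundary f)
    & forall (f : cochain) (j : int), cocycle f ->
        (forall i x, G d i x -> gcomp_enveloping (i + j) (f x)) ->
        gcomp_int (l + j) (Phi f)].

(* A is twisted Calabi-Yau of dimension d with Nakayama automorphism nu *)
Definition nakayama (d : nat) (nu : {lrmorphism A -> A}) : Prop :=
  graded_aut nu /\
  exists (P : resolution (regular_bimodule A))
         (G : forall n, int -> P n -> Prop),
    [/\ graded_resolution G,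
        forall n, finitely_generated (P n),
        exists N : nat, forall n, (N < n)%N -> forall x : P n, x = 0,
        forall i, i != d ->
          forall f : P i -> (enveloping A)^o, cocycle f -> coboundary f
      & exists (l : int) (Phi : (P d -> (enveloping A)^o) -> A),
          ext_iso_twist G nu l Phi].

Definition twisted_CY : Prop := exists d nu, nakayama d nu.

End TwistedCY.

Section Hdet.
Variables (k : fieldType) (A : gralg k).

(* [c] is the scalar by which
     Ext^d_A(k, A) -> Ext^d_A(k, _sigma A) = Ext^d_A(_{sigma^-1} k, A)
                                           = Ext^d_A(k, A)
   acts.  Let P be a projective resolution of k.  The first map sends the class
   of f : P_d -> A to that of sigma o f : P_d -> _sigma A, and the second one
   reads sigma o f as an A-linear map _{sigma^-1} P_d -> A.  The last one is the
   pull-back along a morphism of resolutions phi : P -> _{sigma^-1} P over the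
   identity of k = _{sigma^-1} k, that is phi(sigma(a) x) = a phi(x). *)
Definition hdet_scalar (d : nat) (sigma : A -> A) (c : k) : Prop :=
  exists (P : resolution (trivial_module A)) (phi : forall n, P n -> P n),
    [/\ forall n x y, phi n (x + y) = phi n x + phi n y,
        forall n (a : A) x, phi n (sigma a *: x) = a *: phi n x,
        forall n x, phi n (res_diff P n x) = res_diff P n (phi n.+1 x),
        forall x, res_aug P (phi 0%N x) = res_aug P x
      & forall f : P d -> A^o, cocycle f ->
          coboundary
            (fun x => (sigma (f (phi d x)) - c *: (f x : A) : A) : A^o)].

(* Meaningful when A is Artin-Schelter regular of dimension d and sigma is a
   graded automorphism: Ext^d_A(k, A) is then one-dimensional and exactly one
   scalar, which is non-zero, satisfies [hdet_scalar]. *)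
Definition hdet (d : nat) (sigma : A -> A) : k :=
  (xget 0 (hdet_scalar d sigma))^-1.

End Hdet.

(* Main.v *)
(* Write [R = D (x) A^op], so that [D^e -> R -> A^e] are the quotients by the normal
   regular elements [1 (x) Omega] and [Omega (x) 1]. A finite graded free resolution of
   [A] over [A^e] lifts to matrices over [R] whose consecutive products are multiples of
   [Omega (x) 1]; the mapping cone of this element, twisted by [tau], is a free resolution
   of [A] over [R], one step longer, whose dual has the original cohomology shifted by
   one. By graded Nakayama for [1 (x) Omega] it lifts to a resolution of [D] over [D^e]
   with the same ranks, whose dual has cohomology in degree [d + 1] only.
   That cohomology has a homogeneous generator [e], free over [1 (x) D], and
   [e (a (x) 1) = e (1 (x) mu a)] defines a graded endomorphism [mu] of [D] lifting
   [(tau nu_A)^-1]. As [deg Omega >= 2], [D] and [A] agree in degree one, so [mu] is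
   surjective, hence bijective; it scales [Omega], and [nu_D = mu^-1]. Comparing
   resolutions shows that [d] and [nu] are unique.
   For (3), tensoring the resolution of [A] with [k] resolves [k] over [A], and the cone
   along [Omega] resolves [k] over [D]. A semilinear lift of [sigma] to the cone is block
   triangular, with corner [lambda^-1] times the lift for [A]; this compares the scalars
   defining the two homological determinants. *)
Require Import Defs.
From HB Require Import structures.
From mathcomp Require Import all_boot all_order all_algebra generic_quotient ring_quotient.
From mathcomp Require Import boolp classical_sets zify.

Set Implicit Arguments.
Unset Strict Implicit.
Unset Printing Implicit Defensive.

Import Order.TTheory GRing.Theory Num.Theory.
Local Open Scope ring_scope.

(** The two normal elements behave differently. Undoing the quotient by [Omega (x) 1] enlarges the
    ring under the same module [A], which costs one step of length. Undoing the quotient by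
    [1 (x) Omega] also replaces [A] by [D], on which this element acts as the regular right
    multiplication by [Omega], so the length is kept. As [Omega] is not central, multiplication by
    it commutes with matrices only up to [tau]; this twist of the cone is the source of [tau] in
    (1). The intermediate ring is given no grading: homogeneous matrices are chosen over [D^e], and
    their images in that ring satisfy the equations. That [Omega (x) 1] is still regular there rests
    on linear complements over the field. Since [hdet] is defined by choosing a scalar, (3) also
    requires that at most one scalar exists for [A]; this needs a nonzero class in [Ext^d_A(k, A)],
    found by contracting the dual complex above degree [d] compatibly with the second tensor
    factor. *)

Lemma big_supported (I : choiceType) (M : zmodType) (f : I -> M) (r u : seq I) :
  uniq r -> uniq u -> {subset r <= u} -> (forall j, j \notin r -> f j = 0) ->
  \sum_(j <- r) f j = \sum_(j <- u) f j.
Proof.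
move=> ur uu ru f0; rewrite [RHS](bigID (mem r) predT) /= [X in _ + X]big1 ?addr0.
  rewrite -[RHS]big_filter; apply: perm_big; apply: uniq_perm => //.
    by rewrite filter_uniq.
  by move=> j; rewrite mem_filter; case jr: (j \in r) => //=; rewrite ru.
by move=> j; apply: f0.
Qed.

Lemma big_supportedD (I : choiceType) (M : zmodType) (f g : I -> M) (r t : seq I) :
  uniq r -> uniq t -> (forall j, j \notin r -> f j = 0) ->
  (forall j, j \notin t -> g j = 0) ->
  \sum_(j <- undup (r ++ t)) (f j + g j) = \sum_(j <- r) f j + \sum_(j <- t) g j.
Proof.
move=> ur ut f0 g0; rewrite big_split /=.
by congr (_ + _); apply/esym/big_supported; rewrite ?undup_uniq // => j hj;
  rewrite mem_undup mem_cat hj ?orbT.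
Qed.

(** * Homogeneous components in a direct sum *)

Section DirectSum.
Variables (I : choiceType) (M : zmodType) (H : I -> M -> Prop).
Hypothesis hH : direct_sum H.

Lemma dsum0 i : H i 0. Proof. by have [] := hH. Qed.
Lemma dsumB i x y : H i x -> H i y -> H i (x - y).
Proof. by have [_ h _ _] := hH; apply: h. Qed.
Lemma dsumN i x : H i x -> H i (- x).
Proof. by move=> h; rewrite -sub0r; apply: dsumB => //; apply: dsum0. Qed.
Lemma dsumD i x y : H i x -> H i y -> H i (x + y).
Proof. by move=> hx hy; rewrite -[y]opprK; apply: dsumB => //; apply: dsumN. Qed.
Lemma dsum_sum i (J : Type) (r : seq J) (P : pred J) (f : J -> M) :
  (forall j, P j -> H i (f j)) -> H i (\sum_(j <- r | P j) f j).
Proof.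
move=> h; apply: (@big_ind _ (H i)) => //; first exact: dsum0.
by move=> x y; apply: dsumD.
Qed.
Lemma dsumMn i x n : H i x -> H i (x *+ n).
Proof.
by move=> h; elim: n => [|n IH]; rewrite ?mulr0n ?mulrS; [apply: dsum0|apply: dsumD].
Qed.

Lemma dsum_decomposition x : exists g : I -> M,
  (forall i, H i (g i)) /\
  exists s : seq I, [/\ uniq s, forall i, i \notin s -> g i = 0
                      & x = \sum_(i <- s) g i].
Proof.
have [_ _ hdec _] := hH; have [s [f [hf ->]]] := hdec x.
(* The given sequence may repeat an index, so each term is weighted by its multiplicity. *)
exists (fun i => f i *+ count_mem i s); split=> [i|]; first exact: dsumMn.
exists (undup s); split; first exact: undup_uniq.
  by move=> i; rewrite mem_undup => /count_memPn->.
rewrite -(big_undup_iterop_count _ s); apply: eq_bigr => i _.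
by rewrite /GRing.natmul; case: (count _ _).
Qed.

Definition hcomp (i : I) (x : M) : M := projT1 (cid (dsum_decomposition x)) i.

Lemma hcompP i x : H i (hcomp i x).
Proof. by rewrite /hcomp; case: cid => g []. Qed.

Lemma hcomp_sum x : exists s : seq I,
  [/\ uniq s, forall i, i \notin s -> hcomp i x = 0
    & x = \sum_(i <- s) hcomp i x].
Proof. by rewrite /hcomp; case: cid => g []. Qed.

Lemma hcomp_unique (g : I -> M) (s : seq I) x :
  (forall i, H i (g i)) -> uniq s -> (forall i, i \notin s -> g i = 0) ->
  x = \sum_(i <- s) g i -> forall i, hcomp i x = g i.
Proof.
move=> hg us g0 xE i; have [_ _ _ hind] := hH.
have [t [ut t0 xE']] := hcomp_sum x.
pose u := undup (t ++ s).
have e : \sum_(j <- u) (hcomp j x - g j) = 0.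
  rewrite (@big_supportedD _ _ (hcomp^~ x) (\- g)) // => [|j js].
    by rewrite -xE' sumrN -xE subrr.
  by rewrite /= g0 ?oppr0.
have [iu|iu] := boolP (i \in u).
  apply/eqP; rewrite -subr_eq0; apply/eqP.
  apply: (hind u (fun j => hcomp j x - g j)) => //; first exact: undup_uniq.
  by move=> j; apply: dsumB => //; apply: hcompP.
by move: iu; rewrite mem_undup mem_cat negb_or => /andP[/t0-> /g0->].
Qed.

Lemma hcomp_hom i j x : H j x -> hcomp i x = if i == j then x else 0.
Proof.
move=> hx; apply: (@hcomp_unique (fun i => if i == j then x else 0) [:: j]) => //.
- by move=> l; case: eqP => [->|_] //; apply: dsum0.
- by move=> l; rewrite inE => /negPf->.
- by rewrite big_seq1 eqxx.
Qed.

Lemma hcomp_id i x : H i x -> hcomp i x = x.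
Proof. by move=> /hcomp_hom->; rewrite eqxx. Qed.

Lemma hcomp_neq i j x : H j x -> i != j -> hcomp i x = 0.
Proof. by move=> /hcomp_hom-> /negPf->. Qed.

Lemma hcomp0 i : hcomp i 0 = 0.
Proof. by apply: hcomp_id; apply: dsum0. Qed.

Lemma hcompD i x y : hcomp i (x + y) = hcomp i x + hcomp i y.
Proof.
have [s [us s0 xE]] := hcomp_sum x; have [t [ut t0 yE]] := hcomp_sum y.
rewrite (@hcomp_unique (fun j => hcomp j x + hcomp j y) (undup (s ++ t))) //.
- by move=> j; apply: dsumD; apply: hcompP.
- exact: undup_uniq.
- by move=> j; rewrite mem_undup mem_cat negb_or => /andP[/s0-> /t0->]; rewrite addr0.
- by rewrite big_supportedD -?xE -?yE.
Qed.

Lemma hcompN i x : hcomp i (- x) = - hcomp i x.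
Proof. by apply: (addrI (hcomp i x)); rewrite -hcompD !subrr hcomp0. Qed.

Lemma hcompB i x y : hcomp i (x - y) = hcomp i x - hcomp i y.
Proof. by rewrite hcompD hcompN. Qed.

Lemma hcomp_bigsum i (J : Type) (r : seq J) (P : pred J) (f : J -> M) :
  hcomp i (\sum_(j <- r | P j) f j) = \sum_(j <- r | P j) hcomp i (f j).
Proof.
by apply: (big_morph (hcomp i)); [move=> x y; apply: hcompD|apply: hcomp0].
Qed.

Lemma hcomp_eq0 x : (forall i, hcomp i x = 0) -> x = 0.
Proof. by move=> h; have [s [_ _ xE]] := hcomp_sum x; rewrite xE big1. Qed.

Lemma dsum_ind (Q : M -> Prop) :
  Q 0 -> (forall x y, Q x -> Q y -> Q (x + y)) -> (forall i x, H i x -> Q x) ->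
  forall x, Q x.
Proof.
move=> Q0 QD QH x; have [s [_ _ ->]] := hcomp_sum x.
by apply: big_ind => // i _; apply: (QH i); apply: hcompP.
Qed.

End DirectSum.

(** Injectivity of [s] keeps different components of [x] in different degrees. In the applications
    [s] is a shift for multiplications and actions, and the identity for graded maps. *)
Lemma hcomp_map (I J : choiceType) (M N : zmodType) (H : I -> M -> Prop)
    (K : J -> N -> Prop) (hH : direct_sum H) (hK : direct_sum K)
    (phi : M -> N) (s : I -> J) :
  {morph phi : x y / x + y} -> injective s ->
  (forall i x, H i x -> K (s i) (phi x)) ->
  forall i x, hcomp hK (s i) (phi x) = phi (hcomp hH i x).
Proof.
move=> phiD sI hphi i x.
have phi0 : phi 0 = 0 by apply: (addrI (phi 0)); rewrite -phiD !addr0.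
have [r [ur r0 xE]] := hcomp_sum hH x.
rewrite [in LHS]xE (big_morph phi phiD phi0) hcomp_bigsum.
have h j : hcomp hK (s i) (phi (hcomp hH j x)) =
    if j == i then phi (hcomp hH i x) else 0.
  have [->|ji] := eqVneq j i; first by rewrite (hcomp_id hK) //; apply: hphi; apply: hcompP.
  apply: (hcomp_neq hK (hphi _ _ (hcompP hH j x))).
  by apply: contra_neq ji => /sI->.
rewrite (eq_bigr _ (fun j _ => h j)) -big_mkcond /=.
have [ir|ir] := boolP (i \in r).
  by rewrite -big_filter filter_pred1_uniq // big_seq1.
rewrite (r0 _ ir) phi0 big1_seq // => j /andP[/eqP-> jr].
Qed.

(** * Linear algebra over a field, and bundled morphisms *)

Lemma make_linear (R : nzRingType) (U V : lmodType R) (f : U -> V) :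
  linear f -> exists g : {linear U -> V}, g =1 f.
Proof.
move=> fL; pose fm := GRing.isLinear.Build R U V *:%R f fL.
by pose g : {linear U -> V} := HB.pack f fm; exists g.
Qed.

Section LinearSplitting.
Variables (k : fieldType) (V : lmodType k).

(** Zorn's lemma gives a maximal linear set [U] meeting [W] only in 0. A vector outside [W + U]
    could be added to [U], so [U] is a complement of [W]. *)
Lemma subspace_projector (W : V -> Prop) :
  W 0 -> (forall c x y, W x -> W y -> W (c *: x + y)) ->
  exists p : {linear V -> V}, (forall x, W (p x)) /\ (forall x, W x -> p x = x).
Proof.
move=> W0 WL.
have WB x y : W x -> W y -> W (x - y).
  by move=> hx hy; have := WL (-1) _ _ hy hx; rewrite scaleN1r addrC.
pose P (U : set V) := (forall x, U x -> W x -> x = 0) /\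
  (forall c x y, U x -> U y -> U (c *: x + y)).
have [U [[U1 U2] Umax]] : exists U, P U /\ forall B, (U `<` B)%classic -> ~ P B.
  apply: Zorn_bigcup => F FP tot; split.
    by move=> x [X FX Xx] Wx; have [h _] := FP _ FX; apply: h.
  move=> c x y [X FX Xx] [Y FY Yy].
  have [XY|YX] := tot _ _ FX FY.
    by exists Y => //; have [_ h] := FP _ FY; apply: h => //; apply: XY.
  by exists X => //; have [_ h] := FP _ FX; apply: h => //; apply: YX.
(* [P] holds for the empty set, as the union of the empty chain demands, so [U 0] has to come from
   maximality. *)
have U0 : U 0.
  apply: contrapT => nU; have nU' x : ~ U x.
    by move=> Ux; apply: nU; have := U2 (-1) _ _ Ux Ux; rewrite scaleN1r addNr.
  apply: (Umax [set 0]%classic).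
    by split=> [x /nU'//|h]; apply: nU; apply: h.
  by split=> [x -> //|c x y -> ->]; rewrite scaler0 addr0.
have UB x y : U x -> U y -> U (x - y).
  by move=> hx hy; have := U2 (-1) _ _ hy hx; rewrite scaleN1r addrC.
have dec x : exists w, W w /\ U (x - w).
  apply: contrapT => nx.
  have xU : ~ U x by move=> Ux; apply: nx; exists 0; rewrite subr0.
  pose B : set V := [set z | exists c u, U u /\ z = c *: x + u]%classic.
  apply: (Umax B).
    split=> [u Uu|h]; first by exists 0, u; rewrite scale0r add0r.
    by apply/xU/h; exists 1, 0; rewrite scale1r addr0.
  split=> [z [c [u [Uu ->]]] Wz|c z z' [d [u [Uu ->]]] [d' [u' [Uu' ->]]]].
    have [c0|c0] := eqVneq c 0.
      by move: Wz; rewrite c0 scale0r add0r; apply: U1.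
    case: nx; exists (c^-1 *: (c *: x + u)); split.
      by have := WL c^-1 _ _ Wz W0; rewrite addr0.
    rewrite scalerDr scalerA mulVf // scale1r opprD addrA subrr add0r -scaleNr.
    by have := U2 (- c^-1) _ _ Uu U0; rewrite addr0.
  exists (c * d + d'), (c *: u + u'); split; first exact: U2.
  by rewrite scalerDr scalerA scalerDl addrACA.
pose p x := projT1 (cid (dec x)).
have pW x : W (p x) by rewrite /p; case: cid => w [].
have pU x : U (x - p x) by rewrite /p; case: cid => w [].
have pE x w : W w -> U (x - w) -> p x = w.
  move=> Ww Ux; apply/eqP; rewrite -subr_eq0; apply/eqP/U1; last exact: WB.
  have -> : p x - w = (x - w) - (x - p x) by rewrite opprB [RHS]addrC addrA subrK.
  exact: UB.
have pL : linear p.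
  move=> c x y; apply: pE; first exact: WL.
  by rewrite opprD addrACA -scalerBr; apply: U2.
have [pl plE] := make_linear pL.
by exists pl; split=> x; rewrite plE // => Wx; apply: pE; rewrite ?subrr.
Qed.

End LinearSplitting.

(** Removing from any preimage its projection on the kernel of [g] makes it independent of the
    choice, hence linear in [u]. *)
Lemma linear_lifting (k : fieldType) (U X Y : lmodType k) (g : {linear Y -> X})
    (f : {linear U -> X}) :
  (forall u, exists y, g y = f u) ->
  exists h : {linear U -> Y}, forall u, g (h u) = f u.
Proof.
move=> hs.
have [||p [pW pid]] := @subspace_projector k Y (fun y => g y = 0).
- by rewrite linear0.
- by move=> c x y gx gy; rewrite linearP gx gy scaler0 addr0.
pose y0 u := projT1 (cid (hs u)).
have y0E u : g (y0 u) = f u by rewrite /y0; case: cid.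
pose h u := y0 u - p (y0 u).
have hE u y : g y = f u -> h u = y - p y.
  move=> gy; rewrite /h; apply/eqP; rewrite subr_eq addrAC -addrA addrC -subr_eq.
  by rewrite -linearB; apply/eqP/esym/pid; rewrite linearB /= gy y0E subrr.
have hL : linear h.
  move=> c u v; rewrite (hE _ (c *: y0 u + y0 v)).
    by rewrite linearP opprD addrACA -scalerBr.
  by rewrite !linearP !y0E.
have [hl hlE] := make_linear hL.
by exists hl => u; rewrite hlE linearB /= pW subr0.
Qed.

Lemma make_rmorphism (R S : nzRingType) (f : R -> S) :
  (forall x y, f (x + y) = f x + f y) -> (forall x y, f (x * y) = f x * f y) ->
  f 1 = 1 -> exists g : {rmorphism R -> S}, g =1 f.
Proof.
move=> fD fM f1.
have fB : zmod_morphism f.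
  by move=> x y; apply/eqP; rewrite eq_sym subr_eq -fD subrK.
pose m1 := GRing.isZmodMorphism.Build R S f fB.
pose m2 := GRing.isMonoidMorphism.Build R S f (conj f1 fM).
pose g : {rmorphism R -> S} := HB.pack f m1 m2.
by exists g.
Qed.

Lemma make_lrmorphism (k : fieldType) (A B : algType k) (f : {rmorphism A -> B}) :
  (forall c : k, f c%:A = c%:A) -> exists g : {lrmorphism A -> B}, g =1 f.
Proof.
move=> fc.
have fZ : scalable f by move=> c x; rewrite -mulr_algl rmorphM fc mulr_algl.
pose m := GRing.isScalable.Build k A B *:%R f fZ.
pose g : {lrmorphism A -> B} := HB.pack (GRing.RMorphism.sort f) m.
by exists g.
Qed.

Lemma factor_rmorphism (R S T : nzRingType) (p : {rmorphism R -> S})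
    (f : {rmorphism R -> T}) :
  (forall a, exists x, p x = a) -> (forall x, p x = 0 -> f x = 0) ->
  exists g : {rmorphism S -> T}, forall x, g (p x) = f x.
Proof.
move=> ps pf; pose s a := projT1 (cid (ps a)).
have sE a : p (s a) = a by rewrite /s; case: cid.
have h x : f (s (p x)) = f x.
  by apply/eqP; rewrite -subr_eq0 -rmorphB; apply/eqP/pf; rewrite rmorphB /= sE subrr.
have [|||g gE] := @make_rmorphism S T (f \o s).
- by move=> x y /=; rewrite -rmorphD -[RHS]h rmorphD !sE.
- by move=> x y /=; rewrite -rmorphM -[RHS]h rmorphM !sE.
- by rewrite /= -(rmorph1 p) h rmorph1.
by exists g => x; rewrite gE /= h.
Qed.

Lemma factor_lrmorphism (k : fieldType) (A B C : algType k)
    (p : {lrmorphism A -> B}) (f : {lrmorphism A -> C}) :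
  (forall a, exists x, p x = a) -> (forall x, p x = 0 -> f x = 0) ->
  exists g : {lrmorphism B -> C}, forall x, g (p x) = f x.
Proof.
move=> ps pf; have [g gE] := factor_rmorphism ps pf.
have [|g' g'E] := @make_lrmorphism _ _ _ g.
  by move=> c; rewrite -(rmorph_alg p) gE; apply: (rmorph_alg f).
by exists g' => x; rewrite g'E gE.
Qed.

Lemma inverse_lrmorphism (k : fieldType) (A B : algType k)
    (f : {lrmorphism A -> B}) :
  bijective f -> exists g : {lrmorphism B -> A}, cancel f g /\ cancel g f.
Proof.
move=> [f' fK f'K].
have [||g gE] := @factor_lrmorphism _ _ _ _ f (idfun : {lrmorphism A -> A}).
- by move=> a; exists (f' a).
- by move=> x fx; apply: (can_inj fK); rewrite fx rmorph0.
by exists g; split=> // x; rewrite -[x]f'K gE.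
Qed.

(** Normality provides the factors and regularity makes them unique, which forces additivity and
    multiplicativity. *)
Lemma normal_automorphism (R : nzRingType) (w : R) :
  normal_elt w -> regular_elt w ->
  exists theta theta' : {rmorphism R -> R},
    [/\ cancel theta theta', cancel theta' theta
      & forall x, w * x = theta x * w].
Proof.
move=> [nl nr] [wl wr].
pose f x := projT1 (cid (nl x)); pose f' x := projT1 (cid (nr x)).
have fE x : w * x = f x * w by rewrite /f; case: cid.
have f'E x : x * w = w * f' x by rewrite /f'; case: cid.
have [|||t tE] := @make_rmorphism R R f.
- by move=> x y; apply: wr; rewrite /= mulrDl -!fE mulrDr.
- by move=> x y; apply: wr; rewrite /= -fE -[RHS]mulrA -fE [RHS]mulrA -fE mulrA.
- by apply: wr; rewrite /= -fE mulr1 mul1r.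
have [|||t' t'E] := @make_rmorphism R R f'.
- by move=> x y; apply: wl; rewrite /= mulrDr -!f'E mulrDl.
- by move=> x y; apply: wl; rewrite /= -f'E [RHS]mulrA -f'E -[RHS]mulrA -f'E mulrA.
- by apply: wl; rewrite /= -f'E mulr1 mul1r.
exists t, t'; split.
- by move=> x; rewrite tE t'E; apply: wl; rewrite /= -f'E fE.
- by move=> x; rewrite tE t'E; apply: wr; rewrite /= -fE f'E.
- by move=> x; rewrite tE.
Qed.

(** * The quotient of a ring by a two-sided ideal *)

Section QuotientRing.
Variables (R : nzRingType) (I : R -> Prop).
Hypotheses (IB : forall x y, I x -> I y -> I (x - y))
  (IMl : forall a x, I x -> I (a * x)) (IMr : forall a x, I x -> I (x * a))
  (I1 : ~ I 1) (I0 : I 0).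

Definition ideal_pred : {pred R} := fun x => `[< I x >].
Fact ideal_zmod_closed : zmod_closed ideal_pred.
Proof.
split=> [|x y /asboolP hx /asboolP hy]; apply/asboolP => //; exact: IB.
Qed.
HB.instance Definition _ := GRing.isZmodClosed.Build R ideal_pred ideal_zmod_closed.
Definition ideal_quotient : Type := Quotient.quot ideal_pred.
HB.instance Definition _ := GRing.Zmodule.on ideal_quotient.

Let p (x : R) : ideal_quotient := (\pi_(Quotient.quot ideal_pred) x)%qT.
Let pD x y : p (x + y) = p x + p y. Proof. exact: Quotient.pi_add. Qed.
Let p0 : p 0 = 0. Proof. by apply: (addrI (p 0)); rewrite -pD !addr0. Qed.
Let pE x y : p x = p y <-> I (x - y).
Proof.
split=> [/eqP|h]; first by rewrite -[_ == _]Quotient.idealrBE => /asboolP.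
by apply/eqP; rewrite -[_ == _]Quotient.idealrBE; apply/asboolP.
Qed.
Let pS a : exists x, p x = a.
Proof. by exists (repr a); rewrite /p reprK. Qed.

Definition iq_mul (a b : ideal_quotient) : ideal_quotient := p (repr a * repr b).

Let mulE x y : iq_mul (p x) (p y) = p (x * y).
Proof.
apply/pE.
have -> : repr (p x) * repr (p y) - x * y =
    (repr (p x) - x) * repr (p y) - x * (y - repr (p y)).
  by rewrite mulrBl mulrBr opprB addrA subrK.
by apply: IB; [apply: IMr|apply: IMl]; apply/pE; rewrite /p reprK.
Qed.

Fact iq_mulA : associative iq_mul.
Proof.
by move=> a b c; have [x <-] := pS a; have [y <-] := pS b; have [z <-] := pS c;
  rewrite !mulE mulrA.
Qed.
Fact iq_mul1l : left_id (p 1) iq_mul.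
Proof. by move=> a; have [x <-] := pS a; rewrite mulE mul1r. Qed.
Fact iq_mul1r : right_id (p 1) iq_mul.
Proof. by move=> a; have [x <-] := pS a; rewrite mulE mulr1. Qed.
Fact iq_mulDl : left_distributive iq_mul +%R.
Proof.
by move=> a b c; have [x <-] := pS a; have [y <-] := pS b; have [z <-] := pS c;
  rewrite -pD !mulE mulrDl pD.
Qed.
Fact iq_mulDr : right_distributive iq_mul +%R.
Proof.
by move=> a b c; have [x <-] := pS a; have [y <-] := pS b; have [z <-] := pS c;
  rewrite -pD !mulE mulrDr pD.
Qed.
Fact iq_one_neq0 : p 1 != 0.
Proof.
by rewrite -p0; apply/eqP => /pE; rewrite subr0.
Qed.
HB.instance Definition _ := GRing.Zmodule_isNzRing.Build ideal_quotient
  iq_mulA iq_mul1l iq_mul1r iq_mulDl iq_mulDr iq_one_neq0.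

Lemma quotient_ring_exists : exists (S : nzRingType) (q : {rmorphism R -> S}),
  (forall a, exists x, q x = a) /\ (forall x, q x = 0 <-> I x).
Proof.
have [|||q qE] := @make_rmorphism R ideal_quotient p.
- exact: pD.
- by move=> x y; rewrite -mulE.
- by [].
exists ideal_quotient, q; split=> [a|x]; first by have [x <-] := pS a; exists x.
by rewrite qE -p0 pE subr0.
Qed.

End QuotientRing.

(** The additive operators [T] play the part of the projections, so they need checking on
    homogeneous elements only. The gradings of tensors, matrices and free modules below are obtained
    in this way. *)
Lemma direct_sum_intro (I : choiceType) (M : zmodType) (H : I -> M -> Prop)
    (T : I -> M -> M) :
  (forall i, H i 0) -> (forall i x y, H i x -> H i y -> H i (x - y)) ->
  (forall Q : M -> Prop, Q 0 -> (forall x y, Q x -> Q y -> Q (x + y)) ->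
     (forall i x, H i x -> Q x) -> forall x, Q x) ->
  (forall i, {morph T i : x y / x + y}) ->
  (forall i x, H i x -> T i x = x) ->
  (forall i j x, H j x -> i != j -> T i x = 0) -> direct_sum H.
Proof.
move=> h0 hB hind TD Tid Tneq.
have hD i x y : H i x -> H i y -> H i (x + y).
  by move=> hx hy; rewrite -[y]opprK; apply: (hB) => //; rewrite -sub0r; apply: hB.
have T0 i : T i 0 = 0 by apply: Tid.
split=> //.
  suff hT x : exists s : seq I, [/\ uniq s, forall i, H i (T i x),
      forall i, i \notin s -> T i x = 0 & x = \sum_(i <- s) T i x].
    by move=> x; have [s [_ hs _ sE]] := hT x; exists s, (T^~ x).
  move: x; apply: hind => [|x y [s [us Hs s0 sE]] [t [ut Ht t0 tE]]|i x hx].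
  - by exists [::]; split=> [|i|i|] //; rewrite ?T0 ?big_nil.
  - exists (undup (s ++ t)); split=> [|i|i|]; first exact: undup_uniq.
    + by rewrite TD; apply: hD.
    + by rewrite mem_undup mem_cat negb_or TD => /andP[/s0-> /t0->]; rewrite addr0.
    by rewrite (eq_bigr _ (fun i _ => TD i x y)) big_supportedD -?sE -?tE.
  - exists [:: i]; split=> // [j|j|]; last by rewrite big_seq1 Tid.
      by have [->|ji] := eqVneq j i; [rewrite Tid|rewrite (Tneq _ _ _ hx)].
    by rewrite inE => ji; apply: Tneq hx ji.
move=> s f us hf e i is_.
have := congr1 (T i) e; rewrite T0 (big_morph (T i) (TD i) (T0 i)).
rewrite (bigD1_seq i) //= Tid // big1 ?addr0 // => j ji.
by apply: Tneq (hf j) _; rewrite eq_sym.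
Qed.

(** * The enveloping algebra and its universal property *)

Section Enveloping.
Variables (k : fieldType) (A : algType k).
Implicit Types t u v : enveloping A.

Lemma tensorDl (a a' b : A) : tensor (a + a') b = tensor a b + tensor a' b.
Proof.
apply: tensorP => V f hf.
by rewrite (tliftD hf) !tlift_tensor // bilinDl.
Qed.
Lemma tensorDr (a b b' : A) : tensor a (b + b') = tensor a b + tensor a b'.
Proof.
apply: tensorP => V f hf.
by rewrite (tliftD hf) !tlift_tensor // bilinDr.
Qed.
Lemma tensorM (a b a' b' : A) :
  tensor a b * tensor a' b' = tensor (a * a') (b' * b).
Proof.
apply: tensorP => V f hf; rewrite [LHS]tliftM //.
rewrite tlift_tensor; last exact: bilin_outer.
by rewrite !tlift_tensor //; apply: bilin_inner.
Qed.
Lemma tensor0l (b : A) : tensor 0 b = 0.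
Proof. by apply: (addrI (tensor 0 b)); rewrite -tensorDl !addr0. Qed.
Lemma tensor0r (a : A) : tensor a 0 = 0.
Proof. by apply: (addrI (tensor a 0)); rewrite -tensorDr !addr0. Qed.
Lemma tensorNl (a b : A) : tensor (- a) b = - tensor a b.
Proof. by apply: (addrI (tensor a b)); rewrite -tensorDl !subrr tensor0l. Qed.
Lemma tensorZ (c : k) (a b : A) : tensor (c *: a) b = tensor a (c *: b).
Proof.
apply: tensorP => V f hf; rewrite !tlift_tensor //.
have f0r : f a 0 = 0 by apply: (addrI (f a 0)); rewrite -(bilinDr hf) !addr0.
have hl := hf.1 b c a 0; have hr := hf.2 a c b 0.
by move: hl hr; rewrite !addr0 (bilin0l hf) f0r !addr0 => -> ->.
Qed.

Lemma env_ind (Q : enveloping A -> Prop) :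
  Q 0 -> (forall t u, Q t -> Q u -> Q (t + u)) -> (forall a b, Q (tensor a b)) ->
  forall t, Q t.
Proof. by move=> Q0 QD QT t; rewrite [t]tensor_sum; apply: big_ind. Qed.

(** Scalars act through the first factor; by [tensorZ] the second factor gives the same action. *)
Definition env_scale (c : k) t : enveloping A := tensor c%:A 1 * t.
Fact env_scaleA a b t : env_scale a (env_scale b t) = env_scale (a * b) t.
Proof. by rewrite /env_scale mulrA tensorM mulr1 -scalerAl mul1r scalerA. Qed.
Fact env_scale1 : left_id 1 env_scale.
Proof. by move=> t; rewrite /env_scale scale1r [_ * _]tmul1l. Qed.
Fact env_scaleDr : right_distributive env_scale +%R.
Proof. by move=> c t u; rewrite /env_scale mulrDr. Qed.
Fact env_scaleDl t : {morph env_scale^~ t : a b / a + b}.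
Proof. by move=> a b; rewrite /env_scale scalerDl tensorDl mulrDl. Qed.
HB.instance Definition _ := GRing.Zmodule_isLmodule.Build k (enveloping A)
  env_scaleA env_scale1 env_scaleDr env_scaleDl.

Lemma env_scaleE (c : k) t : c *: t = tensor c%:A 1 * t. Proof. by []. Qed.
Lemma tensorZl (c : k) (a b : A) : tensor (c *: a) b = c *: tensor a b.
Proof. by rewrite env_scaleE tensorM mulr1 -scalerAl mul1r. Qed.
Lemma tensorZr (c : k) (a b : A) : tensor a (c *: b) = c *: tensor a b.
Proof. by rewrite -tensorZ tensorZl. Qed.
Lemma env_one : tensor 1 1 = 1 :> enveloping A. Proof. by []. Qed.
Lemma tensor_sumr (I : Type) (r : seq I) (P : pred I) a (f : I -> A) :
  tensor a (\sum_(i <- r | P i) f i) = \sum_(i <- r | P i) tensor a (f i).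
Proof. by apply: (big_morph (tensor a)); [move=> x y; apply: tensorDr|apply: tensor0r]. Qed.

Lemma tensor_lift (V : lmodType k) (f : A -> A -> V) : bilinear_map f ->
  exists g : {linear enveloping A -> V}, forall a b, g (tensor a b) = f a b.
Proof.
move=> hf.
have gD : {morph tlift f : t u / t + u} by move=> t u; apply: tliftD.
have g0 : tlift f 0 = 0 by apply: (addrI (tlift f 0)); rewrite -gD !addr0.
have gL : linear (tlift f).
  move=> c t u; rewrite gD; congr (_ + _); elim/env_ind: t => [|t v ht hv|a b].
  - by rewrite scaler0 g0 scaler0.
  - by rewrite scalerDr !gD ht hv scalerDr.
  - rewrite -tensorZl !tlift_tensor //.
    by have := hf.1 b c a 0; rewrite (bilin0l hf) !addr0.
have [g gE] := make_linear gL.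
by exists g => a b; rewrite gE; apply: tlift_tensor.
Qed.

Lemma env_rmorphism (S : nzRingType) (h : enveloping A -> S) :
  (forall x y, h (x + y) = h x + h y) ->
  (forall a b a' b', h (tensor (a * a') (b' * b)) = h (tensor a b) * h (tensor a' b')) ->
  h (tensor 1 1) = 1 -> exists h' : {rmorphism enveloping A -> S}, h' =1 h.
Proof.
move=> hD hM h1; have h0 : h 0 = 0 by apply: (addrI (h 0)); rewrite -hD !addr0.
apply: make_rmorphism => // t u; elim/env_ind: t => [|t v ht hv|a b].
- by rewrite !(mul0r, h0).
- by rewrite mulrDl !hD ht hv mulrDl.
elim/env_ind: u => [|t v ht hv|a' b'].
- by rewrite !(mulr0, h0).
- by rewrite mulrDr !hD ht hv mulrDr.
- by rewrite tensorM hM.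
Qed.

Lemma tensor_scale (a b : A) (x : regular_bimodule A) :
  (tensor a b *: x : regular_bimodule A) = a * (x : A) * b :> A.
Proof.
by rewrite -[_ *: x]/(bimod_scale _ _) /bimod_scale tlift_tensor //; apply: mul_bilinear.
Qed.

End Enveloping.

Lemma tensor_map (k : fieldType) (A B : algType k) (f g : {linear A -> B}) :
  exists h : {linear enveloping A -> enveloping B},
    forall a b, h (tensor a b) = tensor (f a) (g b).
Proof.
apply: (@tensor_lift _ _ _ (fun a b => tensor (f a) (g b))).
split=> [b|a] c x y /=; rewrite linearP.
  by rewrite tensorDl tensorZl.
by rewrite tensorDr tensorZr.
Qed.

Lemma tensor_rmorphism (k : fieldType) (A B : algType k) (f g : {lrmorphism A -> B}) :
  exists h : {rmorphism enveloping A -> enveloping B},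
    forall a b, h (tensor a b) = tensor (f a) (g b).
Proof.
have [h hE] := tensor_map f g.
have [x y|a b a' b'||h' h'E] := env_rmorphism (h := h); last by exists h' => a b; rewrite h'E hE.
- by rewrite linearD.
- by rewrite !hE tensorM !rmorphM.
- by rewrite hE !rmorph1.
Qed.

(** * Gradings on an algebra and on its enveloping algebra *)

Section Graded.
Variables (k : fieldType) (A : gralg k).

Lemma gcomp1 : gcomp A 0 1.
Proof. by apply/gcomp_connected; exists 1; rewrite scale1r. Qed.

Lemma gcompZ n (c : k) (x : A) : gcomp A n x -> gcomp A n (c *: x).
Proof.
move=> hx; rewrite -mulr_algl -[n]add0n; apply: gcompM => //.
by apply/gcomp_connected; exists c.
Qed.

Local Notation acomp := (hcomp (gcomp_direct A)).

Lemma acompZ n (c : k) x : acomp n (c *: x) = c *: acomp n x.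
Proof.
apply: (@hcomp_map _ _ _ _ _ _ (gcomp_direct A) (gcomp_direct A) ( *:%R c) id) => //.
  by move=> y z; rewrite scalerDr.
by move=> i y; apply: gcompZ.
Qed.

Lemma gcomp_env_tensor i j (a b : A) : gcomp A i a -> gcomp A j b ->
  gcomp_enveloping (i + j)%N%:Z (tensor a b).
Proof.
move=> ha hb; exists [:: (a, b)]; rewrite big_seq1; split=> // p.
by rewrite inE => /eqP->; exists i, j.
Qed.

Lemma gcomp_envD n (t u : enveloping A) : gcomp_enveloping n t -> gcomp_enveloping n u ->
  gcomp_enveloping n (t + u).
Proof.
move=> [s [hs ->]] [r [hr ->]]; exists (s ++ r); rewrite big_cat; split=> // p.
by rewrite mem_cat => /orP[/hs|/hr].
Qed.

Lemma gcomp_envN n (t : enveloping A) : gcomp_enveloping n t -> gcomp_enveloping n (- t).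
Proof.
move=> [s [hs ->]]; exists [seq (- p.1, p.2) | p <- s]; split.
  move=> p /mapP[q /hs[i [j [hi hj e]]] ->]; exists i, j; split=> //=.
  exact: (dsumN (gcomp_direct A)).
by rewrite big_map -sumrN; apply: eq_bigr => p _; rewrite tensorNl.
Qed.

Lemma gcomp_env0 n : gcomp_enveloping n (0 : enveloping A).
Proof. by exists [::]; rewrite big_nil. Qed.

Lemma gcomp_env_ind n (Q : enveloping A -> Prop) :
  Q 0 -> (forall t u, Q t -> Q u -> Q (t + u)) ->
  (forall i j a b, gcomp A i a -> gcomp A j b -> (i + j)%N%:Z = n -> Q (tensor a b)) ->
  forall t, gcomp_enveloping n t -> Q t.
Proof.
move=> Q0 QD QT t [s [hs ->]]; rewrite big_seq; apply: big_ind => // p /hs.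
by move=> [i [j [ha hb e]]]; apply: (QT i j).
Qed.

Lemma gcomp_envM m n (t u : enveloping A) : gcomp_enveloping m t ->
  gcomp_enveloping n u -> gcomp_enveloping (m + n) (t * u).
Proof.
move=> ht hu; elim/gcomp_env_ind: ht => [|x y hx hy|i j a b ha hb <-].
- by rewrite mul0r; apply: gcomp_env0.
- by rewrite mulrDl; apply: gcomp_envD.
elim/gcomp_env_ind: hu => [|x y hx hy|i' j' a' b' ha' hb' <-].
- by rewrite mulr0; apply: gcomp_env0.
- by rewrite mulrDr; apply: gcomp_envD.
rewrite tensorM.
have -> : (i + j)%:Z + (i' + j')%:Z = ((i + i') + (j' + j))%N.
  by rewrite -PoszD [(j' + j)%N]addnC addnACA.
by apply: gcomp_env_tensor; apply: gcompM.
Qed.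

Lemma gcomp_env_neg n (t : enveloping A) : gcomp_enveloping n t -> n < 0 -> t = 0.
Proof.
move=> ht n0; elim/gcomp_env_ind: ht => // [x y -> ->|i j a b ha hb e].
  by rewrite addr0.
by rewrite -e in n0.
Qed.

(** Connectedness makes the degree-zero part a field, so that [A^e] behaves as a graded local ring
    and graded projectives are free. *)
Lemma gcomp_env_scalar (t : enveloping A) : gcomp_enveloping 0 t -> exists c : k, t = c *: (1 : enveloping A).
Proof.
move=> ht; elim/gcomp_env_ind: ht => [|x y [c ->] [d ->]|i j a b ha hb e].
- by exists 0; rewrite scale0r.
- by exists (c + d); rewrite scalerDl.
case: i j ha hb e => [|i] [|j] // /gcomp_connected[c ->] /gcomp_connected[d ->] _.
by exists (d * c); rewrite tensorZl tensorZr scalerA mulrC.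
Qed.

Lemma gcomp_env1 : gcomp_enveloping 0 (1 : enveloping A).
Proof. by rewrite -env_one; apply: (@gcomp_env_tensor 0 0); apply: gcomp1. Qed.

(** The projection on degree [n] sends [x (x) y] to the sum of the [x_i (x) y_(n-i)]; this is
    bilinear and so descends to tensors. *)
Lemma gcomp_env_direct : direct_sum (@gcomp_enveloping k A).
Proof.
pose b (n : nat) (x y : A) : enveloping A :=
  \sum_(i < n.+1) tensor (acomp i x) (acomp (n - i)%N y).
have hb n : bilinear_map (b n).
  split=> [y|x] c z z'; rewrite /b scaler_sumr -big_split /=; apply: eq_bigr => i _.
    by rewrite hcompD acompZ tensorDl tensorZl.
  by rewrite hcompD acompZ tensorDr tensorZr.
pose T (n : int) (t : enveloping A) : enveloping A :=
  if n is Posz n then tlift (b n) t else 0.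
have TD i : {morph T i : t u / t + u}.
  by case: i => i t u /=; rewrite ?addr0 //; apply: tliftD.
have T0 i : T i 0 = 0 by apply: (addrI (T i 0)); rewrite -TD !addr0.
have TE n i j x y : gcomp A i x -> gcomp A j y ->
    T n (tensor x y) = if (i + j)%N%:Z == n then tensor x y else 0.
  move=> hx hy; case: n => n //=; rewrite tlift_tensor // /b.
  case: ifP => [/eqP[<-]|/negP ne].
    have ij : (i < (i + j).+1)%N by rewrite ltnS leq_addr.
    rewrite (bigD1 (Ordinal ij)) //= addKn !hcomp_id // big1 ?addr0 //.
    move=> l li; rewrite (hcomp_neq _ hx) ?tensor0l //.
  rewrite big1 // => l _; have [li|li] := eqVneq (l : nat) i; last first.
    by rewrite (hcomp_neq _ hx) // tensor0l.
  rewrite [acomp (n - l)%N y](hcomp_neq _ hy) ?tensor0r //; apply: contra_not_neq ne => e.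
  by rewrite -e li subnKC // -li -ltnS.
apply: (@direct_sum_intro _ _ _ T) => //.
- exact: gcomp_env0.
- by move=> i x y hx hy; apply: gcomp_envD => //; apply: gcomp_envN.
- move=> Q Q0 QD QH; apply: env_ind => // a c.
  have [s [_ _ ->]] := hcomp_sum (gcomp_direct A) a.
  have [r [_ _ ->]] := hcomp_sum (gcomp_direct A) c.
  elim: s => [|i s IH]; first by rewrite big_nil tensor0l.
  rewrite big_cons tensorDl; apply: (QD) => //; rewrite tensor_sumr.
  apply: (@big_ind _ Q) => // j _; apply: (QH (i + j)%N%:Z).
  by apply: gcomp_env_tensor; apply: hcompP.
- move=> n t ht; elim/gcomp_env_ind: ht => // [x y hx hy|i j a c ha hc e].
    by rewrite TD hx hy.
  by rewrite (TE _ _ _ _ _ ha hc) e eqxx.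
- move=> n n' t ht nn'; elim/gcomp_env_ind: ht => // [x y hx hy|i j a c ha hc e].
    by rewrite TD hx hy addr0.
  by rewrite (TE _ _ _ _ _ ha hc) e eq_sym (negPf nn').
Qed.

End Graded.

Lemma gcomp_env_map (k : fieldType) (A B : gralg k) (f g : A -> B)
    (h : {rmorphism enveloping A -> enveloping B}) n t :
  (forall a b, h (tensor a b) = tensor (f a) (g b)) ->
  (forall i a, gcomp A i a -> gcomp B i (f a)) ->
  (forall i a, gcomp A i a -> gcomp B i (g a)) ->
  gcomp_enveloping n t -> gcomp_enveloping n (h t).
Proof.
move=> hE hf hg; elim/gcomp_env_ind => [|u v hu hv|i j a b ha hb <-].
- by rewrite rmorph0; apply: gcomp_env0.
- by rewrite rmorphD; apply: gcomp_envD.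
- by rewrite hE; apply: gcomp_env_tensor; [apply: hf|apply: hg].
Qed.

Section IntegerGrading.
Variables (k : fieldType) (A : gralg k).

(** With integer degrees every shift is an injection of the index set, as [hcomp_map] requires, also
    for a negative twist [l]. *)
Lemma gcomp_int_direct : direct_sum (@gcomp_int k A).
Proof.
have hA := gcomp_direct A.
apply: (@direct_sum_intro _ _ _ (fun (n : int) x => if n is Posz n then hcomp hA n x else 0)).
- by case=> n //=; apply: (dsum0 hA).
- by case=> n x y /=; [apply: (dsumB hA)|move=> -> ->; rewrite subr0].
- move=> Q Q0 QD QH; apply: (dsum_ind hA) => // i x hx; exact: (QH i%:Z).
- by case=> n x y /=; rewrite ?hcompD ?addr0.
- by case=> n x //= hx; rewrite hcomp_id.
- case=> i [] j x //= hx ij; last by rewrite hx hcomp0.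
  exact: (hcomp_neq hA hx).
Qed.

Lemma gcomp_int_mul i j (x y : A) :
  gcomp_int i x -> gcomp_int j y -> gcomp_int (i + j) (x * y).
Proof.
case: i => i; case: j => j /=; last 3 first.
- by move=> _ ->; rewrite mulr0; apply: (dsum0 gcomp_int_direct).
- by move=> -> _; rewrite mul0r; apply: (dsum0 gcomp_int_direct).
- by move=> -> _; rewrite mul0r.
exact: gcompM.
Qed.

Lemma hcomp_mull n m (x y : A) : gcomp_int n x ->
  hcomp gcomp_int_direct (n + m) (x * y) = x * hcomp gcomp_int_direct m y.
Proof.
move=> hx; apply: (@hcomp_map _ _ _ _ _ _ _ _ ( *%R x) (fun i => n + i)).
- by move=> u v; rewrite mulrDr.
- exact: addrI.
- by move=> i z hz; apply: gcomp_int_mul.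
Qed.

Lemma hcomp_mulr n m (x y : A) : gcomp_int m y ->
  hcomp gcomp_int_direct (n + m) (x * y) = hcomp gcomp_int_direct n x * y.
Proof.
move=> hy; apply: (@hcomp_map _ _ _ _ _ _ _ _ ( *%R^~ y) (fun i => i + m)).
- by move=> u v; rewrite mulrDl.
- exact: addIr.
- by move=> i z hz; apply: gcomp_int_mul.
Qed.

Lemma hcomp_int n (x : A) : hcomp gcomp_int_direct n%:Z x = hcomp (gcomp_direct A) n x.
Proof. by apply: (@hcomp_map _ _ _ _ _ _ (gcomp_direct A) _ id Posz) => // i j []. Qed.

Lemma gcomp_int_neg i (x : A) : i < 0 -> gcomp_int i x -> x = 0.
Proof. by case: i. Qed.

Lemma gcomp_int_scale i j (t : enveloping A) (x : regular_bimodule A) :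
  gcomp_enveloping i t -> gcomp_int j (x : A) -> gcomp_int (i + j) (t *: x : A).
Proof.
move=> ht hx; elim/gcomp_env_ind: ht => [|t' u ht hu|i1 i2 a1 a2 h1 h2 <-].
- by rewrite scale0r; apply: (dsum0 gcomp_int_direct).
- by rewrite scalerDl; apply: (dsumD gcomp_int_direct).
rewrite tensor_scale; have -> : (i1 + i2)%N%:Z + j = (i1%:Z + j) + i2%:Z by lia.
by apply: gcomp_int_mul => //; apply: gcomp_int_mul.
Qed.

Variables (B : gralg k) (f : {lrmorphism A -> B}).
Hypothesis fg : forall n x, gcomp A n x -> gcomp B n (f x).

Lemma gcomp_int_map j x : gcomp_int j x -> gcomp_int j (f x).
Proof. by case: j => j /=; [apply: fg|move=> ->; rewrite rmorph0]. Qed.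

End IntegerGrading.

Lemma hcomp_graded (k : fieldType) (A B : gralg k) (f : {lrmorphism A -> B}) :
  (forall n x, gcomp A n x -> gcomp B n (f x)) ->
  forall n x, hcomp (gcomp_int_direct B) n (f x) = f (hcomp (gcomp_int_direct A) n x).
Proof.
move=> fg n x; apply: (@hcomp_map _ _ _ _ _ _ _ _ f id) => //.
  by move=> u v; rewrite rmorphD.
by move=> j y; apply: gcomp_int_map.
Qed.

Lemma inverse_graded (k : fieldType) (A : gralg k) (sigma sigma' : {lrmorphism A -> A}) :
  cancel sigma sigma' -> cancel sigma' sigma ->
  (forall n a, gcomp A n a -> gcomp A n (sigma a)) ->
  forall n a, gcomp A n a -> gcomp A n (sigma' a).
Proof.
move=> sK s'K sg n a ha.
have -> : sigma' a = hcomp (gcomp_int_direct A) n (sigma' a).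
  by apply: (can_inj sK); rewrite -hcomp_graded // s'K hcomp_id.
exact: (hcompP (gcomp_int_direct A) n).
Qed.

(** * The twisted cone *)

Section Scalars.
Variable R : nzRingType.

Lemma mulmx_scalarE p r (M : 'M[R]_(p, r)) a i j : (M *m a%:M) i j = M i j * a.
Proof.
rewrite mxE (bigD1 j) //= mxE eqxx mulr1n big1 ?addr0 // => l lj.
by rewrite mxE (negPf lj) mulr0n mulr0.
Qed.

Lemma mx_rreg p r (M N : 'M[R]_(p, r)) a :
  GRing.rreg a -> M *m a%:M = N *m a%:M -> M = N.
Proof.
by move=> ra /matrixP e; apply/matrixP => i j; apply: ra; have := e i j; rewrite !mulmx_scalarE.
Qed.

Lemma mx_lreg p r (M N : 'M[R]_(p, r)) a :
  GRing.lreg a -> a%:M *m M = a%:M *m N -> M = N.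
Proof.
move=> ra /matrixP e; apply/matrixP => i j; apply: ra; have := e i j.
by rewrite !mul_scalar_mx !mxE.
Qed.

Lemma map_mx_lift (S : nzRingType) (f : R -> S) p r (M : 'M[S]_(p, r)) :
  (forall a, exists x, f x = a) -> exists N, map_mx f N = M.
Proof.
move=> fs; pose g a := projT1 (cid (fs a)).
exists (map_mx g M); apply/matrixP => i j; rewrite !mxE /g.
by case: cid.
Qed.

Lemma map_mx_ker (S : nzRingType) (f : {rmorphism R -> S}) a p r (M : 'M[R]_(p, r)) :
  (forall x, f x = 0 <-> exists y, x = y * a) ->
  (map_mx f M = 0 <-> exists N, M = N *m a%:M).
Proof.
move=> fk; split=> [/matrixP e|[N ->]].
  have h i j : exists y, M i j = y * a by apply/fk; have := e i j; rewrite !mxE.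
  exists (\matrix_(i, j) projT1 (cid (h i j))); apply/matrixP => i j.
  by rewrite mulmx_scalarE mxE; case: cid.
apply/matrixP => i j; rewrite mxE mulmx_scalarE mxE; apply/fk.
by exists (N i j).
Qed.

Lemma mulmx_twist (th : R -> R) a p r (M : 'M[R]_(p, r)) :
  (forall x, a * x = th x * a) -> a%:M *m M = map_mx th M *m a%:M.
Proof.
by move=> h; apply/matrixP => i j; rewrite mulmx_scalarE mul_scalar_mx !mxE h.
Qed.

Lemma exact_complex (b : nat -> nat) (d : forall n, 'M[R]_(b n.+1, b n)) :
  (forall n (x : 'rV[R]_(b n.+1)), x *m d n = 0 <-> exists z, x = z *m d n.+1) ->
  forall n, d n.+1 *m d n = 0.
Proof.
move=> ex n; apply/row_matrixP => i; rewrite row_mul row0.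
by apply/ex; exists (delta_mx 0 i); rewrite rowE.
Qed.

(** A left linear map from rows to [R] is right multiplication by a column, so the dual complex
    multiplies columns by [d] on the left. *)
Definition cobd (b : nat -> nat) (d : forall n, 'M[R]_(b n.+1, b n)) (n : nat) :
    'cV[R]_(b n) -> Prop :=
  match n with
  | 0 => fun f => f = 0
  | m.+1 => fun f => exists g, f = d m *m g
  end.

End Scalars.

Section Cone.
Variables (R S : nzRingType) (w : R) (th th' : {rmorphism R -> R}) (q : {rmorphism R -> S}).
Hypotheses (thK : cancel th th') (th'K : cancel th' th)
  (wE : forall x, w * x = th x * w) (wreg : regular_elt w)
  (qs : forall a, exists x, q x = a) (qk : forall x, q x = 0 <-> exists y, x = y * w).
Variables (b : nat -> nat) (d : forall n, 'M[R]_(b n.+1, b n))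
  (s : forall n, 'M[R]_(b n.+2, b n)).
Hypothesis hs : forall n, d n.+1 *m d n = - (s n *m w%:M).

Definition shift_dim n := if n is n'.+1 then b n' else 0%N.
Definition cone_dim n := (b n + shift_dim n)%N.

Definition cone_s n : 'M[R]_(b n.+1, shift_dim n) :=
  match n with 0 => 0 | n'.+1 => s n' end.
(** As [w M = th(M) w], the shifted copy of [d] is twisted by [th] and negated, so that [w d + t w]
    vanishes. *)
Definition cone_t n : 'M[R]_(b n, shift_dim n) :=
  match n with 0 => 0 | n'.+1 => - map_mx th (d n') end.

(* A twisted mapping cone of multiplication by [w] on the "complex" [d], which
   is a complex only modulo [w]; [s] is the correcting homotopy. *)
Definition cone_d n : 'M[R]_(cone_dim n.+1, cone_dim n) :=
  block_mx (d n) (cone_s n) w%:M (cone_t n).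

Let twist p r (M : 'M[R]_(p, r)) : w%:M *m M = map_mx th M *m w%:M.
Proof. exact: mulmx_twist. Qed.

(** After right multiplication by [w] both terms become triple products of [d], with opposite signs;
    then [w] is cancelled. *)
Let dtr n : d n.+1 *m cone_s n + s n *m cone_t n = 0.
Proof.
case: n => [|n] /=; first by rewrite !mulmx0 addr0.
apply: (mx_rreg (a := w)); first by have [] := wreg.
rewrite mul0mx mulmxDl -!mulmxA mulNmx -twist mulmxN [s n.+1 *m _]mulmxA.
rewrite -[s n.+1 *m w%:M]opprK -hs mulNmx opprK.
by rewrite -[s n *m w%:M]opprK -hs mulmxN mulmxA addNr.
Qed.

Let dbr n : w%:M *m cone_s n + cone_t n.+1 *m cone_t n = 0.
Proof.
case: n => [|n] /=; first by rewrite !mulmx0 addr0.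
apply: (mx_rreg (a := w)); first by have [] := wreg.
rewrite mul0mx mulmxDl -!mulmxA [- map_mx _ (d n) *m _]mulNmx -twist mulmxN mulNmx opprK.
rewrite [map_mx _ _ *m (_ *m _)]mulmxA -twist -mulmxA -[s n *m w%:M]opprK -hs.
by rewrite mulmxN addNr.
Qed.

Lemma cone_complex n : cone_d n.+1 *m cone_d n = 0.
Proof.
rewrite /cone_d mulmx_block /= dtr [w%:M *m cone_s n + _]dbr hs addNr twist mulNmx subrr.
by rewrite block_mx0.
Qed.

Section Exactness.
Variable K0 : 'rV[S]_(b 0) -> Prop.
Hypotheses (hex0 : forall x, K0 x <-> exists z, x = z *m map_mx q (d 0))
  (hexS : forall n (x : 'rV[S]_(b n.+1)),
     x *m map_mx q (d n) = 0 <-> exists z, x = z *m map_mx q (d n.+1)).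

Let lift_row n (x : 'rV[R]_(b n)) (z : 'rV[S]_(b n.+1)) :
  map_mx q x = z *m map_mx q (d n) -> exists z' u, x = z' *m d n + u *m w%:M.
Proof.
have [z' <-] := map_mx_lift z qs.
rewrite -map_mxM => /eqP; rewrite -subr_eq0 -map_mxB => /eqP.
by rewrite (map_mx_ker _ qk) => -[u /eqP]; rewrite subr_eq addrC => /eqP->; exists z', u.
Qed.

(** [K0] stands for the kernel of the augmentation, expressed on rows over [S]. Only the first block
    matters, the second being empty in degree 0. *)
Lemma cone_exact0 (x : 'rV[R]_(cone_dim 0)) :
  K0 (map_mx q (lsubmx x)) <-> exists z, x = z *m cone_d 0.
Proof.
split=> [/hex0[z /lift_row[z' [u e]]]|[z ->]].
  exists (row_mx z' u); rewrite /cone_d mul_row_block -e -[LHS]hsubmxK.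
  by congr row_mx; apply/matrixP => i [].
apply/hex0; rewrite /cone_d -[z]hsubmxK mul_row_block row_mxKl map_mxD !map_mxM.
exists (map_mx q (lsubmx z)); rewrite map_scalar_mx.
have -> : q w = 0 by apply/qk; exists 1; rewrite mul1r.
by rewrite raddf0 mulmx0 addr0.
Qed.

(** Exactness modulo [w] allows a boundary to be subtracted so that the first block vanishes; the
    remaining block [y2] satisfies [y2 w = 0], and [w] is regular. *)
Lemma cone_exactS n (x : 'rV[R]_(cone_dim n.+1)) :
  x *m cone_d n = 0 <-> exists z, x = z *m cone_d n.+1.
Proof.
split=> [e|[z ->]]; last by rewrite -mulmxA cone_complex mulmx0.
have e' := e.
move: e'; rewrite /cone_d -[x]hsubmxK mul_row_block -row_mx0 => /eq_row_mx[e1 _].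
have /hexS[z /lift_row[z' [u xE]]] : map_mx q (lsubmx x) *m map_mx q (d n) = 0.
  rewrite -map_mxM; apply/(map_mx_ker _ qk); exists (- rsubmx x).
  by apply/eqP; rewrite mulNmx -addr_eq0 e1.
have z'E : row_mx z' u *m cone_d n.+1 =
    row_mx (z' *m d n.+1 + u *m w%:M) (z' *m cone_s n.+1 + u *m cone_t n.+1).
  by rewrite /cone_d mul_row_block.
set y2 := rsubmx x - (z' *m cone_s n.+1 + u *m cone_t n.+1).
have : (x - row_mx z' u *m cone_d n.+1) *m cone_d n = 0.
  by rewrite mulmxBl e -mulmxA cone_complex mulmx0 subrr.
have -> : x - row_mx z' u *m cone_d n.+1 = row_mx 0 y2.
  by rewrite z'E -[x in LHS]hsubmxK opp_row_mx add_row_mx xE subrr.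
rewrite /cone_d mul_row_block -row_mx0 => /eq_row_mx[]; rewrite mul0mx add0r => e2 _.
have y20 : y2 = 0.
  by apply: (mx_rreg (a := w)); [have [] := wreg|rewrite e2 mul0mx].
exists (row_mx z' u); rewrite z'E -xE; congr row_mx; apply/eqP.
by rewrite -subr_eq0 -/y2 y20.
Qed.

End Exactness.

(** The block [w] of the differential alone forces this: a module killed by a regular element has no
    nonzero map to the ring. *)
Lemma cone_cocycle0 (h : 'cV[R]_(cone_dim 0)) : cone_d 0 *m h = 0 -> h = 0.
Proof.
rewrite /cone_d -[h]vsubmxK mul_block_col -col_mx0 => /eq_col_mx[_].
rewrite mul0mx addr0 => e; rewrite -[RHS]vsubmxK; congr col_mx.
  rewrite raddf0; apply: (mx_lreg (a := w)); first by have [] := wreg.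
  by rewrite e mulmx0.
by apply/matrixP => -[].
Qed.

(* In degree [n + 1] the cohomology of the dual of the cone is, through [cone_psi],
   that of the dual of [d] modulo [w] in degree [n]. *)
Definition cone_psi n (h : 'cV[R]_(cone_dim n.+1)) : 'cV[S]_(b n) :=
  map_mx q (map_mx th' (dsubmx h)).

Lemma map_thK p r (M : 'M[R]_(p, r)) : map_mx th (map_mx th' M) = M.
Proof. by apply/matrixP => i j; rewrite !mxE th'K. Qed.
Lemma map_th'K p r (M : 'M[R]_(p, r)) : map_mx th' (map_mx th M) = M.
Proof. by apply/matrixP => i j; rewrite !mxE thK. Qed.

Let th'w : th' w = w.
Proof. by rewrite -[RHS]thK; congr (th' _); apply: wreg.2; rewrite /= -wE. Qed.

Let th'wM p r (M : 'M[R]_(p, r)) : map_mx th' (w%:M *m M) = M *m w%:M.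
Proof. by rewrite twist map_mxM map_th'K map_scalar_mx th'w. Qed.

(** The lower row of the cocycle condition reads [w f = th(d) g]; undoing [th] moves [w] to the
    right, where [q] kills it. *)
Lemma cone_psi_cocycle n (h : 'cV[R]_(cone_dim n.+1)) :
  cone_d n.+1 *m h = 0 -> map_mx q (d n) *m cone_psi h = 0.
Proof.
rewrite /cone_d -[h]vsubmxK mul_block_col -col_mx0 => /eq_col_mx[_ e].
rewrite /cone_psi vsubmxK; set g := dsubmx h in e *.
rewrite -map_mxM; apply/(map_mx_ker _ qk); exists (usubmx h).
rewrite -th'wM -[d n]map_th'K -map_mxM; congr map_mx; apply/eqP.
by rewrite eq_sym -subr_eq0 -mulNmx; apply/eqP.
Qed.

Lemma cone_psi_surj n (g : 'cV[S]_(b n)) : map_mx q (d n) *m g = 0 ->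
  exists2 h, cone_d n.+1 *m h = 0 & cone_psi h = g.
Proof.
have [g' <-] := map_mx_lift g qs; rewrite -map_mxM => /(map_mx_ker _ qk)[f e].
exists (col_mx f (map_mx th g')); last by rewrite /cone_psi col_mxKd map_th'K.
have e2 : w%:M *m f + cone_t n.+1 *m map_mx th g' = 0.
  by rewrite -[w%:M *m f]map_thK th'wM -e map_mxM /= mulNmx subrr.
rewrite /cone_d mul_block_col e2 -col_mx0; congr col_mx.
(* The upper row is checked after left multiplication by [w], where it follows from the lower row
   [e2] and from [dbr]. *)
apply: (mx_lreg (a := w)); first by have [] := wreg.
move/eqP: e2; rewrite addr_eq0 => /eqP e2.
rewrite mulmx0 mulmxDr !mulmxA twist -mulmxA e2 mulmxN -mulNmx mulmxA -mulmxDl addrC.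
by rewrite [X in X *m _](dbr n.+1) mul0mx.
Qed.

(** The upper block of a primitive changes the lower block only by a multiple of [w], which [q]
    kills. Conversely, once a coboundary has cleared the lower block, [w] times the upper block is
    zero. *)
Lemma cone_psi_cobd n (h : 'cV[R]_(cone_dim n.+1)) : cone_d n.+1 *m h = 0 ->
  (cobd cone_d h <-> cobd (fun n => map_mx q (d n)) (cone_psi h)).
Proof.
move=> e.
have key (f' : 'cV[R]_(b n)) (g' : 'cV[R]_(shift_dim n)) :
    cone_psi (cone_d n *m col_mx f' g') =
      map_mx q (map_mx th' (cone_t n *m g')).
  rewrite /cone_psi mul_block_col col_mxKd map_mxD map_mxD.
  rewrite [X in X + _](_ : _ = 0) ?add0r //; apply/(map_mx_ker _ qk).
  by exists f'; rewrite th'wM.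
have keyS (u : 'cV[S]_(shift_dim n)) : exists g', map_mx q (map_mx th' (cone_t n *m g')) =
    match n return 'cV[S]_(shift_dim n) -> 'cV[S]_(b n) with
    | 0 => fun=> 0 | n'.+1 => fun u => map_mx q (d n') *m u end u.
  have [u' <-] := map_mx_lift u qs; exists (- map_mx th u').
  case: (n) u' => [|n'] u' /=; first by rewrite mul0mx !map_mx0.
  by rewrite mulNmx mulmxN opprK !map_mxM !map_th'K.
split.
  have kc : forall g', cobd (fun n => map_mx q (d n)) (map_mx q (map_mx th' (cone_t n *m g'))).
    case: (n) => [|n'] g' /=; first by rewrite mul0mx !map_mx0.
    exists (- map_mx q (map_mx th' g')).
    by rewrite mulNmx !map_mxN mulmxN !map_mxM map_th'K.
  by case=> u ->; rewrite -[u]vsubmxK key; apply: kc.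
move=> hc.
have [g' g'E] : exists g', cone_psi h = map_mx q (map_mx th' (cone_t n *m g')).
  move: hc keyS; case: (n) (cone_psi h) => [|n'] p /=.
    by move=> -> /(_ 0)[g' <-]; exists g'.
  by move=> [u ->] /(_ u)[g' <-]; exists g'.
have /(map_mx_ker _ qk)[v vE] : map_mx q (map_mx th' (dsubmx h - cone_t n *m g')) = 0.
  by rewrite !map_mxB -g'E subrr.
have hE : dsubmx h = w%:M *m v + cone_t n *m g'.
  apply/eqP; rewrite -subr_eq -[X in X == _]map_thK vE -th'wM map_thK.
  exact: eqxx.
set h' := cone_d n *m col_mx v g'.
have dh : dsubmx (h - h') = 0 by rewrite /h' /cone_d mul_block_col linearB /= hE col_mxKd subrr.
have : cone_d n.+1 *m (h - h') = 0 by rewrite mulmxBr e mulmxA cone_complex mul0mx subrr.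
rewrite /cone_d -[h - h']vsubmxK dh mul_block_col -col_mx0 => /eq_col_mx[_].
rewrite mulmx0 addr0 => uh.
have {}uh : usubmx (h - h') = 0.
  by apply: (mx_lreg (a := w)); [have [] := wreg|rewrite uh mulmx0].
exists (col_mx v g'); apply/eqP; rewrite -subr_eq0 -/h' -[h - h']vsubmxK dh uh.
by rewrite col_mx0.
Qed.

End Cone.

(** * Lifting modulo a normal element *)

Definition bounded_below (M : zmodType) (G : int -> M -> Prop) :=
  exists B : int, forall j x, j < B -> G j x -> x = 0.

(** An operator [phi] of positive degree [m] takes the place of an ideal. Saturation of [K] keeps
    [v] inside [K], and its degree is lower by [m], so the induction ends at the lower bound [B]. *)
Lemma graded_nakayama (M : zmodType) (G : int -> M -> Prop) (hG : direct_sum G)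
    (m : int) (phi : M -> M) (K L : M -> Prop) :
  bounded_below G -> 0 < m -> {morph phi : x y / x + y} ->
  (forall j x, G j x -> G (j + m) (phi x)) ->
  L 0 -> (forall x y, L x -> L y -> L (x + y)) ->
  (forall j x, L x -> L (hcomp hG j x)) -> (forall x, L x -> L (phi x)) ->
  (forall x y, K x -> K y -> K (x - y)) ->
  (forall j x, K x -> K (hcomp hG j x)) -> (forall x, K (phi x) -> K x) ->
  (forall x, L x -> K x) ->
  (forall x, K x -> exists u v, L u /\ x = u + phi v) ->
  forall x, K x -> L x.
Proof.
move=> [B hB] m0 phiD phiG L0 LD LG Lphi KB KG Kphi LK KL.
have hom (N : nat) : forall j x, j < B + N%:Z -> G j x -> K x -> L x.
  elim: N => [|N IH] j x jN Gx Kx; first by rewrite (hB j x) //; lia.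
  have [u [v [Lu xE]]] := KL x Kx.
  have xE' : x = hcomp hG j u + phi (hcomp hG (j - m) v).
    rewrite -{1}(hcomp_id hG Gx) xE hcompD; congr (_ + _).
    rewrite -{1}[j](subrK m).
    by apply: (@hcomp_map _ _ _ _ _ _ hG hG phi (fun i => i + m)) => // i i' /addIr.
  have Lu' : L (hcomp hG j u) by apply: LG.
  rewrite xE'; apply: LD => //; apply: Lphi; apply: (IH (j - m)); first by lia.
    exact: hcompP.
  apply: Kphi; have -> : phi (hcomp hG (j - m) v) = x - hcomp hG j u.
    by rewrite xE' [RHS]addrC addKr.
  by apply: KB => //; apply: LK.
move=> x Kx; have [s [_ _ ->]] := hcomp_sum hG x.
apply: big_ind => // j _; apply: (hom (absz (j - B + 1)) j); last exact: KG.
  by lia.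
exact: hcompP.
Qed.

Section GradedMatrices.
Variables (R : nzRingType) (H : int -> R -> Prop).
Hypotheses (hH : direct_sum H)
  (HM : forall i j x y, H i x -> H j y -> H (i + j) (x * y)).

(** These are the degrees for which right multiplication by [M] raises degrees by [j] between free
    modules with generators in degrees [e] and [e']. *)
Definition mxhom p r (e : 'I_p -> int) (e' : 'I_r -> int) (j : int) (M : 'M[R]_(p, r)) :=
  forall i l, H (e i + j - e' l) (M i l).

Lemma mxhom_direct p r (e : 'I_p -> int) (e' : 'I_r -> int) :
  direct_sum (mxhom e e').
Proof.
pose T j (M : 'M[R]_(p, r)) := \matrix_(i, l) hcomp hH (e i + j - e' l) (M i l).
apply: (@direct_sum_intro _ _ _ T).
- by move=> j i l; rewrite mxE; apply: (dsum0 hH).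
- by move=> j x y hx hy i l; rewrite !mxE; apply: (dsumB hH).
- move=> Q Q0 QD QH M; rewrite [M]matrix_sum_delta.
  apply: (@big_ind _ Q) => // i _; apply: (@big_ind _ Q) => // l _.
  have [s [_ _ ->]] := hcomp_sum hH (M i l); rewrite scaler_suml.
  apply: (@big_ind _ Q) => // j _; apply: (QH (j - e i + e' l)) => i' l'.
  rewrite !mxE; case: eqP => [->|_]; case: eqP => [->|_];
    rewrite ?(mulr1n, mulr0n) ?mulr0; try exact: (dsum0 hH).
  have -> : e i + (j - e i + e' l) - e' l = j by lia.
  by rewrite mulr1; apply: hcompP.
- by move=> j x y; apply/matrixP => i l; rewrite !mxE hcompD.
- by move=> j x hx; apply/matrixP => i l; rewrite !mxE hcomp_id.
- move=> j j' x hx jj; apply/matrixP => i l; rewrite !mxE.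
  by apply: (hcomp_neq hH (hx i l)); lia.
Qed.

Lemma mxhom_mul p r t (e : 'I_p -> int) (e' : 'I_r -> int) (e'' : 'I_t -> int) j j'
    (M : 'M[R]_(p, r)) (N : 'M[R]_(r, t)) :
  mxhom e e' j M -> mxhom e' e'' j' N -> mxhom e e'' (j + j') (M *m N).
Proof.
move=> hM hN i l; rewrite mxE; apply: (dsum_sum hH) => a _.
have -> : e i + (j + j') - e'' l = (e i + j - e' a) + (e' a + j' - e'' l) by lia.
exact: HM.
Qed.

Lemma mxhom_scalar p (e : 'I_p -> int) j a : H j a -> mxhom e e j (a%:M : 'M_p).
Proof.
move=> ha i l; rewrite mxE; case: eqP => [->|_]; last by rewrite mulr0n; apply: (dsum0 hH).
by rewrite mulr1n addrAC subrr add0r.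
Qed.

Lemma mxhom_bounded p r (e : 'I_p -> int) (e' : 'I_r -> int) :
  (forall j x, j < 0 -> H j x -> x = 0) -> bounded_below (mxhom e e').
Proof.
move=> Hneg.
have bd n (f : 'I_n -> int) : exists B : nat, forall i, `|f i| <= B%:Z.
  exists (\sum_i `|f i|)%N => i; rewrite -abszE lez_nat (bigD1 i) //=.
  exact: leq_addr.
have [B hB] := bd _ e; have [B' hB'] := bd _ e'.
exists (- B%:Z - B'%:Z) => j x jB hx; apply/matrixP => i l; rewrite mxE.
by apply: Hneg (hx i l); have := hB i; have := hB' l; lia.
Qed.

Lemma hcomp_mulmx p r t (e : 'I_p -> int) (e' : 'I_r -> int) (e'' : 'I_t -> int)
    j j' (M : 'M[R]_(p, r)) (N : 'M[R]_(r, t)) : mxhom e' e'' j' N ->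
  hcomp (mxhom_direct e e'') (j + j') (M *m N) = hcomp (mxhom_direct e e') j M *m N.
Proof.
move=> hN; apply: (@hcomp_map _ _ _ _ _ _ _ _ (mulmx^~ N) (fun j => j + j')).
- by move=> x y; rewrite mulmxDl.
- exact: addIr.
- by move=> i x hx; apply: mxhom_mul hN.
Qed.

Lemma hcomp_mulmxl p r t (e : 'I_p -> int) (e' : 'I_r -> int) (e'' : 'I_t -> int)
    j j' (M : 'M[R]_(p, r)) (N : 'M[R]_(r, t)) : mxhom e e' j M ->
  hcomp (mxhom_direct e e'') (j + j') (M *m N) = M *m hcomp (mxhom_direct e' e'') j' N.
Proof.
move=> hM; apply: (@hcomp_map _ _ _ _ _ _ _ _ (mulmx M) (fun j' => j + j')).
- by move=> x y; rewrite mulmxDr.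
- exact: addrI.
- by move=> i x hx; apply: mxhom_mul hx.
Qed.

Lemma mxhomZ p r (e : 'I_p -> int) (e' : 'I_r -> int) j j' a (M : 'M[R]_(p, r)) :
  H j a -> mxhom e e' j' M -> mxhom e e' (j + j') (a *: M).
Proof. by move=> ha hM; rewrite -mul_scalar_mx; apply: mxhom_mul hM; apply: mxhom_scalar. Qed.

End GradedMatrices.

Notation rowhom H e := (mxhom H (fun _ : 'I_1 => 0) e).
Notation colhom H e := (mxhom H e (fun _ : 'I_1 => 0)).

Section Lift.
Variables (R S : nzRingType) (H : int -> R -> Prop) (hH : direct_sum H)
  (HM : forall i j x y, H i x -> H j y -> H (i + j) (x * y))
  (Hneg : forall j x, j < 0 -> H j x -> x = 0)
  (y : R) (m : int) (m0 : 0 < m) (ym : H m y)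
  (ynormal : normal_elt y) (yreg : regular_elt y)
  (q : {rmorphism R -> S}) (qs : forall a, exists x, q x = a)
  (qk : forall x, q x = 0 <-> exists z, x = z * y).
Variables (b : nat -> nat) (e : forall n, 'I_(b n) -> int)
  (c : forall n, 'M[R]_(b n.+1, b n)).
Hypothesis (chom : forall n, mxhom H (@e n.+1) (@e n) 0 (c n)).
Hypothesis (cex : forall n (x : 'rV[S]_(b n.+1)),
  x *m map_mx q (c n) = 0 <-> exists z, x = z *m map_mx q (c n.+1)).

Local Notation rdeg n := (mxhom_direct hH (fun _ : 'I_1 => 0) (@e n)).
Local Notation cdeg n := (mxhom_direct hH (@e n) (fun _ : 'I_1 => 0)).

(** Rows form left modules, so the factor [y] that [qk] puts on the right is moved to the left by
    normality. *)
Let kerl p r (M : 'M[R]_(p, r)) : map_mx q M = 0 -> exists N, M = y *: N.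
Proof.
move=> /matrixP h.
have h' i j : exists z, M i j = y * z.
  have /qk[z ->] : q (M i j) = 0 by have := h i j; rewrite !mxE.
  exact: ynormal.2.
exists (\matrix_(i, j) projT1 (cid (h' i j))); apply/matrixP => i j.
by rewrite !mxE; case: cid.
Qed.

Let qy : q y = 0. Proof. by apply/qk; exists 1; rewrite mul1r. Qed.

Let scal_inj p r (M : 'M[R]_(p, r)) : y *: M = 0 -> M = 0.
Proof.
rewrite -mul_scalar_mx => h; apply: (mx_lreg (a := y)); first by have [] := yreg.
by rewrite h mulmx0.
Qed.

(* [K] stands for the kernel of the last lifted differential: it is saturated with
   respect to [y] and reduces modulo [y] onto the image of [c n]. *)
Definition lift_kernel n (K : 'rV[R]_(b n) -> Prop) : Prop :=
  [/\ [/\ K 0, forall x z, K x -> K z -> K (x - z) & forall a x, K x -> K (a *: x)],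
      forall j x, K x -> K (hcomp (rdeg n) j x),
      forall x, K (y *: x) -> K x,
      forall x, K x -> exists z, map_mx q x = z *m map_mx q (c n)
    & forall z, exists2 x, K x & map_mx q x = z *m map_mx q (c n)].

(** The rows of [d] are homogeneous lifts in [K] of the rows of [c n]; as [K] is saturated, they
    generate it by the graded Nakayama lemma. *)
Lemma lift_step n (K : 'rV[R]_(b n) -> Prop) : lift_kernel K ->
  exists d : 'M[R]_(b n.+1, b n),
    [/\ mxhom H (@e n.+1) (@e n) 0 d, map_mx q d = map_mx q (c n),
        forall x, K x <-> exists z, x = z *m d
      & lift_kernel (fun x : 'rV[R]_(b n.+1) => x *m d = 0)].
Proof.
move=> [[K0 KB KZ] KG Ky KI KS].
have KD x z : K x -> K z -> K (x + z).
  by move=> hx hz; rewrite -[z]opprK; apply: (KB) => //; rewrite -sub0r; apply: KB.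
have row_lift i : exists x : 'rV[R]_(b n), [/\ K x,
    mxhom H (fun=> 0) (@e n) (@e n.+1 i) x & map_mx q x = map_mx q (row i (c n))].
  have [x Kx xE] := KS (delta_mx 0 i); rewrite -rowE -map_row in xE.
  exists (hcomp (rdeg n) (@e n.+1 i) x); split; [exact: KG|exact: (hcompP (rdeg n))|].
  have hr : mxhom H (fun=> 0) (@e n) (@e n.+1 i) (row i (c n)).
    by move=> i' l; rewrite mxE add0r; have := chom i l; rewrite addr0.
  (* [S] has no grading. Taking a component of [x] is harmless because [x] differs from the
     homogeneous row of [c n] by a multiple of the homogeneous [y]. *)
  have /kerl[N NE] : map_mx q (x - row i (c n)) = 0 by rewrite map_mxB xE subrr.
  apply/eqP; rewrite -subr_eq0 -map_mxB -{1}(hcomp_id (rdeg n) hr) -hcompB NE.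
  rewrite -mul_scalar_mx -[@e n.+1 i](subrK m) addrC.
  rewrite (@hcomp_mulmxl _ _ hH HM _ _ _ _ (fun=> 0)); last exact: mxhom_scalar.
  by rewrite map_mxM map_scalar_mx qy raddf0 mul0mx.
pose d := \matrix_i projT1 (cid (row_lift i)).
have dK i : K (row i d) by rewrite rowK; case: cid => x [].
have dhom : mxhom H (@e n.+1) (@e n) 0 d.
  move=> i l; have : mxhom H (fun=> 0) (@e n) (@e n.+1 i) (row i d).
    by rewrite rowK; case: cid => x [].
  by move=> /(_ 0 l); rewrite mxE add0r addr0.
have dq : map_mx q d = map_mx q (c n).
  by apply/row_matrixP => i; rewrite -!map_row rowK; case: cid => x [].
have imK z : K (z *m d).
  by rewrite mulmx_sum_row; apply: (@big_ind _ K) => // i _; apply: KZ.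
have Kim x : K x -> exists z, x = z *m d.
  apply: (@graded_nakayama _ _ (rdeg n) m (fun x => y *: x) K
    (fun x => exists z, x = z *m d)) => //.
  - exact: mxhom_bounded.
  - by move=> u v; rewrite scalerDr.
  - by move=> j u hu; rewrite addrC; apply: mxhomZ.
  - by exists 0; rewrite mul0mx.
  - by move=> u v [z ->] [z' ->]; exists (z + z'); rewrite mulmxDl.
  - move=> j _ [z ->]; exists (hcomp (rdeg n.+1) j z).
    by rewrite -[j in LHS]addr0; apply: hcomp_mulmx.
  - by move=> _ [z ->]; exists (y *: z); rewrite scalemxAl.
  - by move=> _ [z ->].
  - move=> u Ku; have [z zE] := KI u Ku; have [z' z'E] := map_mx_lift z qs.
    have /kerl[v vE] : map_mx q (u - z' *m d) = 0.
      by rewrite map_mxB map_mxM dq z'E zE subrr.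
    exists (z' *m d), v; split; first by exists z'.
    by rewrite -vE addrC subrK.
exists d; split=> //; first by move=> x; split=> [/Kim//|[z ->]].
split; first split.
- exact: mul0mx.
- by move=> x z hx hz; rewrite mulmxBl hx hz subrr.
- by move=> a x hx; rewrite -scalemxAl hx scaler0.
- by move=> j x hx; rewrite -(hcomp_mulmx hH HM _ _ _ dhom) hx hcomp0.
- by move=> x; rewrite -scalemxAl => /scal_inj.
- by move=> x hx; apply/cex; rewrite -dq -map_mxM hx map_mx0.
- move=> z; have [x xE] := map_mx_lift (z *m map_mx q (c n.+1)) qs.
  have /kerl[u uE] : map_mx q (x *m d) = 0 by rewrite map_mxM dq xE; apply/cex; exists z.
  (* Saturation of [K] makes the error [y u] the image of [y v], so [x - y v] lies in the new kernel
     and has the same reduction. *)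
  have /Kim[v vE] : K u by apply: Ky; rewrite -uE.
  exists (x - y *: v); last by rewrite map_mxB map_mxZ qy scale0r subr0.
  by rewrite mulmxBl uE -scalemxAl -vE subrr.
Qed.

Lemma lift_exists (K0 : 'rV[R]_(b 0) -> Prop) : lift_kernel K0 ->
  exists d : forall n, 'M[R]_(b n.+1, b n),
    [/\ forall n, mxhom H (@e n.+1) (@e n) 0 (d n),
        forall n, map_mx q (d n) = map_mx q (c n),
        forall x, K0 x <-> exists z, x = z *m d 0%N
      & forall n (x : 'rV[R]_(b n.+1)), x *m d n = 0 <-> exists z, x = z *m d n.+1].
Proof.
move=> hK0.
(* The recursion carries a kernel together with its invariant; each step yields a differential and
   the next kernel. *)
pose T n := {K : 'rV[R]_(b n) -> Prop | lift_kernel K}.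
pose dd n (K : T n) := projT1 (cid (lift_step (projT2 K))).
have ddP n (K : T n) := projT2 (cid (lift_step (projT2 K))).
pose next n (K : T n) : T n.+1 :=
  let: And4 _ _ _ h := ddP n K in exist _ _ h.
pose Ks := fix Ks n : T n := if n is n'.+1 then next n' (Ks n') else exist _ _ hK0.
exists (fun n => dd n (Ks n)); split.
- by move=> n; have [] := ddP n (Ks n).
- by move=> n; have [] := ddP n (Ks n).
- by move=> x; have [_ _ h _] := ddP 0%N (Ks 0%N); apply: h.
- move=> n x; have [_ _ h _] := ddP n.+1 (Ks n.+1).
  rewrite -h /= /next; case: (ddP n (Ks n)) => /= ????; exact: iff_refl.
Qed.

Section Dual.
Variable d : forall n, 'M[R]_(b n.+1, b n).
Hypotheses (dhom : forall n, mxhom H (@e n.+1) (@e n) 0 (d n))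
  (dq : forall n, map_mx q (d n) = map_mx q (c n))
  (dd : forall n, d n.+1 *m d n = 0).

Let cobdq n (z : 'cV[R]_(b n)) : cobd (fun n => map_mx q (c n)) (map_mx q z) ->
  exists u v, cobd d u /\ z = u + v *m y%:M.
Proof.
case: n z => [|n] z /=.
  by move/(map_mx_ker _ qk) => [v ->]; exists 0, v; rewrite add0r.
move=> [g]; have [g' <-] := map_mx_lift g qs; rewrite -dq -map_mxM => /eqP.
rewrite -subr_eq0 -map_mxB => /eqP /(map_mx_ker _ qk) [v vE].
by exists (d n *m g'), v; split; [exists g'|rewrite -vE addrC subrK].
Qed.

Lemma cobd_cocycle n (z : 'cV[R]_(b n)) : cobd d z -> d n *m z = 0.
Proof. by case: n z => [|n] z /= => [->|[g ->]]; rewrite ?mulmx0 // mulmxA dd mul0mx. Qed.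

Lemma cobdD n (z z' : 'cV[R]_(b n)) : cobd d z -> cobd d z' -> cobd d (z + z').
Proof.
case: n z z' => [|n] z z' /= => [-> ->|[g ->] [g' ->]]; first by rewrite addr0.
by exists (g + g'); rewrite mulmxDr.
Qed.

Lemma cobd0 n : cobd d (0 : 'cV[R]_(b n)).
Proof. by case: n => [|n] //=; exists 0; rewrite mulmx0. Qed.

Lemma cobdZ n (z : 'cV[R]_(b n)) a : cobd d z -> cobd d (z *m a%:M).
Proof.
case: n z => [|n] z /= => [->|[g ->]]; first by rewrite mul0mx.
by exists (g *m a%:M); rewrite mulmxA.
Qed.

Lemma cobd_hcomp n (z : 'cV[R]_(b n)) j : cobd d z -> cobd d (hcomp (cdeg n) j z).
Proof.
case: n z => [|n] z /= => [->|[g ->]]; first by rewrite hcomp0.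
by exists (hcomp (cdeg n) j g); rewrite -[j in LHS]add0r; apply: hcomp_mulmxl.
Qed.

Lemma cocycle_hcomp n (z : 'cV[R]_(b n)) j :
  d n *m z = 0 -> d n *m hcomp (cdeg n) j z = 0.
Proof. by move=> h; rewrite -(hcomp_mulmxl hH HM _ _ _ (@dhom n)) h hcomp0. Qed.

Lemma cocycleZ n (z : 'cV[R]_(b n)) : d n *m (z *m y%:M) = 0 -> d n *m z = 0.
Proof.
rewrite mulmxA => h; apply: (mx_rreg (a := y)); first by have [] := yreg.
by rewrite h mul0mx.
Qed.

(** Graded Nakayama for right multiplication by [y] on cocycles: exactness modulo [y] writes a
    cocycle as a coboundary plus a multiple of [y]. *)
Lemma lift_dual_exact n :
  (forall z : 'cV[S]_(b n), map_mx q (c n) *m z = 0 -> cobd (fun n => map_mx q (c n)) z) ->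
  forall z : 'cV[R]_(b n), d n *m z = 0 -> cobd d z.
Proof.
move=> ex; apply: (@graded_nakayama _ _ (cdeg n) m (fun z => z *m y%:M)) => //.
- exact: mxhom_bounded.
- by move=> u v; rewrite mulmxDl.
- by move=> j u hu; apply: mxhom_mul hu _ => //; apply: mxhom_scalar.
- exact: cobd0.
- by move=> z z'; apply: cobdD.
- by move=> j z; apply: cobd_hcomp.
- by move=> z; apply: cobdZ.
- by move=> x z hx hz; rewrite mulmxBr hx hz subrr.
- by move=> j x; apply: cocycle_hcomp.
- by move=> x /cocycleZ.
- exact: cobd_cocycle.
- by move=> z hz; apply/cobdq/ex; rewrite -dq -map_mxM hz map_mx0.
Qed.

(** With the next two lemmas, the long exact sequence of cohomology for right multiplication by [y]:
    the kernel of reduction, then injectivity of [y], then surjectivity of reduction. *)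
Lemma lift_dual_quotient n (z : 'cV[R]_(b n)) :
  cobd (fun n => map_mx q (c n)) (map_mx q z) -> d n *m z = 0 ->
  exists u v, [/\ cobd d u, d n *m v = 0 & z = u + v *m y%:M].
Proof.
move=> /cobdq[u [v [hu zE]]] hz; exists u, v; split=> //; apply: cocycleZ.
by move: hz; rewrite zE mulmxDr cobd_cocycle // add0r.
Qed.

Lemma lift_dual_regular n (z : 'cV[R]_(b n.+1)) :
  (forall z : 'cV[S]_(b n), map_mx q (c n) *m z = 0 -> cobd (fun n => map_mx q (c n)) z) ->
  cobd d (z *m y%:M) -> cobd d z.
Proof.
move=> ex /= [u uE].
have /cobdq[v [v' [hv uE']]] : cobd (fun n => map_mx q (c n)) (map_mx q u).
  apply: ex; rewrite -dq -map_mxM -uE map_mxM map_scalar_mx qy.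
  by rewrite raddf0 mulmx0.
exists v'; apply: (mx_rreg (a := y)); first by have [] := yreg.
by rewrite uE uE' mulmxDr cobd_cocycle // add0r mulmxA.
Qed.

Lemma lift_dual_surj n (z : 'cV[S]_(b n)) :
  (forall z : 'cV[R]_(b n.+1), d n.+1 *m z = 0 -> cobd d z) ->
  map_mx q (c n) *m z = 0 -> exists2 z', d n *m z' = 0 & map_mx q z' = z.
Proof.
move=> ex; have [z1 <-] := map_mx_lift z qs; rewrite -dq -map_mxM.
move=> /(map_mx_ker _ qk)[u uE].
have /ex[v vE] : d n.+1 *m u = 0 by apply: cocycleZ; rewrite -uE mulmxA dd mul0mx.
exists (z1 - v *m y%:M); first by rewrite mulmxBr uE vE mulmxA subrr.
by rewrite map_mxB map_mxM map_scalar_mx qy raddf0 mulmx0 subr0.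
Qed.

End Dual.
End Lift.

(** * Graded projective modules are free *)

Section Combination.
Variables (R : nzRingType) (P : lmodType R) (n : nat) (v : 'I_n -> P).

Definition comb (c : 'rV[R]_n) : P := \sum_i c 0 i *: v i.

Fact comb_linear : linear comb.
Proof.
move=> a x y; rewrite /comb scaler_sumr -big_split /=; apply: eq_bigr => i _.
by rewrite !mxE scalerDl scalerA.
Qed.
HB.instance Definition _ :=
  GRing.isLinear.Build R 'rV[R]_n P *:%R comb comb_linear.

Lemma comb_delta i : comb (delta_mx 0 i) = v i.
Proof.
rewrite /comb (bigD1 i) //= mxE !eqxx scale1r big1 ?addr0 // => j ji.
by rewrite mxE (negPf ji) andbF scale0r.
Qed.

End Combination.

Lemma rV_projective (R : nzRingType) n : projective 'rV[R]_n.
Proof.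
move=> X Y g f gs.
have h i : exists x, g x = f (delta_mx 0 i) by apply: gs.
exists (comb (fun i => projT1 (cid (h i)))) => p.
rewrite {2}[p]row_sum_delta /comb !linear_sum; apply: eq_bigr => i _.
by rewrite !linearZ /=; case: cid => x /= ->.
Qed.

Section GradedFree.
Variables (R : nzRingType) (H : int -> R -> Prop) (hH : direct_sum H)
  (HM : forall i j x y, H i x -> H j y -> H (i + j) (x * y))
  (Hneg : forall j x, j < 0 -> H j x -> x = 0)
  (Hunit : forall x, H 0 x -> x != 0 -> exists u, u * x = 1).
Variables (P : lmodType R) (G : int -> P -> Prop) (hG : direct_sum G)
  (GM : forall i j a x, H i a -> G j x -> G (i + j) (a *: x)).

Let hgen n := exists (e : 'I_n -> int) (v : 'I_n -> P),
  (forall i, G (e i) (v i)) /\ forall x, exists c, x = comb v c.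

Lemma homogeneous_generators : finitely_generated P -> exists n, hgen n.
Proof.
move=> [n [u hu]].
(* One finite set of degrees is made to serve all generators. *)
have [s [us sE]] : exists s : seq int, uniq s /\
    forall i, u i = \sum_(j <- s) hcomp hG j (u i).
  pose t i := projT1 (cid (hcomp_sum hG (u i))).
  exists (undup (flatten [seq t i | i : 'I_n])); split; first exact: undup_uniq.
  move=> i; rewrite /t; have := projT2 (cid (hcomp_sum hG (u i))).
  rewrite -/(t i) => -[ut t0 tE]; rewrite {1}tE; apply: big_supported => //.
    exact: undup_uniq.
  move=> j jt; rewrite mem_undup; apply/flattenP; exists (t i) => //.
  by apply: map_f; rewrite mem_enum.
pose J : finType := ('I_n * 'I_(size s))%type.
pose e (p : J) := nth 0 s p.2; pose v (p : J) := hcomp hG (e p) (u p.1).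
exists #|J|, (fun i => e (enum_val i)), (fun i => v (enum_val i)); split.
  by move=> i; apply: hcompP.
move=> x; have [c ->] := hu x; exists (\row_i c (enum_val i).1).
transitivity (\sum_(p : J) c p.1 *: v p).
  rewrite -(pair_bigA _ (fun i l => c i *: v (i, l))) /=; apply: eq_bigr => i _.
  rewrite -scaler_sumr {1}sE; congr (_ *: _).
  by rewrite (big_nth 0) big_mkord.
rewrite /comb (reindex (@enum_val _ predT)) /=; last first.
  by apply: onW_bij; apply: enum_val_bij.
by apply: eq_bigr => i _; rewrite mxE.
Qed.

Lemma graded_projective_free : finitely_generated P -> projective P ->
  exists n (e : 'I_n -> int) (v : 'I_n -> P) (crd : {linear P -> 'rV[R]_n}),
    [/\ forall i, G (e i) (v i), cancel crd (comb v), cancel (comb v) crd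
      & forall j x, G j x -> rowhom H e j (crd x)].
Proof.
move=> fg proj.
have exn : exists n, `[< hgen n >].
  by have [n hn] := homogeneous_generators fg; exists n; apply/asboolP.
case: (ex_minnP exn) => n /asboolP[e [v [hv gv]]] nmin.
have [h hE] := proj 'rV[R]_n P (comb v) idfun (fun y =>
  let: ex_intro c cE := gv y in ex_intro _ c (esym cE)).
pose hR := mxhom_direct hH (fun _ : 'I_1 => 0) e.
have gG j c : rowhom H e j c -> G j (comb v c).
  move=> hc; apply: (dsum_sum hG) => i _.
  rewrite -[j](subrK (e i)); apply: GM => //.
  by have := hc 0 i; rewrite add0r.
have gcomp j c : hcomp hG j (comb v c) = comb v (hcomp hR j c).
  by apply: (@hcomp_map _ _ _ _ _ _ hR hG (comb v) id) => // x y; apply: linearD.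
have unitfree (c : 'rV[R]_n) i : comb v c = 0 -> H 0 (c 0 i) -> c 0 i = 0.
  move=> c0 hc; apply: contrapT => /eqP /(Hunit hc)[u uE].
  have i_n := ltn_ord i; have : (n <= n.-1)%N; last by lia.
  apply: nmin; apply/asboolP; exists (e \o lift i), (v \o lift i).
  split=> [l|x]; first exact: hv.
  have [a ->] := gv x; exists (\row_l (a 0 (lift i l) - a 0 i * u * c 0 (lift i l))).
  have vi : v i = - \sum_(l < n.-1) (u * c 0 (lift i l)) *: v (lift i l).
    apply/eqP; rewrite -addr_eq0; apply/eqP; have := congr1 ( *:%R u) c0.
    rewrite scaler0 /comb (bigD1_ord i) //= scalerDr scalerA uE scale1r scaler_sumr.
    by move=> {2}<-; congr (_ + _); apply: eq_bigr => l _; rewrite scalerA.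
  rewrite /comb (bigD1_ord i) //= vi scalerN scaler_sumr addrC -sumrB.
  by apply: eq_bigr => l _; rewrite mxE scalerBl scalerA mulrA.
have [B hB] := mxhom_bounded (fun _ : 'I_1 => 0) e Hneg.
have ker0 (N : nat) : forall j c, j < B + N%:Z ->
    rowhom H e j c -> comb v c = 0 -> c = 0.
  elim: N => [|N IH] j c jN hc c0; first by apply: (hB j) => //; lia.
  pose l i := delta_mx 0 i - h (v i).
  have lE i : comb v (l i) = 0 by rewrite linearB /= comb_delta hE subrr.
  (* As [h (comb v c) = 0], the relation [c] is a combination of the relations [l i], with
     coefficients of degree [j - e i]. *)
  have cE : c = \sum_i c 0 i *: l i.
    have hc0 : \sum_i c 0 i *: h (v i) = 0.
      transitivity (h (comb v c)); last by rewrite c0 linear0.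
      by rewrite /comb linear_sum; apply: eq_bigr => i _; rewrite linearZ.
    rewrite (eq_bigr _ (fun i _ => scalerBr _ _ _)) sumrB hc0 subr0.
    exact: row_sum_delta.
  rewrite -(hcomp_id hR hc) cE hcomp_bigsum big1 // => i _.
  have hci : H (j - e i) (c 0 i) by have := hc 0 i; rewrite add0r.
  have -> : hcomp hR j (c 0 i *: l i) = c 0 i *: hcomp hR (e i) (l i).
    rewrite -[j](subrK (e i)) -!mul_scalar_mx.
    by rewrite (@hcomp_mulmxl _ _ hH HM _ _ _ _ (fun=> 0)) //; apply: mxhom_scalar.
  have [->|ci0] := eqVneq (c 0 i) 0; first by rewrite scale0r.
  have ji : e i <= j.
    by rewrite leNgt; apply/negP => ij; move/eqP: ci0; apply; apply: Hneg hci; lia.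
  have ij : e i != j.
    apply/eqP => ij; move/eqP: ci0; apply; apply: (unitfree c i) => //.
    by move: hci; rewrite ij subrr.
  rewrite (IH (e i) (hcomp hR (e i) (l i))) ?scaler0 //; first by lia.
    exact: (hcompP hR).
  by rewrite -gcomp lE hcomp0.
have inj c : comb v c = 0 -> c = 0.
  move=> c0; apply: (hcomp_eq0 (hH := hR)) => j.
  apply: (ker0 (absz (j - B + 1)) j); first by lia.
    exact: (hcompP hR).
  by rewrite -gcomp c0 hcomp0.
have hK : cancel (comb v) h.
  by move=> c; apply/eqP; rewrite -subr_eq0; apply/eqP/inj; rewrite linearB /= hE subrr.
exists n, e, v, h; split=> // j x hx.
have <- : hcomp hR j (h x) = h x by rewrite -[LHS]hK -gcomp hE hcomp_id.
exact: (hcompP hR).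
Qed.

End GradedFree.

(** * Matrices of free resolutions *)

Section BasedResolution.
Variables (R : nzRingType) (M : lmodType R) (P : resolution M) (b : nat -> nat)
  (v : forall n, 'I_(b n) -> P n) (crd : forall n, {linear P n -> 'rV[R]_(b n)}).
Hypotheses (crdK : forall n, cancel (@crd n) (comb (@v n)))
  (combK : forall n, cancel (comb (@v n)) (@crd n)).

Definition basis_mx n : 'M[R]_(b n.+1, b n) := \matrix_i crd n (res_diff P n (v i)).

Lemma basis_mxE n (x : P n.+1) : crd n (res_diff P n x) = crd n.+1 x *m basis_mx n.
Proof.
rewrite -{1}[x]crdK /comb !linear_sum mulmx_sum_row; apply: eq_bigr => i _.
by rewrite rowK !linearZ.
Qed.

Definition colfun n (f : 'cV[R]_(b n)) : P n -> R^o := fun x => (crd n x *m f) 0 0.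

Lemma crd_v n i : crd n (v i) = delta_mx 0 i.
Proof. by rewrite -[v i]comb_delta combK. Qed.

Lemma colfun_v n (f : 'cV[R]_(b n)) i : colfun f (v i) = f i 0.
Proof. by rewrite /colfun crd_v -rowE mxE. Qed.

Lemma colfun_linear n (f : 'cV[R]_(b n)) : linear (colfun f).
Proof. by move=> a x y; rewrite /colfun linearP mulmxDl -scalemxAl !mxE. Qed.

Lemma colfunE n (F : P n -> R^o) : linear F -> F = colfun (\col_i F (v i)).
Proof.
move=> FL; apply: funext => x; rewrite -{1}[x]crdK /comb /colfun.
have [Fl FlE] := make_linear FL.
rewrite -FlE linear_sum mxE; apply: eq_bigr => i _.
by rewrite linearZ mxE -FlE.
Qed.

Lemma colfun_cocycle n (f : 'cV[R]_(b n)) :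
  cocycle (colfun f) <-> basis_mx n *m f = 0.
Proof.
split=> [[_ h]|h].
  apply/row_matrixP => i; rewrite row_mul rowK row0; apply/matrixP => a c.
  by rewrite !ord1 [RHS]mxE; apply: (h (v i)).
split; first exact: colfun_linear.
by move=> x; rewrite /colfun basis_mxE -mulmxA h mulmx0 mxE.
Qed.

Lemma colfun_coboundary n (f : 'cV[R]_(b n)) :
  coboundary (colfun f) <-> cobd basis_mx f.
Proof.
case: n f => [|n] f /=.
  split=> [h|-> x]; last by rewrite /colfun mulmx0 mxE.
  by apply/matrixP => i j; rewrite ord1 mxE -colfun_v h.
split=> [[g gE]|[g ->]].
  have gE' := @colfunE _ g (@linearP _ _ _ _ g); exists (\col_i g (v i)).
  apply/matrixP => i j; rewrite ord1 -colfun_v gE {1}gE'.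
  by rewrite /colfun basis_mxE crd_v -mulmxA -rowE mxE.
have [gl glE] := make_linear (colfun_linear g).
by exists gl => x; rewrite glE /colfun basis_mxE mulmxA.
Qed.

Lemma colfun_ex n (F : P n -> R^o) : cocycle F ->
  exists2 f, basis_mx n *m f = 0 & F = colfun f.
Proof.
move=> hF; have FE := colfunE hF.1; exists (\col_i F (v i)) => //.
by apply/colfun_cocycle; rewrite -FE.
Qed.

End BasedResolution.

Section FreeResolution.
Variables (R : nzRingType) (M : lmodType R) (b : nat -> nat)
  (d : forall n, 'M[R]_(b n.+1, b n)) (al : 'I_(b 0) -> M).
Hypotheses (al_surj : forall m, exists x, comb al x = m)
  (ex0 : forall x, comb al x = 0 <-> exists z, x = z *m d 0)
  (exS : forall n (x : 'rV[R]_(b n.+1)), x *m d n = 0 <-> exists z, x = z *m d n.+1).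

Lemma free_resolution_ex : exists (P : resolution M)
    (v : forall n, 'I_(b n) -> P n) (crd : forall n, {linear P n -> 'rV[R]_(b n)}),
  [/\ forall n, cancel (crd n) (comb (@v n)), forall n, cancel (comb (@v n)) (crd n),
      basis_mx v crd = d & forall x, res_aug P x = comb al (crd 0%N x)].
Proof.
have ex0' x : comb al x = 0 <-> exists y, mulmxr (d 0) y = x.
  by rewrite ex0; split=> -[z e]; exists z; symmetry.
have exS' n (x : 'rV[R]_(b n.+1)) :
    mulmxr (d n) x = 0 <-> exists y, mulmxr (d n.+1) y = x.
  by rewrite /= exS; split=> -[z e]; exists z; symmetry.
pose P := @Resolution R M (fun n => 'rV[R]_(b n)) (fun n => mulmxr (d n)) (comb al)
  (fun n => @rV_projective R (b n)) al_surj ex0' exS'.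
exists P, (fun n i => delta_mx 0 i), (fun n => idfun).
have e n : comb (fun i => delta_mx 0 i) =1 (id : 'rV[R]_(b n) -> _).
  by move=> x; rewrite /comb -row_sum_delta.
split=> //.
apply: functional_extensionality_dep => n; apply/row_matrixP => i.
by rewrite rowK /= rowE.
Qed.

End FreeResolution.

Section MatrixForm.
Variables (k : fieldType) (A : gralg k).
Local Notation Ae := (enveloping A).
Local Notation HA := (@gcomp_enveloping k A).
Local Notation bimod := (regular_bimodule A).

(** Coordinates are used because a differential can then be lifted along a ring map entry by
    entry. *)
Record mx_resolution (b : nat -> nat) (e : forall n, 'I_(b n) -> int)
    (d : forall n, 'M[Ae]_(b n.+1, b n)) (al : 'I_(b 0) -> bimod) : Prop := MxResolution {
  mxr_hom : forall n, mxhom HA (@e n.+1) (@e n) 0 (d n);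
  mxr_aug_hom : forall i, gcomp_int (e 0%N i) (al i : A);
  mxr_surj : forall a, exists x, comb al x = a;
  mxr_exact0 : forall x, comb al x = 0 <-> exists z, x = z *m d 0%N;
  mxr_exactS : forall n (x : 'rV[Ae]_(b n.+1)), x *m d n = 0 <-> exists z, x = z *m d n.+1;
  mxr_fin : exists N, forall n, (N < n)%N -> b n = 0%N }.

Record mx_ext (b : nat -> nat) (e : forall n, 'I_(b n) -> int)
    (d : forall n, 'M[Ae]_(b n.+1, b n)) (dim : nat) (nu : A -> A) (l : int)
    (Phi : 'cV[Ae]_(b dim) -> A) : Prop := MxExt {
  mxe_vanish : forall i, i != dim -> forall f : 'cV[Ae]_(b i), d i *m f = 0 -> cobd d f;
  mxe_add : forall f g, d dim *m f = 0 -> d dim *m g = 0 -> Phi (f + g) = Phi f + Phi g;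
  mxe_mul : forall f, d dim *m f = 0 -> forall a c : A,
    Phi (f *m (tensor a c)%:M) = nu c * Phi f * a;
  mxe_surj : forall a, exists2 f, d dim *m f = 0 & Phi f = a;
  mxe_ker : forall f, d dim *m f = 0 -> (Phi f = 0 <-> cobd d f);
  mxe_hom : forall f j, d dim *m f = 0 ->
    colhom HA (@e dim) j f ->
    gcomp_int (l + j) (Phi f) }.

Lemma gcomp_env_unit (x : Ae) : gcomp_enveloping 0 x -> x != 0 -> exists u, u * x = 1.
Proof.
move=> /gcomp_env_scalar[c ->] cx.
have c0 : c != 0 by apply: contraNneq cx => ->; rewrite scale0r.
exists (c^-1 *: (1 : Ae)); rewrite !env_scaleE !mulr1 tensorM mulr1 -scalerAl mul1r.
by rewrite scalerA mulVf // scale1r.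
Qed.

Lemma gcomp_env_lt0 j (x : Ae) : j < 0 -> gcomp_enveloping j x -> x = 0.
Proof. by move=> j0 hx; apply: (gcomp_env_neg hx). Qed.

Record graded_basis (P : lmodType Ae) (G : int -> P -> Prop) := GradedBasis {
  gb_dim : nat; gb_deg : 'I_gb_dim -> int; gb_vec : 'I_gb_dim -> P;
  gb_crd : {linear P -> 'rV[Ae]_gb_dim};
  gb_hom : forall i, G (gb_deg i) (gb_vec i);
  gb_crdK : cancel gb_crd (comb gb_vec);
  gb_combK : cancel (comb gb_vec) gb_crd;
  gb_crd_hom : forall j x, G j x ->
    rowhom HA gb_deg j (gb_crd x) }.

Lemma nakayama_mx dim (nu : {lrmorphism A -> A}) : nakayama dim nu ->
  exists b e d al l Phi, @mx_resolution b e d al /\ @mx_ext b e d dim nu l Phi.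
Proof.
move=> [nug [P [G [[Gd GM Gdiff Gaug] fg [N hN] van [l [Phi [PhiD PhiM PhiS PhiK PhiG]]]]]]].
have free n : exists _ : graded_basis (G n), True.
  have [m [e [v [crd [h1 h2 h3 h4]]]]] :=
    graded_projective_free (@gcomp_env_direct k A) (@gcomp_envM k A)
      gcomp_env_lt0 gcomp_env_unit (Gd n) (@GM n) (fg n) (@res_projective _ _ P n).
  by exists (GradedBasis h1 h2 h3 h4).
pose B n := projT1 (cid (free n)).
pose b n := gb_dim (B n).
pose e n := @gb_deg _ _ (B n) : 'I_(b n) -> int.
pose v n := @gb_vec _ _ (B n) : 'I_(b n) -> P n.
pose crd n : {linear P n -> 'rV[Ae]_(b n)} := gb_crd (B n).
have hv n i : G n (e n i) (v n i) by apply: gb_hom.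
have crdK n : cancel (crd n) (comb (v n)) by apply: gb_crdK.
have combK n : cancel (comb (v n)) (crd n) by apply: gb_combK.
have crdG n j x : G n j x -> rowhom HA (e n) j (crd n x).
  exact: gb_crd_hom.
clearbody b e v crd; clear B free.
pose d := basis_mx v crd.
have dE n x := basis_mxE crdK x : crd n (res_diff P n x) = crd n.+1 x *m d n.
have augE x : comb (fun i => res_aug P (v 0%N i)) x = res_aug P (comb (v 0%N) x).
  by rewrite /comb linear_sum; apply: eq_bigr => i _; rewrite linearZ.
have crd0 n x : crd n x = 0 -> x = 0 by move=> h; rewrite -[x]crdK h linear0.
exists b, e, d, (fun i => res_aug P (v 0%N i)), l, (fun f => Phi (colfun crd f)).
split; split.
- move=> n i j; rewrite mxE.
  have := crdG n (e n.+1 i) _ (Gdiff _ _ _ (hv n.+1 i)) 0 j.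
  by rewrite add0r addr0.
- by move=> i; apply: Gaug.
- by move=> a; have [x <-] := res_aug_surj P a; exists (crd 0%N x); rewrite augE crdK.
- move=> x; rewrite augE res_exact0; split=> [[y yE]|[z ->]].
    by exists (crd 1%N y); rewrite -dE yE combK.
  exists (comb (v 1%N) z); rewrite -[LHS]crdK; congr comb.
  by rewrite dE combK.
- move=> n x; split=> [h|[z ->]].
    have /res_exactS[y yE] : res_diff P n (comb (v n.+1) x) = 0.
      by apply: crd0; rewrite dE combK.
    by exists (crd n.+2 y); rewrite -dE yE combK.
  rewrite -[z]combK -dE -dE; have /res_exactS -> : exists y, res_diff P n.+1 y =
    res_diff P n.+1 (comb (v n.+2) z) by exists (comb (v n.+2) z).
  by rewrite linear0.
(* A zero module has an empty basis, since a basis vector would have a coordinate equal to 1. *)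
- exists N => n hn; case E: (b n) => [//|m]; move: (hN n hn).
  have i : 'I_(b n) by rewrite E; apply: ord0.
  move=> /(_ (v n i)) vi0; have := combK n (delta_mx 0 i).
  rewrite comb_delta vi0 linear0 => /matrixP/(_ 0 i)/eqP.
  by rewrite !mxE !eqxx eq_sym oner_eq0.
- move=> i idim f hf; apply/(colfun_coboundary crdK combK).
  by apply: van => //; apply/(colfun_cocycle crdK).
- move=> f g hf hg; rewrite -PhiD; try exact/(colfun_cocycle crdK).
  by congr Phi; apply: funext => x; rewrite /colfun mulmxDr mxE.
- move=> f hf a c; rewrite -PhiM; last exact/(colfun_cocycle crdK).
  by congr Phi; apply: funext => x; rewrite /colfun mulmxA mulmx_scalarE.
- move=> a; have [F /(colfun_ex crdK)[f hf ->] FE] := PhiS a.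
  by exists f.
- move=> f hf; rewrite PhiK; last exact/(colfun_cocycle crdK).
  exact: colfun_coboundary.
- move=> f j hf hfj; apply: PhiG; first exact/(colfun_cocycle crdK).
  move=> i x hx; rewrite /colfun.
  have := mxhom_mul (@gcomp_env_direct k A) (@gcomp_envM k A) (crdG _ _ _ hx) hfj.
  by move=> /(_ 0 0); rewrite add0r subr0.
Qed.

Lemma mx_nakayama dim (nu : {lrmorphism A -> A}) b e d al l Phi :
  graded_aut nu -> @mx_resolution b e d al -> @mx_ext b e d dim nu l Phi -> nakayama dim nu.
Proof.
move=> nug [dhom alhom asurj ex0 exS [N hN]] [van PhiD PhiM PhiS PhiK PhiG].
split=> //.
have [P [v [crd [crdK combK dE augE]]]] := free_resolution_ex asurj ex0 exS.
pose G n (j : int) (x : P n) := rowhom HA (@e n) j (crd n x).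
have coc n (f : 'cV_(b n)) : cocycle (colfun crd f) <-> d n *m f = 0.
  by rewrite -dE; apply: colfun_cocycle.
have cob n (f : 'cV_(b n)) : coboundary (colfun crd f) <-> cobd d f.
  by rewrite -dE; apply: colfun_coboundary.
have ex n (F : P n -> Ae^o) : cocycle F -> exists2 f, d n *m f = 0 & F = colfun crd f.
  by rewrite -dE; apply: colfun_ex.
have hR n := mxhom_direct (@gcomp_env_direct k A) (fun _ : 'I_1 => 0) (@e n).
pose col n (F : P n -> Ae^o) : 'cV[Ae]_(b n) := \col_i F (v n i).
have colK n (f : 'cV_(b n)) : col n (colfun crd f) = f.
  by apply/matrixP => i j; rewrite ord1 mxE (colfun_v combK).
exists P, G; split.
- split.
  + move=> n; have combE j (z : 'rV_(b n)) : rowhom HA (@e n) j z ->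
      G n j (comb (v n) z) by rewrite /G combK.
    apply: (@direct_sum_intro _ _ _ (fun j x => comb (v n) (hcomp (hR n) j (crd n x)))).
    * by move=> j; rewrite /G linear0; apply: (dsum0 (hR n)).
    * by move=> j x z hx hz; rewrite /G linearB; apply: (dsumB (hR n)).
    * move=> Q Q0 QD QG x; rewrite -[x]crdK.
      apply: (@dsum_ind _ _ _ (hR n) (fun z => Q (comb (v n) z))) => [|z z' hz hz'|j z hz].
      - by rewrite linear0.
      - by rewrite linearD; apply: (QD).
      by apply: (QG j); apply: combE.
    * by move=> j x z; rewrite linearD hcompD linearD.
    * by move=> j x hx; rewrite hcomp_id ?crdK.
    * by move=> i j x hx ij; rewrite (hcomp_neq (hR n) hx ij) linear0.
  + move=> n i j a x ha hx; rewrite /G linearZ.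
    exact: (mxhomZ (@gcomp_env_direct k A) (@gcomp_envM k A)).
  + move=> n j x hx; rewrite /G (basis_mxE crdK) dE -[j]addr0.
    exact: (mxhom_mul (@gcomp_env_direct k A) (@gcomp_envM k A) hx (dhom n)).
  + move=> j x hx; rewrite augE; apply: (@dsum_sum _ _ _ (gcomp_int_direct A)) => i _.
    rewrite -[j](subrK (e 0%N i)); apply: gcomp_int_scale => //.
    by have := hx 0 i; rewrite add0r.
- move=> n; exists (b n), (v n) => x; exists (fun i => crd n x 0 i).
  by rewrite -[LHS]crdK.
- exists N => n hn x; rewrite -[x]crdK -[RHS](linear0 (comb (v n))); congr (comb _ _).
  by apply/matrixP => i j; have := ltn_ord j; rewrite [X in (_ < X)%N]hN.
- move=> i idim F /ex[f hf ->]; apply/cob; exact: van.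
exists l, (fun F => Phi (col dim F)); split.
- move=> F F' /ex[f hf ->] /ex[f' hf' ->]; rewrite !colK -PhiD //.
  congr Phi; rewrite -[RHS](colK dim); congr col; apply: funext => x.
  by rewrite /colfun mulmxDr [RHS]mxE.
- move=> F /ex[f hf ->] a c; rewrite colK -PhiM //.
  congr Phi; rewrite -[RHS](colK dim); congr col; apply: funext => x.
  by rewrite /colfun mulmxA mulmx_scalarE.
- move=> a; have [f hf <-] := PhiS a; exists (colfun crd f); rewrite ?colK //.
  exact/coc.
- by move=> F /ex[f hf ->]; rewrite colK PhiK // cob.
- move=> F j /ex[f hf ->] h; rewrite colK; apply: PhiG => // i i'; rewrite ord1 subr0.
  rewrite -(colfun_v combK); apply: h => i'' l'; rewrite (crd_v combK) add0r mxE.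
  case: eqP => _ /=; last by apply: gcomp_env0.
  case: eqP => [->|_]; last exact: gcomp_env0.
  rewrite subrr; exact: gcomp_env1.
Qed.

End MatrixForm.

(** * The top extension group over the enveloping algebra of D *)

Lemma gcomp_int_bounded (k : fieldType) (A : gralg k) : bounded_below (@gcomp_int k A).
Proof. by exists 0 => j x; apply: gcomp_int_neg. Qed.

Section Quotient.
Variables (k : fieldType) (D A : gralg k) (Omega : D) (m : nat) (m_gt0 : (0 < m)%N)
  (Omega_hom : gcomp D m Omega)
  (Omega_normal : normal_elt Omega) (Omega_regular : regular_elt Omega)
  (pi : {lrmorphism D -> A})
  (pi_hom : forall n x, gcomp D n x -> gcomp A n (pi x))
  (pi_surj : forall a, exists x, pi x = a)
  (pi_ker : forall x, pi x = 0 <-> two_sided_ideal (eq Omega) x).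
Local Notation iD := (gcomp_int_direct D).
Local Notation iA := (gcomp_int_direct A).

Lemma Omega_neq0 : Omega != 0.
Proof.
apply/eqP => O0; have [h _] := Omega_regular.
by have /eqP := h 1 0 (eq_trans (mulr1 _) (eq_trans O0 (esym (mulr0 _)))); rewrite oner_eq0.
Qed.

(** Normality moves every right factor to the left of [Omega], so the two-sided ideal consists of
    left multiples. *)
Lemma pi_kerP x : pi x = 0 <-> exists z, x = z * Omega.
Proof.
rewrite pi_ker; split=> [[s [hs ->]]|[z ->]]; last first.
  by exists [:: (z, Omega, 1)]; split=> [t|]; rewrite ?big_seq1 ?mulr1 // inE => /eqP->.
elim: s hs => [|t s IH] hs; first by exists 0; rewrite big_nil mul0r.
have [|z zE] := IH; first by move=> u us; apply: hs; rewrite inE us orbT.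
have [z' z'E] := Omega_normal.1 t.2.
exists (t.1.1 * z' + z); rewrite big_cons zE -(hs t) ?mem_head //.
by rewrite -mulrA z'E mulrA mulrDl.
Qed.

Lemma pi_kerPl x : pi x = 0 <-> exists z, x = Omega * z.
Proof.
rewrite pi_kerP; split=> -[z ->].
  by have [z' ->] := Omega_normal.2 z; exists z'.
by have [z' ->] := Omega_normal.1 z; exists z'.
Qed.

Lemma pi_Omega : pi Omega = 0.
Proof. by apply/pi_kerP; exists 1; rewrite mul1r. Qed.

Lemma pi_hcomp n x : hcomp iA n (pi x) = pi (hcomp iD n x).
Proof. exact: hcomp_graded. Qed.

Lemma pi_lift n (a : A) : gcomp_int n a -> exists2 x, gcomp_int n x & pi x = a.
Proof.
move=> ha; have [x xE] := pi_surj a; exists (hcomp iD n x); first exact: (hcompP iD).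
by rewrite -pi_hcomp xE hcomp_id.
Qed.

Lemma hcomp_mulOmega n x : hcomp iD n (x * Omega) = hcomp iD (n - m%:Z) x * Omega.
Proof.
by rewrite -{1}[n](subrK m%:Z); apply: hcomp_mulr.
Qed.

Lemma pi_ker_low n x : (n < m)%N -> gcomp D n x -> pi x = 0 -> x = 0.
Proof.
move=> nm hx /pi_kerP[z xE].
rewrite -(hcomp_id iD (hx : gcomp_int n%:Z x)) xE hcomp_mulOmega.
by rewrite (@gcomp_int_neg _ _ _ _ _ (hcompP iD (n%:Z - m%:Z) z)) ?mul0r //; lia.
Qed.

Lemma pi_ker_deg x : gcomp D m x -> pi x = 0 -> exists c : k, x = c *: Omega.
Proof.
move=> hx /pi_kerP[z xE].
rewrite -(hcomp_id iD (hx : gcomp_int m%:Z x)) xE hcomp_mulOmega subrr.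
have /gcomp_connected[c ->] : gcomp D 0 (hcomp iD 0 z) by apply: (hcompP iD 0 z).
by exists c; rewrite mulr_algl.
Qed.

(** Graded Nakayama with [L = 0]: every element of [K] is [phi] of an element of [K], whose degree
    is lower by [m]. *)
Lemma gralg_cancel (K : D -> Prop) (phi : D -> D) :
  {morph phi : x y / x + y} -> (forall j x, gcomp_int j x -> gcomp_int (j + m%:Z) (phi x)) ->
  K 0 -> (forall x y, K x -> K y -> K (x - y)) ->
  (forall j x, K x -> K (hcomp iD j x)) -> (forall x, K (phi x) -> K x) ->
  (forall x, K x -> exists z, x = phi z) -> forall x, K x -> x = 0.
Proof.
move=> phiD phiG K0 KB KG Kphi KL.
apply: (@graded_nakayama _ _ iD m%:Z phi K (fun x => x = 0)) => //.
- exact: gcomp_int_bounded.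
- by move=> x y -> ->; rewrite addr0.
- by move=> j _ ->; rewrite hcomp0.
- by move=> _ ->; apply: (addrI (phi 0)); rewrite -phiD !addr0.
- by move=> _ ->.
- by move=> x /KL[z ->]; exists 0, z; rewrite add0r.
Qed.

Section RankOne.
Hypotheses (D_gen : generated_in_degree_one D) (m_ge2 : (2 <= m)%N).
Local Notation De := (enveloping D).
Local Notation HD := (@gcomp_enveloping k D).
Local Notation Ht := (@gcomp_env_direct k D).
Variables (n : nat) (ec : 'I_n -> int) (Z B : 'cV[De]_n -> Prop) (Phi1 : 'cV[De]_n -> A)
  (kap kap' : {lrmorphism A -> A}) (l1 : int).
Local Notation hc := (mxhom_direct Ht ec (fun _ : 'I_1 => 0)).
Hypotheses (kapK : cancel kap kap')
  (kap_hom : forall i a, gcomp A i a -> gcomp A i (kap a))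
  (kap'K : cancel kap' kap).
Hypotheses (ZB : forall x y, Z x -> Z y -> Z (x - y)) (ZM : forall x r, Z x -> Z (x *m r%:M))
  (ZG : forall j x, Z x -> Z (hcomp hc j x))
  (Zreg : forall x, Z (x *m (tensor 1 Omega)%:M) -> Z x)
  (B0 : B 0) (BB : forall x y, B x -> B y -> B (x - y)) (BM : forall x r, B x -> B (x *m r%:M))
  (BG : forall j x, B x -> B (hcomp hc j x)) (BZ : forall x, B x -> Z x).
Hypotheses (F1D : forall x y, Z x -> Z y -> Phi1 (x + y) = Phi1 x + Phi1 y)
  (F1M : forall x, Z x -> forall a c : D,
     Phi1 (x *m (tensor a c)%:M) = kap (pi c) * Phi1 x * pi a)
  (F1ker : forall x, Z x -> Phi1 x = 0 ->
     exists u v, [/\ B u, Z v & x = u + v *m (tensor 1 Omega)%:M])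
  (F1B : forall x, B x -> Phi1 x = 0)
  (F1one : exists2 x, Z x & Phi1 x = 1)
  (F1hom : forall x j, Z x -> colhom HD ec j x ->
     gcomp_int (l1 + j) (Phi1 x))
  (Breg : forall x, Z x -> B (x *m (tensor 1 Omega)%:M) -> B x).

Let Z0 : Z 0. Proof. exact: BZ. Qed.
Let ZD x y : Z x -> Z y -> Z (x + y).
Proof. by move=> hx hy; rewrite -[y]opprK; apply: ZB => //; rewrite -sub0r; apply: ZB. Qed.
Let BN x : B x -> B (- x).
Proof. by move=> hx; rewrite -sub0r; apply: BB. Qed.
Let BD x y : B x -> B y -> B (x + y).
Proof. by move=> hx hy; rewrite -[y]opprK; apply: BB => //; apply: BN. Qed.
Let F10 : Phi1 0 = 0. Proof. exact: F1B. Qed.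
Let F1sub x y : Z x -> Z y -> Phi1 (x - y) = Phi1 x - Phi1 y.
Proof. by move=> hx hy; apply: (addIr (Phi1 y)); rewrite -F1D ?subrK //; apply: ZB. Qed.

(** As [Phi1] shifts degrees by [l1], only the component of degree [- l1] of a preimage of 1
    contributes to 1. *)
Let generator : exists e, [/\ Z e, Phi1 e = 1
  & colhom HD ec (- l1) e].
Proof.
have [e0 Ze0 F1e0] := F1one.
exists (hcomp hc (- l1) e0); split; [exact: ZG| |exact: (hcompP hc)].
have [s [us s0 sE]] := hcomp_sum hc e0.
have sumF (r : seq int) : Z (\sum_(j <- r) hcomp hc j e0) /\
    Phi1 (\sum_(j <- r) hcomp hc j e0) = \sum_(j <- r) Phi1 (hcomp hc j e0).
  elim: r => [|j r [IH1 IH2]]; first by rewrite !big_nil.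
  rewrite !big_cons; have Zj := ZG j Ze0; split; first exact: ZD.
  by rewrite F1D // IH2.
have := (sumF s).2; rewrite -sE F1e0 => /(congr1 (hcomp iA 0)).
rewrite hcomp_id; last exact: gcomp1.
rewrite hcomp_bigsum => ->.
have h j : hcomp iA 0 (Phi1 (hcomp hc j e0)) = if j == - l1 then Phi1 (hcomp hc (- l1) e0) else 0.
  have hj := F1hom (ZG j Ze0) (hcompP hc j e0).
  case: eqP hj => [->|jl] hj; first by move: hj; rewrite subrr; apply: hcomp_id.
  by apply: (hcomp_neq iA hj); apply/eqP; lia.
rewrite (eq_bigr _ (fun j _ => h j)) -big_mkcond /=.
have [ls|ls] := boolP (- l1 \in s).
  by rewrite -big_filter filter_pred1_uniq // big_seq1.
by rewrite (s0 _ ls) F10 big1_seq // => j /andP[/eqP-> js]; rewrite js in ls.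
Qed.

(** [Z] and [B] model cocycles and coboundaries in the top degree. The hypotheses say that
    [1 (x) Omega] is regular on [Z / B] with quotient [A] twisted by [kap]; so [Z / B] is free of
    rank one over [1 (x) D], with a twist lifting [kap]. *)
Lemma rank_one : exists (nu : {lrmorphism D -> D}) (Phi : 'cV[De]_n -> D),
  [/\ graded_aut nu, forall x, pi (nu x) = kap (pi x), exists c : k, nu Omega = c *: Omega
    & [/\ forall x y, Z x -> Z y -> Phi (x + y) = Phi x + Phi y,
          forall x, Z x -> forall a c : D, Phi (x *m (tensor a c)%:M) = nu c * Phi x * a,
          forall a, exists2 x, Z x & Phi x = a,
          forall x, Z x -> (Phi x = 0 <-> B x)
        & forall x j, Z x -> colhom HD ec j x ->
            gcomp_int (l1 + j) (Phi x)]].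
Proof.
have [e [Ze F1e he]] := generator.
pose act b := e *m (tensor 1 b : De)%:M.
have Zact b : Z (act b) by apply: ZM.
have actD b c : act (b + c) = act b + act c.
  by rewrite /act tensorDr raddfD /= mulmxDr.
have act0 : act 0 = 0 by apply: (addrI (act 0)); rewrite -actD !addr0.
have actN b : act (- b) = - act b by apply: (addrI (act b)); rewrite -actD !subrr act0.
have actB b c : act (b - c) = act b - act c by rewrite actD actN.
have actM b c : act b *m (tensor 1 c)%:M = act (c * b).
  by rewrite /act -mulmxA -scalar_mxM tensorM mulr1.
have F1act b : Phi1 (act b) = kap (pi b) by rewrite F1M // F1e rmorph1 !mulr1.
have act_hom i b : gcomp_int i b ->
    colhom HD ec (i - l1) (act b).
  move=> hb; rewrite addrC; apply: (mxhom_mul Ht (@gcomp_envM k D) he).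
  apply: (mxhom_scalar Ht); case: i hb => [i|i] /= hb.
    by apply: (@gcomp_env_tensor _ _ 0 i) => //; apply: gcomp1.
  by rewrite hb tensor0r; apply: gcomp_env0.
have act_hcomp i b : hcomp hc (i - l1) (act b) = act (hcomp iD i b).
  by apply: (@hcomp_map _ _ _ _ _ _ iD hc act (fun i => i - l1)) => // i' i'' /addIr.
have yhom : gcomp_enveloping m%:Z (tensor 1 Omega : De).
  by apply: (@gcomp_env_tensor _ _ 0 m) => //; apply: gcomp1.
(* Graded Nakayama for right multiplication by [1 (x) Omega], where [L] consists of the elements of
   [Z] congruent to some [act b] modulo [B]. *)
have gen x : Z x -> exists b, B (x - act b).
  move=> Zx; suff: Z x /\ exists b, B (x - act b) by case.
  move: x Zx; apply: (@graded_nakayama _ _ hc m%:Z (fun z => z *m (tensor 1 Omega)%:M) Z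
    (fun z => Z z /\ exists b, B (z - act b))) => //.
  - apply: mxhom_bounded; exact: gcomp_env_lt0.
  - by move=> u v; rewrite mulmxDl.
  - by move=> j u hu; apply: (mxhom_mul Ht (@gcomp_envM k D) hu); apply: (mxhom_scalar Ht).
  - by split=> //; exists 0; rewrite act0 subr0.
  - move=> u v [Zu [b hb]] [Zv [c hcc]]; split; first exact: ZD.
    by exists (b + c); rewrite actD opprD addrACA; apply: BD.
  - move=> j u [Zu [b hb]]; split; first exact: ZG.
    exists (hcomp iD (j + l1) b); rewrite -act_hcomp addrK -hcompB; exact: BG.
  - move=> u [Zu [b hb]]; split; first exact: ZM.
    by exists (Omega * b); rewrite -actM -mulmxBl; apply: BM.
  - by move=> u [].
  - move=> u Zu; have [a' aE] := pi_surj (kap' (Phi1 u)).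
    have Zu' : Z (u - act a') by apply: ZB.
    have [|v [v' [Bv Zv' vE]]] := F1ker Zu'.
      by rewrite F1sub // F1act aE kap'K subrr.
    exists (act a' + v), v'; split; last by rewrite -addrA -vE addrC subrK.
    split; first by apply: ZD => //; apply: BZ.
    by exists a'; rewrite addrC addKr.
(* If [act b] is a coboundary, [Phi1] puts [b] in [Omega D] and [Breg] removes the factor [Omega],
   so [gralg_cancel] applies. *)
have free b : B (act b) -> b = 0.
  apply: (@gralg_cancel (fun b => B (act b)) ( *%R Omega)).
  - by move=> x y; rewrite mulrDr.
  - by move=> j x hx; rewrite addrC; apply: gcomp_int_mul.
  - by rewrite act0.
  - by move=> x y hx hy; rewrite actB; apply: BB.
  - by move=> j x hx; rewrite -act_hcomp; apply: BG.
  - by move=> x; rewrite -actM => /Breg; apply.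
  - move=> x hx; apply/pi_kerPl; apply: (can_inj kapK).
    by rewrite rmorph0 -F1act F1B.
have uniq x b c : B (x - act b) -> B (x - act c) -> b = c.
  move=> hb hc'; apply/eqP; rewrite -subr_eq0; apply/eqP/free; rewrite actB.
  have -> : act b - act c = (x - act c) - (x - act b) by rewrite opprB [RHS]addrC addrA subrK.
  exact: BB.
have ZL a : Z (e *m (tensor a 1)%:M) by apply: ZM.
(* [mu] is defined by e (a (x) 1) = e (1 (x) mu a), and nu is its inverse *)
pose muf a := projT1 (cid (gen _ (ZL a))).
have mufE a : B (e *m (tensor a 1)%:M - act (muf a)) by rewrite /muf; case: cid.
have mufU a b : B (e *m (tensor a 1)%:M - act b) -> muf a = b by apply: uniq.
have [|||mu0 mu0E] := @make_rmorphism D D muf.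
- move=> a a'; apply: mufU; rewrite tensorDl raddfD /= mulmxDr actD opprD addrACA.
  exact: BD.
- move=> a a'; apply: mufU; rewrite -[tensor (a * a') 1](_ : tensor a 1 * tensor a' 1 = _);
    last by rewrite tensorM mulr1.
  rewrite scalar_mxM mulmxA.
  (* [a' (x) 1] is moved past [1 (x) mu a], which reverses the order, and the second factor
     multiplies in the opposite order; the two reversals cancel, so [mu] is multiplicative. *)
  have h1 : B (e *m (tensor a 1)%:M *m (tensor a' 1)%:M
      - e *m (tensor a' 1)%:M *m (tensor 1 (muf a))%:M).
    have := BM (tensor a' 1) (mufE a); rewrite mulmxBl /act.
    by rewrite -![_ *m _ *m (tensor _ _)%:M]mulmxA -!scalar_mxM !tensorM !mulr1 !mul1r.
  have h2 := BM (tensor 1 (muf a)) (mufE a'); rewrite mulmxBl actM in h2.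
  by have := BD h1 h2; rewrite addrA subrK.
- by apply: mufU; rewrite /act subrr.
have [|mu muE'] := @make_lrmorphism _ _ _ mu0.
  by move=> c; rewrite mu0E; apply: mufU; rewrite /act tensorZ subrr.
have muE a : B (e *m (tensor a 1)%:M - act (mu a)) by rewrite muE' mu0E.
have muU a b : B (e *m (tensor a 1)%:M - act b) -> mu a = b by move=> h; rewrite muE' mu0E; apply: mufU.
have mu_hom i a : gcomp D i a -> gcomp D i (mu a).
  move=> ha; rewrite (_ : mu a = hcomp iD i (mu a)); first exact: (hcompP iD i%:Z).
  apply: muU; rewrite -act_hcomp.
  have h : colhom HD ec (i%:Z - l1)
      (e *m (tensor a 1)%:M).
    rewrite addrC; apply: (mxhom_mul Ht (@gcomp_envM k D) he).
    apply: (mxhom_scalar Ht); rewrite -[i]addn0; apply: gcomp_env_tensor => //; exact: gcomp1.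
  by rewrite -(hcomp_id hc h) -hcompB; apply: BG.
(* [Phi1] is applied to the congruence that defines [mu a]. *)
have pimu a : kap (pi (mu a)) = pi a.
  have := F1B (muE a); rewrite F1sub // F1act F1M // F1e !rmorph1 !mul1r => /eqP.
  by rewrite subr_eq0 => /eqP.
have mu_kerpi a : mu a = 0 -> pi a = 0 by move=> h; rewrite -pimu h !rmorph0.
have mu_surj x : exists a, mu a = x.
  (* in degree 1 the map [pi] is injective, as [2 <= m] *)
  have deg1 y : gcomp D 1 y -> exists a, mu a = y.
    move=> hy; have [a ha aE] := @pi_lift 1 (kap (pi y)) (kap_hom (pi_hom hy)).
    exists a; apply/eqP; rewrite -subr_eq0; apply/eqP; apply: (@pi_ker_low 1) => //.
      by apply: (dsumB (gcomp_direct D)) => //; apply: mu_hom.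
    by rewrite rmorphB /=; apply/eqP; rewrite subr_eq0; apply/eqP/(can_inj kapK); rewrite pimu.
  have [ws [hws ->]] := D_gen x; elim: ws hws => [|u ws IH] hws.
    by exists 0; rewrite big_nil rmorph0.
  have [|a aE] := IH; first by move=> w' w's; apply: hws; rewrite inE w's orbT.
  have hu := hws u (mem_head _ _).
  have [c cE] : exists c, mu c = \prod_(y <- u.2) y.
    elim: (u.2) hu => [|y ys IHy] hy; first by exists 1; rewrite big_nil rmorph1.
    have [|c cE] := IHy; first by move=> y' ys'; apply: hy; rewrite inE ys' orbT.
    have [y' y'E] := deg1 y (hy y (mem_head _ _)).
    by exists (y' * c); rewrite big_cons rmorphM /= cE y'E.
  by exists (u.1 *: c + a); rewrite big_cons linearP /= cE aE.
(* [mu Omega] has degree [m] and is killed by [pi], whose kernel in that degree is the line of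
   [Omega]. *)
have [lam lamE] : exists c : k, mu Omega = c *: Omega.
  apply: pi_ker_deg; first exact: mu_hom.
  by apply: (can_inj kapK); rewrite pimu pi_Omega rmorph0.
(* Otherwise a preimage of [Omega] under [mu], being a left multiple of [Omega], would be sent to
   0. *)
have lam0 : lam != 0.
  apply/eqP => l0; rewrite l0 scale0r in lamE.
  have [u uE] := mu_surj Omega; have : pi u = 0 by rewrite -pimu uE pi_Omega rmorph0.
  move=> /pi_kerP[z zE]; have := Omega_neq0.
  by rewrite -uE zE rmorphM /= lamE mulr0 eqxx.
(* The kernel of [mu] lies in [D Omega], and as [lam] is nonzero a right factor [Omega] can be
   cancelled in it. *)
have mu_inj : injective mu.
  move=> x y /eqP; rewrite -subr_eq0 -rmorphB => /eqP h; apply/eqP; rewrite -subr_eq0.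
  apply/eqP; move: (x - y) h => {x y}.
  apply: (@gralg_cancel (fun b => mu b = 0) ( *%R^~ Omega)).
  - by move=> x y; rewrite mulrDl.
  - by move=> j x hx; apply: gcomp_int_mul.
  - by rewrite rmorph0.
  - by move=> x y hx hy; rewrite rmorphB /= hx hy subrr.
  - by move=> j x hx; rewrite -hcomp_graded // hx hcomp0.
  - move=> x; rewrite rmorphM /= lamE -scalerAr => /eqP; rewrite scaler_eq0 (negPf lam0) /=.
    by move/eqP => h; apply: Omega_regular.2; rewrite /= h mul0r.
  - by move=> x /mu_kerpi /pi_kerP.
have [nu [muK nuK]] : exists nu : {lrmorphism D -> D}, cancel mu nu /\ cancel nu mu.
  apply: inverse_lrmorphism; pose g x := projT1 (cid (mu_surj x)).
  have gE x : mu (g x) = x by rewrite /g; case: cid.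
  by exists g => // x; apply: mu_inj.
have nu_hom := inverse_graded muK nuK mu_hom.
(* This is the coordinate of a class on [e]. That of [x (a (x) c)] is [c * bz x * mu a]; applying
   [nu] turns the outer factors into [nu c] and [a]. *)
pose bz z := xget 0 (fun b => B (z - act b)).
have bzE z : Z z -> B (z - act (bz z)).
  by move=> /gen[b hb]; rewrite /bz; case: xgetP => // /(_ b).
have bzU z b : B (z - act b) -> bz z = b.
  move=> hb; apply: (uniq z) => //; apply: bzE.
  by rewrite -[z](subrK (act b)); apply: ZD => //; apply: BZ.
exists nu, (fun z => nu (bz z)); split.
- by split; first by exists mu.
- by move=> x; rewrite -[RHS]/(kap (pi x)) -{2}[x]nuK pimu.
- by exists lam^-1; apply: mu_inj; rewrite nuK linearZ /= lamE scalerA mulVf // scale1r.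
split.
- move=> x y Zx Zy; rewrite -rmorphD; congr (nu _); apply: bzU.
  by rewrite actD opprD addrACA; apply: BD; apply: bzE.
- move=> x Zx a c; rewrite -[a in RHS]muK -!rmorphM; congr (nu _); apply: bzU.
  have h1 := BM (tensor a c) (bzE _ Zx); rewrite mulmxBl in h1.
  have h2 := BM (tensor 1 (c * bz x)) (muE a).
  have e2 : act (bz x) *m (tensor a c)%:M = e *m (tensor a 1)%:M *m (tensor 1 (c * bz x))%:M.
    by rewrite /act -!mulmxA -!scalar_mxM !tensorM !mul1r !mulr1.
  rewrite mulmxBl -e2 actM in h2.
  by have := BD h1 h2; rewrite addrA subrK.
- move=> a; exists (act (mu a)) => //.
  by rewrite (@bzU _ (mu a)) ?muK // subrr.
- move=> x Zx; split=> [h|Bx].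
    have b0 : bz x = 0 by apply: (can_inj nuK); rewrite h rmorph0.
    by have := bzE _ Zx; rewrite b0 act0 subr0.
  by rewrite (@bzU _ 0) ?rmorph0 // act0 subr0.
- move=> x j Zx hx; apply: (gcomp_int_map nu_hom).
  rewrite (_ : bz x = hcomp iD (l1 + j) (bz x)); first exact: (hcompP iD).
  apply: bzU; rewrite -act_hcomp addrAC subrr add0r.
  by rewrite -{1}(hcomp_id hc hx) -hcompB; apply: BG; apply: bzE.
Qed.

End RankOne.
End Quotient.

(** * Regular and normal elements of the enveloping algebra *)

Lemma linear_retraction (k : fieldType) (U V : lmodType k) (f : {linear U -> V}) :
  injective f -> exists r : {linear V -> U}, cancel f r.
Proof.
move=> fI.
have [||p [pI pid]] := @subspace_projector k V (fun v => exists u, f u = v).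
- by exists 0; rewrite linear0.
- by move=> c _ _ [u <-] [v <-]; exists (c *: u + v); rewrite linearP.
have [r rE] := linear_lifting pI.
by exists r => u; apply: fI; rewrite rE pid //; exists u.
Qed.

Section MulLinear.
Variables (k : fieldType) (A : algType k) (a : A).
Fact lmul_linear : linear (fun x : A => a * x).
Proof. by move=> c x y; rewrite mulrDr scalerAr. Qed.
Fact rmul_linear : linear (fun x : A => x * a).
Proof. by move=> c x y; rewrite mulrDl scalerAl. Qed.
Definition lmul : {linear A -> A} :=
  HB.pack (fun x : A => a * x) (GRing.isLinear.Build k A A *:%R _ lmul_linear).
Definition rmul : {linear A -> A} :=
  HB.pack (fun x : A => x * a) (GRing.isLinear.Build k A A *:%R _ rmul_linear).
End MulLinear.

Section TensorNormal.
Variables (k : fieldType) (D A : algType k) (Omega : D)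
  (Omega_normal : normal_elt Omega) (Omega_regular : regular_elt Omega)
  (pi : {lrmorphism D -> A}) (pi_surj : forall a, exists x, pi x = a)
  (pi_ker : forall x, pi x = 0 <-> exists z, x = z * Omega)
  (pi_kerl : forall x, pi x = 0 <-> exists z, x = Omega * z).
Variables (tau tau' : {lrmorphism D -> D}).
Hypotheses (tauK : cancel tau tau') (tau'K : cancel tau' tau)
  (tauE : forall x, Omega * x = tau x * Omega).
Local Notation De := (enveloping D).
Local Notation y := (tensor 1 Omega : De).
Local Notation w := (tensor Omega 1 : De).

(** The tensor product of two retractions is a retraction of the tensor product. Injective linear
    maps over a field have retractions, so regularity passes from [a] and [b] to [a (x) b]. *)
Let tmap_injective (f g f' g' : {linear D -> D}) (F : {linear De -> De}) :
  (forall a b, F (tensor a b) = tensor (f a) (g b)) ->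
  cancel f f' -> cancel g g' -> injective F.
Proof.
move=> FE fK gK; have [h hE] := tensor_map f' g'; apply: (can_inj (g := h)).
elim/env_ind => [|s u hs hu|a b]; first by rewrite !linear0.
  by rewrite !linearD hs hu.
by rewrite FE hE fK gK.
Qed.

Let mul_tensor a b : exists F : {linear De -> De},
  [/\ F =1 *%R (tensor a b) & forall x z, F (tensor x z) = tensor (a * x) (z * b)].
Proof.
have [F FE] := tensor_map (lmul a) (rmul b); exists F; split=> // t.
elim/env_ind: t => [|s u hs hu|x z]; first by rewrite linear0 mulr0.
  by rewrite linearD hs hu mulrDr.
by rewrite FE tensorM.
Qed.

Let tensor_mul a b : exists F : {linear De -> De},
  [/\ F =1 *%R^~ (tensor a b) & forall x z, F (tensor x z) = tensor (x * a) (b * z)].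
Proof.
have [F FE] := tensor_map (rmul a) (lmul b); exists F; split=> // t.
elim/env_ind: t => [|s u hs hu|x z]; first by rewrite linear0 mul0r.
  by rewrite linearD hs hu mulrDl.
by rewrite FE tensorM.
Qed.

Let tensor_regular a b : regular_elt a -> regular_elt b -> regular_elt (tensor a b : De).
Proof.
move=> [al ar] [bl br].
have [r1 r1K] := @linear_retraction _ _ _ (lmul a) al.
have [r2 r2K] := @linear_retraction _ _ _ (rmul a) ar.
have [r3 r3K] := @linear_retraction _ _ _ (lmul b) bl.
have [r4 r4K] := @linear_retraction _ _ _ (rmul b) br.
split.
  have [F [FE FT]] := mul_tensor a b; apply: (eq_inj _ FE).
  exact: (@tmap_injective (lmul a) (rmul b) r1 r4).
have [F [FE FT]] := tensor_mul a b; apply: (eq_inj _ FE).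
exact: (@tmap_injective (rmul a) (lmul b) r2 r3).
Qed.

Let regular1 : regular_elt (1 : D).
Proof. by split=> x z /=; rewrite ?mul1r ?mulr1. Qed.

Lemma tensor_y_regular : regular_elt y. Proof. exact: tensor_regular. Qed.
Let tensor_w_regular : regular_elt w. Proof. exact: tensor_regular. Qed.

(** The second factor multiplies in the opposite order, so moving [y] from left to right applies
    [tau'] there, and the other direction applies [tau]. *)
Lemma tensor_y_normal : normal_elt y.
Proof.
split=> t.
  have [h hE] := tensor_rmorphism (idfun : {lrmorphism D -> D}) tau'; exists (h t).
  elim/env_ind: t => [|s u hs hu|a b]; first by rewrite rmorph0 mulr0 mul0r.
    by rewrite rmorphD mulrDr mulrDl hs hu.
  by rewrite hE !tensorM mul1r mulr1 tauE tau'K.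
have [h hE] := tensor_rmorphism (idfun : {lrmorphism D -> D}) tau; exists (h t).
elim/env_ind: t => [|s u hs hu|a b]; first by rewrite rmorph0 mulr0 mul0r.
  by rewrite rmorphD mulrDr mulrDl hs hu.
by rewrite hE !tensorM mul1r mulr1 tauE.
Qed.

Lemma tensor_w_twist (theta : {rmorphism De -> De}) :
  (forall a b, theta (tensor a b) = tensor (tau a) b) -> forall t, w * t = theta t * w.
Proof.
move=> thE t; elim/env_ind: t => [|s u hs hu|a b].
- by rewrite rmorph0 mulr0 mul0r.
- by rewrite rmorphD mulrDr mulrDl hs hu.
- by rewrite thE !tensorM mul1r mulr1 tauE.
Qed.

(* [B1] is D (x) A^op. *)
Lemma intermediate_ring (theta theta' : {rmorphism De -> De}) :
  (forall a b, theta (tensor a b) = tensor (tau a) b) ->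
  (forall a b, theta' (tensor a b) = tensor (tau' a) b) ->
  exists (B1 : nzRingType) (q1 : {rmorphism De -> B1}) (q2 : {rmorphism B1 -> enveloping A})
    (th th' : {rmorphism B1 -> B1}),
  [/\ [/\ forall a, exists x, q1 x = a, forall a, exists x, q2 x = a,
          forall x, q1 x = 0 <-> exists z, x = z * y
        & forall x, q2 x = 0 <-> exists z, x = z * q1 w],
      [/\ cancel th th', cancel th' th, forall x, q1 w * x = th x * q1 w
        & regular_elt (q1 w)],
      forall a b, q2 (q1 (tensor a b)) = tensor (pi a) (pi b),
      forall x, th (q1 x) = q1 (theta x)
    & forall x, th' (q1 x) = q1 (theta' x)].
Proof.
move=> thE th'E.
have [rho rhoE] := tensor_rmorphism pi pi.
have piO : pi Omega = 0 by apply/pi_ker; exists 1; rewrite mul1r.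
have [|||||B1 [q1 [q1s q1k]]] := @quotient_ring_exists De (fun x => exists z, x = z * y).
- by move=> _ _ [u ->] [v ->]; exists (u - v); rewrite mulrBl.
- by move=> a _ [u ->]; exists (a * u); rewrite mulrA.
- move=> a _ [u ->]; have [a' a'E] := tensor_y_normal.1 a.
  by exists (u * a'); rewrite -[LHS]mulrA a'E mulrA.
- move=> [z /(congr1 rho)]; rewrite rmorph1 rmorphM rhoE piO tensor0r mulr0.
  by move/eqP; rewrite oner_eq0.
- by exists 0; rewrite mul0r.
have rho_surj a : exists x, rho x = a.
  elim/env_ind: a => [|s t [s' <-] [t' <-]|a b]; first by exists 0; rewrite rmorph0.
    by exists (s' + t'); rewrite rmorphD.
  have [a' <-] := pi_surj a; have [b' <-] := pi_surj b.
  by exists (tensor a' b'); rewrite rhoE.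
have [|q2 q2E] := factor_rmorphism (p := q1) (f := rho) q1s.
  by move=> x /q1k[z ->]; rewrite rmorphM rhoE piO tensor0r mulr0.
have [|s sE] := @linear_lifting k A A D pi (idfun : {linear A -> A}).
  by move=> a; apply: pi_surj.
(* [p] is a projector with kernel [ker pi]. Then [P = id (x) p] chooses representatives modulo [y]
   and commutes with multiplication by [w], so regularity of [w] descends to [B1]. *)
pose p : {linear D -> D} := s \o pi.
have pO b : pi (b - p b) = 0 by rewrite rmorphB /= [pi (s _)]sE subrr.
have [P PE] := tensor_map (idfun : {linear D -> D}) p.
have [Q QE] := tensor_map p p.
have q1P t : q1 t = q1 (P t).
  elim/env_ind: t => [|t u ht hu|a b]; first by rewrite linear0.
    by rewrite linearD !rmorphD ht hu.
  apply/eqP; rewrite -subr_eq0 -rmorphB PE /=; apply/eqP/q1k.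
  have /pi_kerl[z zE] := pO b; exists (tensor a z); rewrite tensorM mulr1 -zE.
  by rewrite [in RHS]tensorDr -[- p b]scaleN1r tensorZr scaleN1r.
have Pq t : q1 t = 0 -> P t = 0.
  move=> /q1k[z ->]; elim/env_ind: z => [|u v hu hv|a b].
  - by rewrite mul0r linear0.
  - by rewrite mulrDl linearD hu hv addr0.
  - rewrite tensorM mulr1 PE /=; have -> : pi (Omega * b) = 0 by apply/pi_kerl; exists b.
    by rewrite linear0 tensor0r.
have PwM t : P (t * w) = P t * w.
  elim/env_ind: t => [|u v hu hv|a b]; first by rewrite !(mul0r, linear0).
    by rewrite mulrDl !linearD hu hv mulrDl.
  by rewrite tensorM mul1r !PE tensorM mul1r.
have PwMl t : P (w * t) = w * P t.
  elim/env_ind: t => [|u v hu hv|a b]; first by rewrite !(mulr0, linear0).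
    by rewrite mulrDr !linearD hu hv mulrDr.
  by rewrite tensorM mulr1 !PE tensorM mulr1.
have q1w t : q1 t * q1 w = 0 -> q1 t = 0.
  rewrite -rmorphM => /Pq; rewrite PwM => h.
  by rewrite q1P (tensor_w_regular.2 (P t) 0) ?rmorph0 //= h mul0r.
have q1wl t : q1 w * q1 t = 0 -> q1 t = 0.
  rewrite -rmorphM => /Pq; rewrite PwMl => h.
  by rewrite q1P (tensor_w_regular.1 (P t) 0) ?rmorph0 //= h mulr0.
have thy : theta y = y by rewrite thE rmorph1.
have th'y : theta' y = y by rewrite th'E rmorph1.
have [|th thQ] := factor_rmorphism (p := q1) (f := q1 \o theta) q1s.
  by move=> x /q1k[z ->]; rewrite /= rmorphM thy; apply/q1k; exists (theta z).
have [|th' th'Q] := factor_rmorphism (p := q1) (f := q1 \o theta') q1s.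
  by move=> x /q1k[z ->]; rewrite /= rmorphM th'y; apply/q1k; exists (theta' z).
have cK (f g : {lrmorphism D -> D}) (F G : {rmorphism De -> De}) : cancel f g ->
    (forall a b, F (tensor a b) = tensor (f a) b) ->
    (forall a b, G (tensor a b) = tensor (g a) b) -> cancel F G.
  move=> fK FE GE; elim/env_ind => [|u v hu hv|a b]; first by rewrite !rmorph0.
    by rewrite !rmorphD hu hv.
  by rewrite FE GE fK.
have thK := cK _ _ _ _ tauK thE th'E; have th'K := cK _ _ _ _ tau'K th'E thE.
have decomp t : exists u, q1 t = q1 (Q t) + u * q1 w.
  elim/env_ind: t => [|t u [t' ht] [u' hu]|a b].
  - by exists 0; rewrite linear0 rmorph0 mul0r addr0.
  - by exists (t' + u'); rewrite linearD !rmorphD ht hu mulrDl addrACA.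
  have /pi_ker[z zE] := pO a; exists (q1 (P (tensor z b))).
  rewrite q1P !PE QE /= -rmorphM tensorM mul1r -zE -rmorphD -tensorDl.
  by rewrite addrC subrK.
exists B1, q1, q2, th, th'; split=> //; [split=> //|split|].
- by move=> a; have [x xE] := rho_surj a; exists (q1 x); rewrite q2E.
- move=> a; have [x <-] := q1s a; rewrite q2E; split=> [rx|[z zE]].
    have [u ->] := decomp x; exists u.
    suff -> : Q x = 0 by rewrite rmorph0 add0r.
    have [h hE] := tensor_map s s; rewrite -(linear0 h) -rx.
    elim/env_ind: {rx} x => [|t v ht hv|c b]; first by rewrite rmorph0 !linear0.
      by rewrite rmorphD !linearD ht hv.
    by rewrite QE rhoE hE.
  by rewrite -q2E zE rmorphM q2E rhoE piO tensor0l mulr0.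
- by move=> a; have [x <-] := q1s a; rewrite thQ th'Q /= thK.
- by move=> a; have [x <-] := q1s a; rewrite th'Q thQ /= th'K.
- move=> a; have [x <-] := q1s a; rewrite thQ /= -!rmorphM; congr (q1 _).
  exact: tensor_w_twist.
- split=> a c e.
    apply/eqP; rewrite -subr_eq0; have [x xE] := q1s (a - c); rewrite -xE.
    by apply/eqP/q1wl; rewrite xE mulrBr e subrr.
  apply/eqP; rewrite -subr_eq0; have [x xE] := q1s (a - c); rewrite -xE.
  by apply/eqP/q1w; rewrite xE mulrBl e subrr.
- by move=> a b; rewrite q2E rhoE.
Qed.

End TensorNormal.

Lemma induced_automorphism (k : fieldType) (D A : algType k) (pi : {lrmorphism D -> A})
    (sigma sigma' : {lrmorphism D -> D}) :
  (forall a, exists x, pi x = a) -> cancel sigma sigma' -> cancel sigma' sigma ->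
  (forall x, pi x = 0 -> pi (sigma x) = 0) -> (forall x, pi x = 0 -> pi (sigma' x) = 0) ->
  exists sA sA' : {lrmorphism A -> A}, [/\ cancel sA sA', cancel sA' sA,
    forall x, sA (pi x) = pi (sigma x) & forall x, sA' (pi x) = pi (sigma' x)].
Proof.
move=> ps sK s'K h h'.
have [sA sAE] := factor_lrmorphism (p := pi) (f := pi \o sigma) ps h.
have [sA' sA'E] := factor_lrmorphism (p := pi) (f := pi \o sigma') ps h'.
exists sA, sA'; split=> // a; have [x <-] := ps a.
  by rewrite sAE sA'E /= sK.
by rewrite sA'E sAE /= s'K.
Qed.

(** * The resolution of [D] over its enveloping algebra *)

Section Construction.
Variables (k : fieldType) (D A : gralg k) (Omega : D) (m : nat) (m_gt0 : (0 < m)%N)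
  (Omega_hom : gcomp D m Omega)
  (Omega_normal : normal_elt Omega) (Omega_regular : regular_elt Omega)
  (pi : {lrmorphism D -> A})
  (pi_hom : forall n x, gcomp D n x -> gcomp A n (pi x))
  (pi_surj : forall a, exists x, pi x = a)
  (pi_ker : forall x, pi x = 0 <-> two_sided_ideal (eq Omega) x).
Local Notation iD := (gcomp_int_direct D).
Local Notation iA := (gcomp_int_direct A).
Local Notation kerP := (pi_kerP Omega_normal pi_ker).
Local Notation kerPl := (pi_kerPl Omega_normal pi_ker).
Local Notation piO := (pi_Omega Omega_normal pi_ker).

Lemma hcomp_lmulOmega n x : hcomp iD n (Omega * x) = Omega * hcomp iD (n - m%:Z) x.
Proof.
by rewrite -{1}[n](subrK m%:Z) addrC; apply: hcomp_mull.
Qed.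

(** [tau] preserves degrees because [Omega] is homogeneous: components of [Omega x = tau x Omega]
    are compared and [Omega] is cancelled. *)
Lemma tau_exists : exists tau tau' : {lrmorphism D -> D},
  [/\ cancel tau tau', cancel tau' tau, forall x, Omega * x = tau x * Omega,
      forall i x, gcomp_int i x -> gcomp_int i (tau x)
    & forall i x, gcomp_int i x -> gcomp_int i (tau' x)].
Proof.
have [t0 [t0' [t0K t0'K t0E]]] := normal_automorphism Omega_normal Omega_regular.
have [|tau tauE] := @make_lrmorphism _ _ _ t0.
  by move=> c; apply: Omega_regular.2; rewrite /= -t0E mulr_algl -scalerAr mulr1.
have [|tau' tau'E] := @make_lrmorphism _ _ _ t0'.
  move=> c; apply: Omega_regular.1; rewrite /= t0E t0'K.
  by rewrite mulr_algl -scalerAr mulr1.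
have tO x : Omega * x = tau x * Omega by rewrite t0E tauE.
have tO' x : Omega * tau' x = x * Omega by rewrite t0E tau'E t0'K.
have hc i x : hcomp iD i (tau x) = tau (hcomp iD i x).
  apply: Omega_regular.2; rewrite /= -tO.
  have := hcomp_mulOmega Omega_hom (i + m%:Z) (tau x); rewrite addrK => <-.
  by rewrite -tO hcomp_lmulOmega addrK.
have hc' i x : hcomp iD i (tau' x) = tau' (hcomp iD i x).
  apply: Omega_regular.1; rewrite /= tO'.
  have := hcomp_lmulOmega (i + m%:Z) (tau' x); rewrite addrK => <-.
  by rewrite tO' (hcomp_mulOmega Omega_hom) addrK.
exists tau, tau'; split=> // [x|x|i x hx|i x hx].
- by rewrite tauE tau'E t0K.
- by rewrite tauE tau'E t0'K.
- by rewrite -(hcomp_id iD hx) -hc; apply: (hcompP iD).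
- by rewrite -(hcomp_id iD hx) -hc'; apply: (hcompP iD).
Qed.

Lemma env_lift n (rho : {rmorphism enveloping D -> enveloping A}) :
  (forall a b, rho (tensor a b) = tensor (pi a) (pi b)) ->
  forall t : enveloping A, gcomp_enveloping n t ->
  exists2 t' : enveloping D, gcomp_enveloping n t' & rho t' = t.
Proof.
move=> rhoE t ht; elim/gcomp_env_ind: ht => [|u v [u' hu <-] [v' hv <-]|i j a b ha hb ij].
- by exists 0; [apply: gcomp_env0|rewrite rmorph0].
- by exists (u' + v'); [apply: gcomp_envD|rewrite rmorphD].
have [a' ha' <-] := pi_lift pi_hom pi_surj (ha : gcomp_int i%:Z a).
have [b' hb' <-] := pi_lift pi_hom pi_surj (hb : gcomp_int j%:Z b).
by exists (tensor a' b'); rewrite ?rhoE // -ij; apply: gcomp_env_tensor.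
Qed.

Hypotheses (D_gen : generated_in_degree_one D) (m_ge2 : (2 <= m)%N).
Variables (tau tau' : {lrmorphism D -> D}).
Hypotheses (tauK : cancel tau tau') (tau'K : cancel tau' tau)
  (tauE : forall x, Omega * x = tau x * Omega)
  (tau_hom : forall i x, gcomp_int i x -> gcomp_int i (tau x))
  (tau'_hom : forall i x, gcomp_int i x -> gcomp_int i (tau' x)).
Variables (tauA tauA' : {lrmorphism A -> A}).
Hypotheses (tauAK : cancel tauA tauA') (tauA'K : cancel tauA' tauA)
  (tauAE : forall x, tauA (pi x) = pi (tau x))
  (tauA'E : forall x, tauA' (pi x) = pi (tau' x)).
Local Notation De := (enveloping D).
Local Notation Ae := (enveloping A).
Local Notation HD := (@gcomp_enveloping k D).
Local Notation homD := (mxhom HD).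
Local Notation HtD := (@gcomp_env_direct k D).
Local Notation HmD := (@gcomp_envM k D).

Section Data.
Variables (dim : nat) (nuA : {lrmorphism A -> A}) (nuA_aut : graded_aut nuA).
Variables (b : nat -> nat) (e : forall n, 'I_(b n) -> int)
  (d : forall n, 'M[Ae]_(b n.+1, b n)) (al : 'I_(b 0) -> regular_bimodule A)
  (l : int) (Phi : 'cV[Ae]_(b dim) -> A).
Hypotheses (res : mx_resolution e d al) (ext : mx_ext e d nuA l Phi).

Theorem lift_nakayama : exists nuD : {lrmorphism D -> D},
  [/\ nakayama dim.+1 nuD, forall x, pi (nuD x) = tauA (nuA (pi x))
    & exists c : k, nuD Omega = c *: Omega].
Proof.
have [theta thE] := tensor_rmorphism tau (idfun : {lrmorphism D -> D}).
have [theta' th'E] := tensor_rmorphism tau' (idfun : {lrmorphism D -> D}).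
have [B1 [q1 [q2 [th [th' [[q1s q2s q1k q2k] [thK th'K thw wreg] q12 thq th'q]]]]]] :=
  intermediate_ring Omega_regular pi_surj kerP kerPl tauK tau'K tauE thE th'E.
pose y : De := tensor 1 Omega; pose w : De := tensor Omega 1.
have yhom : gcomp_enveloping m%:Z y by apply: (@gcomp_env_tensor _ _ 0 m) => //; apply: gcomp1.
have whom : gcomp_enveloping m%:Z w.
  by rewrite -[m]addn0; apply: gcomp_env_tensor => //; apply: gcomp1.
have q1y : q1 y = 0 by apply/q1k; exists 1; rewrite mul1r.
have yreg := tensor_y_regular Omega_regular.
have ynorm := tensor_y_normal tau'K tauE.
(* Lifts are taken directly over [De], where homogeneity makes sense, and then pushed to [B1]. *)
have [dh dh_hom dhE] : exists2 dh : forall n, 'M[De]_(b n.+1, b n),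
    forall n, homD (@e n.+1) (@e n) 0 (dh n)
    & forall n, map_mx q2 (map_mx q1 (dh n)) = d n.
  have h n i j : exists t : De, gcomp_enveloping (e i + 0 - e j) t /\ q2 (q1 t) = d n i j.
    have [t ht tE] := @env_lift _ (q2 \o q1) q12 _ (mxr_hom res i j).
    by exists t.
  exists (fun n => \matrix_(i, j) projT1 (cid (h n i j))).
    by move=> n i j; rewrite mxE; case: cid => t [].
  by move=> n; apply/matrixP => i j; rewrite !mxE; case: cid => t [].
pose d1 n := map_mx q1 (dh n).
have d1E n : map_mx q2 (d1 n) = d n by apply: dhE.
have d0 : forall n, d n.+1 *m d n = 0 := exact_complex (@mxr_exactS _ _ _ _ _ _ res).
have [sh sh_hom shE] : exists2 sh : forall n, 'M[De]_(b n.+2, b n),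
    forall n, homD (@e n.+2) (@e n) (- m%:Z) (sh n)
    & forall n, d1 n.+1 *m d1 n = - (map_mx q1 (sh n) *m (q1 w)%:M).
  have h n : exists s : 'M[De]_(b n.+2, b n),
      homD (@e n.+2) (@e n) (- m%:Z) s /\
      d1 n.+1 *m d1 n = - (map_mx q1 s *m (q1 w)%:M).
    have /(map_mx_ker _ q2k)[s1 s1E] : map_mx q2 (d1 n.+1 *m d1 n) = 0.
      by rewrite map_mxM !d1E d0.
    have [s0 s0E] := map_mx_lift s1 q1s.
    have /(map_mx_ker _ q1k)[N NE] : map_mx q1 (dh n.+1 *m dh n - s0 *m w%:M) = 0.
      by rewrite map_mxB !map_mxM map_scalar_mx s0E -s1E subrr.
    exists (- hcomp (mxhom_direct HtD (@e n.+2) (@e n)) (- m%:Z) s0); split.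
      apply: (dsumN (mxhom_direct HtD _ _)); exact: (hcompP (mxhom_direct HtD _ _)).
    rewrite map_mxN mulNmx opprK.
    have hdd : homD (@e n.+2) (@e n) 0 (dh n.+1 *m dh n).
      rewrite -[0 : int]addr0; apply: (mxhom_mul HtD HmD); exact: dh_hom.
    (* As [w] has degree [m], the correction must have degree [-m]; the degree-zero part of the
       lifted identity provides it, and the multiple of [y] dies in [B1]. *)
    have := congr1 (hcomp (mxhom_direct HtD (@e n.+2) (@e n)) 0) NE.
    rewrite hcompB (hcomp_id _ hdd) -{1 2}[0 : int](addNr m%:Z).
    rewrite (hcomp_mulmx HtD HmD _ _ _ (mxhom_scalar HtD (@e n) whom)).
    rewrite (hcomp_mulmx HtD HmD _ _ _ (mxhom_scalar HtD (@e n) yhom)) => e1.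
    have := congr1 (map_mx q1) e1; rewrite map_mxB !map_mxM !map_scalar_mx.
    by rewrite q1y raddf0 mulmx0 => /eqP; rewrite subr_eq0 => /eqP.
  exists (fun n => projT1 (cid (h n))) => n; by case: cid => s [].
(* Over [De] this need not be a complex; its image under [q1] is the cone of [d1]. *)
pose C := cone_d w theta dh sh.
pose cd := cone_dim b.
pose s1 n := map_mx q1 (sh n).
have CE n : map_mx q1 (C n) = cone_d (q1 w) th d1 s1 n.
  rewrite /C /cone_d map_block_mx map_scalar_mx; congr block_mx.
    by case: n => [|n] //=; rewrite map_mx0.
  case: n => [|n] /=; first by rewrite map_mx0.
  rewrite map_mxN; congr (- _); apply/matrixP => i j; rewrite !mxE.
  by rewrite thq.
have CE' : (fun n => map_mx q1 (C n)) = cone_d (q1 w) th d1 s1.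
  by apply: functional_extensionality_dep.
(* The shift by [m] makes the block [w], whose entries have degree [m], part of a differential of
   degree 0. *)
pose es n : 'I_(shift_dim b n) -> int :=
  match n with 0 => fun=> 0 | n'.+1 => fun i => @e n' i + m%:Z end.
pose ec n (i : 'I_(cd n)) : int :=
  match split i with inl j => @e n j | inr j => es n j end.
have ecl n j : ec n (lshift _ j) = @e n j.
  by rewrite /ec -[lshift _ j]/(unsplit (inl _ j)) unsplitK.
have ecr n j : ec n (rshift _ j) = es n j.
  by rewrite /ec -[rshift _ j]/(unsplit (inr _ j)) unsplitK.
have theta_hom j t : gcomp_enveloping j t -> gcomp_enveloping j (theta t).
  by apply: (gcomp_env_map thE) => i a; [apply: (tau_hom (i := i%:Z))|].
have C_hom n : homD (ec n.+1) (ec n) 0 (C n).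
  move=> i j; rewrite /C /cone_d -[i]splitK -[j]splitK.
  case: (split i) => i'; case: (split j) => j' /=.
  - rewrite block_mxEul ecl ecl; exact: dh_hom.
  - rewrite block_mxEur ecl ecr.
    case: (n) i' j' => [|n'] i' j' //=; first by case: j'.
    have := sh_hom n' i' j'; set u := e _; set v := e _.
    by have -> : u + 0 - (v + m%:Z) = u - m%:Z - v by lia.
  - rewrite block_mxEdl ecr ecl /= mxE.
    case: eqP => [->|_]; last by rewrite mulr0n; apply: gcomp_env0.
    by rewrite mulr1n addr0 addrAC subrr add0r.
  - rewrite block_mxEdr ecr ecr.
    case: (n) i' j' => [|n'] i' j' //=; first by case: j'.
    rewrite !mxE; apply: gcomp_envN; apply: theta_hom.
    have := dh_hom n' i' j'; set u := e _; set v := e _.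
    by have -> : u + m%:Z + 0 - (v + m%:Z) = u + 0 - v by lia.
have piZ (t : De) (x : D) :
    pi (t *: (x : regular_bimodule D) : D) = (q2 (q1 t) *: (pi x : regular_bimodule A) : A).
  elim/env_ind: t => [|u v hu hv|a c].
  - by rewrite !rmorph0 !scale0r rmorph0.
  - by rewrite !rmorphD !scalerDl -hu -hv -rmorphD.
  by rewrite q12 tensor_scale [RHS]tensor_scale !rmorphM.
have yZ (x : D) : (y *: (x : regular_bimodule D) : D) = x * Omega.
  by rewrite tensor_scale mul1r.
have al_lift i : exists x : D, gcomp_int (@e 0%N i) x /\ pi x = al i.
  by have [x] := pi_lift pi_hom pi_surj (mxr_aug_hom res i); exists x.
pose alD (i : 'I_(cd 0)) : regular_bimodule D :=
  match split i with inl j => projT1 (cid (al_lift j)) | inr _ => 0 end.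
have alD_hom i : gcomp_int (ec 0%N i) (alD i : D).
  rewrite /ec /alD; case: (split i) => j; last by case: j.
  by case: cid => x [].
have combD (x : 'rV[De]_(cd 0)) :
    pi (comb alD x : D) = comb al (map_mx q2 (map_mx q1 (lsubmx x))) :> A.
  rewrite /comb big_split_ord /= big_ord0 addr0 raddf_sum; apply: eq_bigr => i _.
  rewrite !mxE; apply: (etrans (piZ _ _)).
  rewrite /alD -[lshift _ i]/(unsplit (inl _ i)) unsplitK.
  by case: cid => z [_ /= ->].
pose rD n := mxhom_direct HtD (fun _ : 'I_1 => 0) (ec n).
have comb_hom j (x : 'rV[De]_(cd 0)) :
    rowhom HD (ec 0%N) j x ->
    gcomp_int j (comb alD x : D).
  move=> hx; apply: (@dsum_sum _ _ _ iD) => i _; rewrite -[j](subrK (ec 0%N i)).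
  by apply: gcomp_int_scale => //; have := hx 0 i; rewrite add0r.
have comb_hcomp j (x : 'rV[De]_(cd 0)) :
    hcomp iD j (comb alD x : D) = comb alD (hcomp (rD 0%N) j x).
  apply: (@hcomp_map _ _ _ _ _ _ (rD 0%N) iD (comb alD) id) => // u v.
  exact: (linearD (comb alD) u v).
(* Modulo [Omega] this is surjectivity of [al]; graded Nakayama for right multiplication by [Omega]
   gives the rest. *)
have surjD (a : D) : exists x, comb alD x = a.
  apply: (@graded_nakayama _ _ iD m%:Z ( *%R^~ Omega) (fun=> True)
    (fun a => exists x, comb alD x = a)) => //.
  - exact: gcomp_int_bounded.
  - by move=> u v; rewrite mulrDl.
  - by move=> j x hx; apply: gcomp_int_mul.
  - by exists 0; rewrite linear0.
  - by move=> _ _ [u <-] [v <-]; exists (u + v); rewrite linearD.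
  - by move=> j _ [u <-]; exists (hcomp (rD 0%N) j u); rewrite -comb_hcomp.
  - by move=> _ [u <-]; exists (y *: u); rewrite linearZ /= yZ.
  - move=> {}a _; have [x xE] := mxr_surj res (pi a).
    have [x1 x1E] := map_mx_lift x q2s; have [x2 x2E] := map_mx_lift x1 q1s.
    pose x3 : 'rV[De]_(cd 0) := row_mx x2 0.
    have /kerP[v vE] : pi (a - (comb alD x3 : D)) = 0.
      apply/eqP; rewrite rmorphB /= subr_eq0; apply/eqP/esym.
      by apply: (etrans (combD _)); rewrite row_mxKl x2E x1E xE.
    by exists (comb alD x3), v; split; [exists x3|rewrite -vE addrC subrK].
have cx0 (x : 'rV[B1]_(cd 0)) :
    comb al (map_mx q2 (lsubmx x)) = 0 <-> exists z, x = z *m map_mx q1 (C 0%N).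
  rewrite CE; apply: (@cone_exact0 _ _ _ th q2 q2s q2k b d1 s1 (fun x => comb al x = 0)) => z.
  by rewrite d1E; apply: (mxr_exact0 res).
have shE' n : d1 n.+1 *m d1 n = - (s1 n *m (q1 w)%:M) by apply: shE.
have cxS n (x : 'rV[B1]_(cd n.+1)) :
    x *m map_mx q1 (C n) = 0 <-> exists z, x = z *m map_mx q1 (C n.+1).
  rewrite !CE; apply: (@cone_exactS _ _ _ th q2) => //.
  by move=> n' z; rewrite !d1E; apply: (mxr_exactS res).
(* [y] acts on [D] as right multiplication by [Omega], which is regular with quotient [A]; so the
   kernel of the augmentation is saturated and reduces onto the kernel for the cone. *)
have hK : lift_kernel HtD y q1 ec C (fun x : 'rV[De]_(cd 0) => comb alD x = 0).
  split.
  - split; [exact: linear0|by move=> u v hu hv; rewrite linearB /= hu hv subrr|].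
    by move=> a u hu; rewrite linearZ /= hu scaler0.
  - by move=> j u hu; rewrite -comb_hcomp hu; apply: (hcomp0 iD).
  - move=> u; rewrite linearZ /= yZ => hu; apply: Omega_regular.2.
    by rewrite /= hu mul0r.
  - move=> u hu; apply/cx0; rewrite -map_lsubmx; apply: (etrans (esym (combD u))).
    by rewrite hu rmorph0.
  - move=> z; have [u uE] := map_mx_lift (z *m map_mx q1 (C 0%N)) q1s.
    have /kerP[v vE] : pi (comb alD u : D) = 0.
      by apply: (etrans (combD u)); rewrite map_lsubmx uE; apply/cx0; exists z.
    have [u' u'E] := surjD v; exists (u - y *: u').
      by rewrite linearB linearZ /= yZ u'E vE subrr.
    by rewrite map_mxB map_mxZ uE q1y scale0r subr0.
have m0 : 0 < m%:Z by lia.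
have [dD [dDhom dDq dD0 dDS]] := @lift_exists De B1 _ HtD HmD (@gcomp_env_lt0 k D)
  y m%:Z m0 yhom ynorm yreg q1 q1s q1k cd ec C C_hom cxS _ hK.
have ddD := exact_complex dDS.
have lift_ex := lift_dual_exact HtD HmD (@gcomp_env_lt0 k D) m0 yhom yreg q1s q1k dDhom dDq ddD.
have d1E' : (fun n => map_mx q2 (d1 n)) = d by apply: functional_extensionality_dep.
have psi_cobd n (h : 'cV[B1]_(cd n.+1)) : map_mx q1 (C n.+1) *m h = 0 ->
    (cobd (fun n => map_mx q1 (C n)) h <-> cobd d (cone_psi th' q2 h)).
  rewrite CE CE' -d1E'; exact: cone_psi_cobd.
have psi_cocycle n (h : 'cV[B1]_(cd n.+1)) : map_mx q1 (C n.+1) *m h = 0 ->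
    d n *m cone_psi th' q2 h = 0.
  by rewrite CE -d1E; apply: cone_psi_cocycle.
(* Degree [i.+1] of the dual cone has the cohomology of degree [i] for [d], and degree 0 vanishes by
   regularity of [w]. *)
have dual_exact i : i != dim.+1 -> forall z : 'cV[B1]_(cd i),
    map_mx q1 (C i) *m z = 0 -> cobd (fun n => map_mx q1 (C n)) z.
  case: i => [_|i idim] z hz; first by move: hz; rewrite CE; apply: cone_cocycle0.
  by apply/psi_cobd => //; apply: (mxe_vanish ext) => //; apply: psi_cocycle.
have [nuA' [nuAK nuA'K]] := inverse_lrmorphism nuA_aut.1.
pose kap : {lrmorphism A -> A} := tauA \o nuA.
pose kap' : {lrmorphism A -> A} := nuA' \o tauA'.
(* [cone_psi] undoes [th], so [a (x) c] acts through [tau' a]. Composing with [tauA] restores [a]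
   and turns the twist [nuA] into [tauA \o nuA]. *)
pose Phi1 (z : 'cV[De]_(cd dim.+1)) := tauA (Phi (cone_psi th' q2 (map_mx q1 z))).
have tauA_hom i a : gcomp_int i a -> gcomp_int i (tauA a).
  move=> ha; have [x hx <-] := pi_lift pi_hom pi_surj ha.
  rewrite tauAE -(hcomp_id iD (tau_hom hx)) -(pi_hcomp pi_hom); exact: (hcompP iA).
have q1Z n (z : 'cV[De]_(cd n)) : dD n *m z = 0 -> map_mx q1 (C n) *m map_mx q1 z = 0.
  by move=> hz; rewrite -dDq -map_mxM hz map_mx0.
have psiD n (h h' : 'cV[B1]_(cd n.+1)) :
    cone_psi th' q2 (h + h') = cone_psi th' q2 h + cone_psi th' q2 h'.
  by rewrite /cone_psi raddfD !map_mxD.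
have psiM n (h : 'cV[B1]_(cd n.+1)) r :
    cone_psi th' q2 (h *m r%:M) = cone_psi th' q2 h *m (q2 (th' r))%:M.
  by rewrite /cone_psi -mul_dsub_mx !map_mxM !map_scalar_mx.
have [|||||||||||||||||||nu [PhiD [nug nuE nuO [P1 P2 P3 P4 P5]]]] :=
  (@rank_one k D A Omega m m_gt0 Omega_hom Omega_normal Omega_regular pi pi_hom pi_surj
    pi_ker D_gen m_ge2 (cd dim.+1) (ec dim.+1) (fun z => dD dim.+1 *m z = 0)
    (fun z => cobd dD z) Phi1 kap kap' (l + m%:Z)).
- by move=> a; rewrite /= tauAK nuAK.
- by move=> i a ha; apply: (tauA_hom i%:Z); apply: nuA_aut.2.
- by move=> a; rewrite /= nuA'K tauA'K.
- by move=> x z hx hz; rewrite mulmxBr hx hz subrr.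
- by move=> x r hx; rewrite mulmxA hx mul0mx.
- move=> j x; exact: (cocycle_hcomp HtD HmD dDhom).
- move=> x; exact: (cocycleZ yreg).
- exact: cobd0.
- move=> x z hx hz; apply: cobdD => //.
  by have := cobdZ (-1) hz; rewrite raddfN /= mulmxN mulmx1.
- by move=> x r; apply: cobdZ.
- by move=> j x; apply: (cobd_hcomp HtD HmD dDhom).
- by move=> x; apply: cobd_cocycle.
- move=> x z hx hz; rewrite /Phi1 map_mxD psiD (mxe_add ext) ?rmorphD //.
    by apply: psi_cocycle; apply: q1Z.
  by apply: psi_cocycle; apply: q1Z.
- move=> x hx a c; rewrite /Phi1 map_mxM map_scalar_mx psiM th'q th'E q12 /=.
  rewrite (mxe_mul ext); last by apply: psi_cocycle; apply: q1Z.
  by rewrite !rmorphM -tauA'E; congr (_ * _); apply: tauA'K.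
- move=> x hx /eqP; rewrite /Phi1 -(rmorph0 tauA) (inj_eq (can_inj tauAK)) => /eqP.
  have hx1 := q1Z _ _ hx; rewrite (mxe_ker ext) ?psi_cocycle // => /(psi_cobd _ _ hx1).
  by move=> h; apply: (lift_dual_quotient yreg q1s q1k dDq ddD h hx).
- move=> x hx; have hx0 : dD dim.+1 *m x = 0 by apply: cobd_cocycle.
  rewrite /Phi1 (_ : Phi _ = 0) ?rmorph0 //; apply/(mxe_ker ext).
    by apply: psi_cocycle; apply: q1Z.
  apply/psi_cobd; first exact: q1Z.
  by case: hx => g ->; exists (map_mx q1 g); rewrite map_mxM dDq.
- have [f hf fE] := mxe_surj ext 1.
  have [|h hh hE] := @cone_psi_surj _ _ (q1 w) th th' q2 thK th'K thw wreg q2s q2k b d1 s1 shE' dim f.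
    by rewrite d1E.
  have [||h1 hh1 h1E] := @lift_dual_surj De B1 y yreg q1 q1s q1k cd C dD dDq ddD dim.+1 h.
  + apply: (lift_ex).
    by apply: dual_exact; rewrite eqSS neq_ltn ltnSn orbT.
  + by rewrite CE.
  by exists h1 => //; rewrite /Phi1 h1E hE fE rmorph1.
(* The generators of the lower block sit [m] degrees higher, whence the shift [l + m]. *)
- move=> x j hx hxj; apply: tauA_hom; rewrite -addrA; apply: (mxe_hom ext).
    by apply: psi_cocycle; apply: q1Z.
  move=> i i'; rewrite !mxE th'q subr0.
  have := hxj (rshift _ i) i'; rewrite subr0 ecr /= -addrA.
  rewrite (_ : q2 _ = (q2 \o (q1 \o theta') : {rmorphism De -> Ae}) (x (rshift (b dim.+1) i) i')) //.
  apply: (@gcomp_env_map _ _ _ (pi \o tau') pi) => [a c|r a ha|r a].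
  + by rewrite /= th'E q12.
  + by apply: pi_hom; apply: (tau'_hom (i := r%:Z)).
  + exact: pi_hom.
- move=> x hx; apply: (lift_dual_regular yreg q1s q1k dDq ddD).
  by apply: dual_exact; rewrite neq_ltn ltnSn.
exists nu; split=> //.
apply: (@mx_nakayama k D dim.+1 nu cd ec dD alD (l + m%:Z) PhiD nug).
  (* The shifted copy makes the cone one step longer. *)
  split=> //; have [N hN] := mxr_fin res; exists N.+1 => n hn.
  case: n hn => [//|n] hn; rewrite /cd /cone_dim /shift_dim hN ?hN //.
  exact: (ltn_trans (ltnSn N)).
split=> //.
move=> i idim f hf; apply: (lift_ex) => //.
exact: dual_exact.
Qed.

End Data.
End Construction.

(** * Comparison of resolutions *)

Section Image.
Variables (R : nzRingType) (X Y : lmodType R) (g : {linear X -> Y}).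
Definition image_pred : {pred Y} := fun y => `[< exists x, g x = y >].
Fact image_submod_closed : submod_closed image_pred.
Proof.
split=> [|a u v /asboolP[x <-] /asboolP[z <-]]; apply/asboolP.
  by exists 0; rewrite linear0.
by exists (a *: x + z); rewrite linearP.
Qed.
HB.instance Definition _ := GRing.isSubmodClosed.Build R Y image_pred image_submod_closed.
Definition image_module : Type := {y : Y | y \in image_pred}.
HB.instance Definition _ := SubChoice.on image_module.
HB.instance Definition _ := [SubChoice_isSubLmodule of image_module by <:].

(** [projective] speaks of surjections, so [g] is first corestricted to its image. *)
Lemma projective_lift (P : lmodType R) (f : {linear P -> Y}) : projective P ->
  (forall p, exists x, g x = f p) -> exists h : {linear P -> X}, forall p, g (h p) = f p.
Proof.
move=> hP hf.
have gI x : g x \in image_pred by apply/asboolP; exists x.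
have fI p : f p \in image_pred by apply/asboolP.
pose g0 x : image_module := exist _ (g x) (gI x).
pose f0 p : image_module := exist _ (f p) (fI p).
have g0L : linear g0 by move=> a x z; apply: val_inj; rewrite linearP /= linearP.
have f0L : linear f0 by move=> a x z; apply: val_inj; rewrite linearP /= linearP.
have [g' g'E] := make_linear g0L; have [f' f'E] := make_linear f0L.
have [|h hE] := hP _ _ g' f'.
  by move=> [y yI]; have /asboolP[x xE] := yI; exists x; rewrite g'E; apply: val_inj.
by exists h => p; have /(congr1 val) := hE p; rewrite g'E f'E.
Qed.

End Image.

(** The target of comparison maps: a resolution with its scalars restricted is directly of this
    form. *)
Record exact_sequence (R : nzRingType) (N : lmodType R) := ExactSequence {
  es_mod :> nat -> lmodType R;
  es_diff : forall n, {linear es_mod n.+1 -> es_mod n};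
  es_aug : {linear es_mod 0%N -> N};
  es_surj : forall m, exists x, es_aug x = m;
  es_exact0 : forall x, es_aug x = 0 <-> exists y, es_diff 0%N y = x;
  es_exactS : forall n x, es_diff n x = 0 <-> exists y, es_diff n.+1 y = x }.
Arguments es_diff {R N} _ n.
Arguments es_aug {R N} _.

Definition resolution_exact (R : nzRingType) (M : lmodType R) (P : resolution M) :=
  ExactSequence (@res_aug_surj _ _ P) (@res_exact0 _ _ P) (@res_exactS _ _ P).

Lemma res_diffK (R : nzRingType) (N : lmodType R) (Q : resolution N) n x :
  res_diff Q n (res_diff Q n.+1 x) = 0.
Proof. by apply/res_exactS; exists x. Qed.
Lemma res_augK (R : nzRingType) (N : lmodType R) (Q : resolution N) x :
  res_aug Q (res_diff Q 0 x) = 0.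
Proof. by apply/res_exact0; exists x. Qed.

Section Comparison.
Variables (R : nzRingType) (M N : lmodType R) (P : resolution M) (Q : exact_sequence N).

Lemma comparison (f : {linear M -> N}) : exists phi : forall n, {linear P n -> Q n},
  (forall x, es_aug Q (phi 0%N x) = f (res_aug P x)) /\
  (forall n x, phi n (res_diff P n x) = es_diff Q n (phi n.+1 x)).
Proof.
(* Each map is kept together with the solvability of the next lifting problem. *)
pose T n := {phi : {linear P n -> Q n} |
  forall x, exists z, es_diff Q n z = phi (res_diff P n x)}.
have step n (t : T n) : exists t' : T n.+1,
    forall x, es_diff Q n (projT1 t' x) = projT1 t (res_diff P n x).
  case: t => phi hphi /=.
  have [h hE] := @projective_lift _ _ _ (es_diff Q n) (P n.+1) (phi \o res_diff P n)
    (@res_projective _ _ P n.+1) hphi.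
  have hh x : exists z, es_diff Q n.+1 z = h (res_diff P n.+1 x).
    by apply/es_exactS; rewrite hE /= res_diffK linear0.
  by exists (exist _ h hh).
have [phi0 phi0E] := projective_lift (f := f \o res_aug P) (@res_projective _ _ P 0%N)
  (fun x => @es_surj _ _ Q (f (res_aug P x))).
have h0 x : exists z, es_diff Q 0 z = phi0 (res_diff P 0 x).
  by apply/es_exact0; rewrite phi0E /= res_augK linear0.
pose ts := fix ts n : T n :=
  if n is n'.+1 then projT1 (cid (step n' (ts n'))) else exist _ phi0 h0.
exists (fun n => projT1 (ts n)); split=> [x|n x] /=; first exact: phi0E.
by case: (cid (step n (ts n))) => t' /= ->.
Qed.

Lemma homotopy (phi : forall n, {linear P n -> Q n}) :
  (forall x, es_aug Q (phi 0%N x) = 0) ->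
  (forall n x, phi n (res_diff P n x) = es_diff Q n (phi n.+1 x)) ->
  exists h : forall n, {linear P n -> Q n.+1},
    (forall x, phi 0%N x = es_diff Q 0 (h 0%N x)) /\
    (forall n x, phi n.+1 x = es_diff Q n.+1 (h n.+1 x) + h n (res_diff P n x)).
Proof.
move=> phi0 phiS.
(* The invariant puts [phi n.+1 - h d] in the kernel of the differential, hence in the image of the
   next one. *)
pose T n := {h : {linear P n -> Q n.+1} |
  forall x, es_diff Q n (h (res_diff P n x)) = phi n (res_diff P n x)}.
have step n (t : T n) : exists t' : T n.+1,
    forall x, phi n.+1 x = es_diff Q n.+1 (projT1 t' x) + projT1 t (res_diff P n x).
  case: t => h hh /=.
  have fD : linear (fun x => phi n.+1 x - h (res_diff P n x)).
    by move=> a x z /=; rewrite !linearD !linearZ /= scalerDr addrACA.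
  have [f fE] := make_linear fD.
  have [|h' h'E] := @projective_lift _ _ _ (es_diff Q n.+1) (P n.+1) f (@res_projective _ _ P n.+1).
    by move=> x; apply/es_exactS; rewrite fE linearB /= hh phiS subrr.
  have hh' x : es_diff Q n.+1 (h' (res_diff P n.+1 x)) = phi n.+1 (res_diff P n.+1 x).
    by rewrite h'E fE res_diffK linear0 subr0.
  by exists (exist _ h' hh') => x; rewrite /= h'E fE subrK.
have [|h0 h0E] := @projective_lift _ _ _ (es_diff Q 0) (P 0%N) (phi 0%N) (@res_projective _ _ P 0%N).
  by move=> x; apply/es_exact0.
have hh0 x : es_diff Q 0 (h0 (res_diff P 0 x)) = phi 0%N (res_diff P 0 x) by rewrite h0E.
pose ts := fix ts n : T n :=
  if n is n'.+1 then projT1 (cid (step n' (ts n'))) else exist _ h0 hh0.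
exists (fun n => projT1 (ts n)); split=> [x|n x] /=; first by rewrite h0E.
by case: (cid (step n (ts n))) => t' /= ->.
Qed.

End Comparison.

Section Cochains.
Variables (R : nzRingType) (M N : lmodType R) (P : resolution M).

Lemma coboundary_ext n (f g : P n -> N) : f =1 g -> coboundary f -> coboundary g.
Proof. by move=> fg; rewrite (_ : f = g) //; apply: funext. Qed.

Lemma coboundaryD n (f g : P n -> N) :
  coboundary f -> coboundary g -> coboundary (fun x => f x + g x).
Proof.
case: n f g => [|n] f g /=; first by move=> hf hg x; rewrite hf hg addr0.
by move=> [f' f'E] [g' g'E]; exists (f' \+ g') => x /=; rewrite f'E g'E.
Qed.

Lemma coboundaryN n (f : P n -> N) : coboundary f -> coboundary (fun x => - f x).
Proof.
case: n f => [|n] f /=; first by move=> hf x; rewrite hf oppr0.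
by move=> [f' f'E]; exists (\- f') => x /=; rewrite f'E.
Qed.

End Cochains.

Lemma homotopy_coboundary (R : nzRingType) (M N L : lmodType R) (P : resolution M)
    (Q : exact_sequence N) (psi : forall n, {linear P n -> Q n}) n (F : Q n -> L) :
  (forall x, es_aug Q (psi 0%N x) = 0) ->
  (forall n x, psi n (res_diff P n x) = es_diff Q n (psi n.+1 x)) ->
  linear F -> (forall x, F (es_diff Q n x) = 0) ->
  coboundary (fun x : P n => F (psi n x)).
Proof.
move=> psi0 psiS FL FD; have [h [h0 hS]] := homotopy psi0 psiS.
have [F' F'E] := make_linear FL.
case: n F F' FL FD F'E => [|n] F F' FL FD F'E /=.
  by move=> x; rewrite h0 FD.
exists (F' \o h n) => x /=; rewrite hS -F'E linearD [X in X + _]F'E FD add0r.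
by [].
Qed.

Section ChainMaps.
Variables (R : nzRingType) (M M' N : lmodType R) (P : resolution M) (P' : resolution M')
  (v : forall n, {linear P' n -> P n}).
Hypothesis vS : forall n x, v n (res_diff P' n x) = res_diff P n (v n.+1 x).

Lemma coboundary_comp n (f : P n -> N) : coboundary f -> coboundary (f \o v n).
Proof.
case: n f => [|n] f /=; first by move=> f0 x /=.
by move=> [g gE]; exists (g \o v n) => x /=; rewrite gE vS.
Qed.

Lemma cocycle_comp n (f : P n -> N) : cocycle f -> cocycle (f \o v n).
Proof.
move=> [fL fd]; split=> [a x y|x] /=; first by rewrite linearP fL.
by rewrite vS fd.
Qed.

End ChainMaps.

Lemma comparison_res (R : nzRingType) (M : lmodType R) (P Q : resolution M) :
  exists phi : forall n, {linear P n -> Q n},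
  (forall x, res_aug Q (phi 0%N x) = res_aug P x) /\
  (forall n x, phi n (res_diff P n x) = res_diff Q n (phi n.+1 x)).
Proof. exact: (comparison P (resolution_exact Q) idfun). Qed.

Lemma self_map_coboundary (R : nzRingType) (M N : lmodType R) (P : resolution M)
    (phi : forall n, {linear P n -> P n}) n (f : P n -> N) :
  (forall x, res_aug P (phi 0%N x) = res_aug P x) ->
  (forall n x, phi n (res_diff P n x) = res_diff P n (phi n.+1 x)) ->
  cocycle f -> coboundary (fun x => f (phi n x) - f x).
Proof.
move=> phi0 phiS [fL fd].
pose psi n : {linear P n -> P n} := phi n \- (idfun : {linear P n -> P n}).
apply: (@coboundary_ext _ _ _ _ _ (fun x => f (psi n x))).
  move=> x; have [f' f'E] := make_linear fL.
  by rewrite -!f'E -linearB.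
apply: (@homotopy_coboundary _ _ _ _ P (resolution_exact P) psi) => //.
- by move=> x; rewrite /= linearB /= phi0 subrr.
- by move=> i x; rewrite /= linearB /= phiS.
Qed.

Lemma augmentation_comp (k : fieldType) (A : gralg k) (x : A) :
  hcomp (gcomp_int_direct A) 0 x = (augmentation x)%:A.
Proof.
rewrite (hcomp_int 0).
have /gcomp_connected[c cE] := hcompP (gcomp_direct A) 0%N x.
rewrite cE; congr (_%:A); apply/esym/augmentation_uniq; rewrite -cE.
have [s [us s0 sE]] := hcomp_sum (gcomp_direct A) x.
have -> : x - hcomp (gcomp_direct A) 0%N x =
    \sum_(i <- s | i != 0%N) hcomp (gcomp_direct A) i x.
  rewrite {1}sE; have [is_|is_] := boolP (0%N \in s).
    by rewrite (bigD1_seq 0%N) //= addrAC subrr add0r.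
  rewrite (s0 _ is_) subr0 [RHS]big_mkcond /=; apply: eq_big_seq => i i_s.
  by case: eqP is_ => // <-; rewrite i_s.
rewrite -big_filter; apply: positive_sum => i; rewrite mem_filter => /andP[i0 _].
by apply: (@positive_hom _ _ i); [rewrite lt0n|apply: hcompP].
Qed.

(** * Uniqueness of the dimension and of the Nakayama automorphism *)

Section Uniqueness.
Variables (k : fieldType) (A : gralg k).
Local Notation Ae := (enveloping A).

Lemma cocycleB (P : resolution (regular_bimodule A)) n (f g : P n -> Ae^o) :
  cocycle f -> cocycle g -> cocycle (fun x => f x - g x).
Proof.
move=> [fL fd] [gL gd]; split=> [a x y|x]; last by rewrite fd gd subrr.
by rewrite fL gL opprD addrACA -scalerBr.
Qed.

Lemma cocycle_mul (P : resolution (regular_bimodule A)) n (f : P n -> Ae^o) (t : Ae) :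
  cocycle f -> cocycle (fun x => (f x : Ae) * t : Ae^o).
Proof.
move=> [fL fd]; split=> [a x y|x]; last by rewrite fd mul0r.
by rewrite fL mulrDl; congr (_ + _); apply: (esym (mulrA _ _ _)).
Qed.

(** Comparison maps in both directions identify the two Ext groups. The image [s] of the generator
    intertwines [nu] and [nu'], and its constant term is nonzero. *)
Lemma nakayama_unique d d' (nu nu' : {lrmorphism A -> A}) :
  nakayama d nu -> nakayama d' nu' -> d = d' /\ nu =1 nu'.
Proof.
move=> [nug [P [G [_ _ _ van [l [Phi [PhiD PhiM PhiS PhiK _]]]]]]].
move=> [nug' [P' [G' [_ _ _ van' [l' [Phi' [PhiD' PhiM' PhiS' PhiK' _]]]]]]].
have [u [u0 uS]] := comparison_res P P'.
have [v [v0 vS]] := comparison_res P' P.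
pose vu n : {linear P n -> P n} := v n \o u n.
pose uv n : {linear P' n -> P' n} := u n \o v n.
have vuE n (f : P n -> Ae^o) : cocycle f -> coboundary (fun x => f (vu n x) - f x).
  by apply: self_map_coboundary => [x|i x] /=; rewrite ?v0 ?u0 // uS vS.
have uvE n (f : P' n -> Ae^o) : cocycle f -> coboundary (fun x => f (uv n x) - f x).
  by apply: self_map_coboundary => [x|i x] /=; rewrite ?u0 ?v0 // vS uS.
have PhiN (Q : resolution (regular_bimodule A)) n (F : (Q n -> Ae^o) -> A) f g :
  (forall f g : Q n -> Ae^o, cocycle f -> cocycle g -> F (fun x => f x + g x) = F f + F g) ->
  (forall f, cocycle f -> (F f = 0 <-> coboundary f)) ->
  cocycle f -> cocycle g -> (F f = F g <-> coboundary (fun x => f x - g x)).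
  move=> FD FK hf hg; have hfg := cocycleB hf hg.
  rewrite -FK //; have -> : F f = F (fun x => f x - g x) + F g.
    by rewrite -FD //; congr F; apply: funext => x; rewrite subrK.
  split=> [/(canRL (addrK _))->|->]; first by rewrite subrr.
  by rewrite add0r.
have [f1 hf1 f1E] := PhiS 1.
(* If the degrees differed, pulling [f1] back to [P'] and then to [P] would make it a coboundary,
   although its class is 1. *)
have dd : d = d'.
  apply: contrapT => /eqP dd'.
  have h := van' d dd' _ (cocycle_comp vS hf1).
  have h1 := coboundary_comp uS h.
  have : coboundary f1.
    apply: coboundary_ext (coboundaryD h1 (coboundaryN (vuE _ _ hf1))) => x /=.
    by rewrite opprB addrC subrK.
  by move=> /(PhiK _ hf1)/eqP; rewrite f1E oner_eq0.
split=> //; subst d'.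
have transfer f g : cocycle f -> cocycle g -> Phi f = Phi g -> Phi' (f \o v d) = Phi' (g \o v d).
  move=> hf hg /(PhiN _ _ _ _ _ PhiD PhiK hf hg) h.
  apply/(PhiN _ _ _ _ _ PhiD' PhiK'); [exact: cocycle_comp|exact: cocycle_comp|].
  exact: (coboundary_comp vS h).
pose s := Phi' (f1 \o v d).
have hf1v : cocycle (f1 \o v d) by apply: cocycle_comp.
(* [f1 (1 (x) b)] and [f1 (nu b (x) 1)] have the same class for [Phi], hence after transport also
   for [Phi']. *)
have twist b : nu' b * s = s * nu b.
  have := transfer _ _ (cocycle_mul (tensor 1 b) hf1) (cocycle_mul (tensor (nu b) 1) hf1).
  rewrite !PhiM // f1E !rmorph1 !mulr1 !mul1r => /(_ erefl).
  have := PhiM' _ hf1v 1 b; rewrite mulr1 /= => <- e.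
  have := PhiM' _ hf1v (nu b) 1; rewrite rmorph1 mul1r /= => <-; exact: e.
(* The generator [g] of the second group, pulled back to [P], has the class of [f1 (c (x) 1)] for
   some [c]; transporting this back gives [s * c = 1]. *)
have sc : exists c, s * c = 1.
  have [g hg gE] := PhiS' 1; have hgu : cocycle (g \o u d) by apply: cocycle_comp.
  exists (Phi (g \o u d)); have := PhiM' _ hf1v (Phi (g \o u d)) 1.
  rewrite rmorph1 mul1r /= => <-.
  have e : Phi (fun x => (f1 x : Ae) * tensor (Phi (g \o u d)) 1) = Phi (g \o u d).
    by rewrite PhiM // f1E rmorph1 !mul1r.
  rewrite -[LHS]/(Phi' ((fun x => (f1 x : Ae) * tensor (Phi (g \o u d)) 1 : Ae^o) \o v d)).
  rewrite (transfer _ _ _ hgu e); last exact: cocycle_mul.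
  rewrite -gE; apply/(PhiN _ _ _ _ _ PhiD' PhiK') => //; last exact: uvE.
  exact: cocycle_comp.
have s0 : augmentation s != 0.
  have [c /(congr1 (@augmentation k A))] := sc; rewrite augmentationM augmentation1 => e.
  by apply/eqP => s0; move/eqP: e; rewrite s0 mul0r eq_sym oner_eq0.
pose hA := gcomp_int_direct A.
apply: (dsum_ind (gcomp_direct A)) => [|x y|i x hx]; first by rewrite !rmorph0.
  by move=> hx hy; rewrite !rmorphD; congr (_ + _); [apply: hx|apply: hy].
(* Taking components of degree [i] replaces [s] by its constant term, a nonzero scalar that
   cancels. *)
have := congr1 (hcomp hA (i%:Z + 0)) (twist x).
rewrite hcomp_mull; last exact: (nug'.2 _ _ hx).
rewrite addrC hcomp_mulr; last exact: (nug.2 _ _ hx).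
by rewrite /hA augmentation_comp mulr_algl mulr_algr => /(scalerI s0) ->.
Qed.

End Uniqueness.

(** * Restriction of scalars *)

Definition restr (R S : nzRingType) (s : {rmorphism R -> S}) (M : lmodType S) : Type := M.

Section Restriction.
Variables (R S : nzRingType) (s : {rmorphism R -> S}).

Section Module.
Variable M : lmodType S.
Local Notation rM := (restr s M).
HB.instance Definition _ := GRing.Zmodule.on rM.
Definition restr_scale (a : R) (x : rM) : rM := s a *: (x : M).
Fact restr_scaleA a b x : restr_scale a (restr_scale b x) = restr_scale (a * b) x.
Proof. by rewrite /restr_scale scalerA rmorphM. Qed.
Fact restr_scale1 : left_id 1 restr_scale.
Proof. by move=> x; rewrite /restr_scale rmorph1 scale1r. Qed.
Fact restr_scaleDr : right_distributive restr_scale +%R.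
Proof. by move=> a x y; apply: scalerDr. Qed.
Fact restr_scaleDl x : {morph restr_scale^~ x : a b / a + b}.
Proof. by move=> a b; rewrite /restr_scale rmorphD scalerDl. Qed.
HB.instance Definition _ := GRing.Zmodule_isLmodule.Build R rM
  restr_scaleA restr_scale1 restr_scaleDr restr_scaleDl.
End Module.

Section Map.
Variables (M N : lmodType S) (f : {linear M -> N}).
Definition restr_fun (x : restr s M) : restr s N := f x.
Fact restr_fun_linear : linear restr_fun.
Proof. by move=> a x y; apply: linearP. Qed.
HB.instance Definition _ :=
  GRing.isLinear.Build R (restr s M) (restr s N) *:%R restr_fun restr_fun_linear.
End Map.

Definition restr_sequence (M : lmodType S) (P : resolution M) :
    exact_sequence (restr s M) :=
  @ExactSequence R (restr s M) (fun n => restr s (P n)) (fun n => restr_fun (res_diff P n))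
    (restr_fun (res_aug P)) (@res_aug_surj _ _ P) (@res_exact0 _ _ P) (@res_exactS _ _ P).

End Restriction.

Lemma graded_augmentation (k : fieldType) (A B : gralg k) (s : {lrmorphism A -> B}) :
  (forall n a, gcomp A n a -> gcomp B n (s a)) ->
  forall a, augmentation (s a) = augmentation a.
Proof.
move=> sg a; apply/eqP; rewrite -subr_eq0.
suff : (augmentation (s a) - augmentation a) *: (1 : B) == 0.
  by rewrite scaler_eq0 oner_eq0 orbF.
have := hcomp_graded sg 0 a.
by rewrite !augmentation_comp linearZ /= rmorph1 scalerBl subr_eq0 => ->.
Qed.

(** * Independence of the determinant scalar from the resolution and the lift *)

Section Independence.
Variables (k : fieldType) (A : gralg k) (sigma sigma' : {lrmorphism A -> A}).
Hypotheses (sK : cancel sigma sigma') (s'K : cancel sigma' sigma)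
  (aug_s' : forall a, augmentation (sigma' a) = augmentation a).
Local Notation triv := (trivial_module A).

Definition twisted_lift (P : resolution triv) (phi : forall n, P n -> P n) : Prop :=
  [/\ forall n x y, phi n (x + y) = phi n x + phi n y,
      forall n (a : A) x, phi n (sigma a *: x) = a *: phi n x,
      forall n x, phi n (res_diff P n x) = res_diff P n (phi n.+1 x)
    & forall x, res_aug P (phi 0%N x) = res_aug P x].

Definition twisted_scalar (P : resolution triv) (phi : forall n, P n -> P n) d (c : k) : Prop :=
  forall f : P d -> A^o, cocycle f ->
    coboundary (fun x => (sigma (f (phi d x)) - c *: (f x : A) : A) : A^o).

(** A semilinear lift is a linear map into the resolution with scalars restricted along [sigma'].
    The identity of [k] is linear for that structure, as [sigma'] preserves the augmentation. *)
Lemma twisted_lift_ex (P : resolution triv) : exists phi, @twisted_lift P phi.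
Proof.
have idL : linear (idfun : triv -> restr sigma' triv).
  move=> a x y; congr (_ + _); rewrite -[LHS]/(trivial_scale a x).
  by rewrite -[RHS]/(trivial_scale (sigma' a) x) /trivial_scale aug_s'.
have [f fE] := make_linear idL.
have [phi [phi0 phiS]] := comparison P (restr_sequence sigma' P) f.
exists (fun n => phi n); split.
- by move=> n x y; apply: (linearD (phi n)).
- by move=> n a x; apply: (etrans (linearZ_LR (phi n) (sigma a) x)); apply: (etrans (_ : _ = sigma' (sigma a) *: (phi n x : P n))) => //; rewrite sK.
- by move=> n x; apply: phiS.
- by move=> x; apply: (etrans (phi0 x)); rewrite fE.
Qed.

Lemma twisted_liftP (P : resolution triv) phi n a (x y : P n) : twisted_lift phi ->
  phi n (a *: x + y) = sigma' a *: phi n x + phi n y.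
Proof. by move=> [h1 h2 _ _]; rewrite h1 -{1}[a]s'K h2. Qed.

Lemma coboundaryZ (P : resolution triv) n (f : P n -> A^o) (c : k) :
  coboundary f -> coboundary (fun x => (c *: (f x : A) : A) : A^o).
Proof.
case: n f => [|n] f /=; first by move=> f0 x; rewrite f0 scaler0.
move=> [g gE]; have [|g' g'E] := @make_linear A (P n) A^o (fun x => (c *: (g x : A) : A)).
  by move=> a x y; rewrite linearP scalerDr; congr (_ + _); apply: (scalerAr c a (g x : A)).
by exists g' => x; rewrite g'E gE.
Qed.

(** [u phi v] and [phi'] are semilinear lifts of the same map, so their difference is
    null-homotopic; and [sigma f] is linear on the restricted module, so the difference contributes
    a coboundary. *)
Lemma twisted_scalar_transfer (P P' : resolution triv) phi phi' d c :
  @twisted_lift P phi -> @twisted_lift P' phi' ->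
  twisted_scalar phi d c -> twisted_scalar phi' d c.
Proof.
move=> hphi hphi' hc f hf.
have [u [u0 uS]] := comparison_res P P'.
have [v [v0 vS]] := comparison_res P' P.
have h1 := coboundary_comp vS (hc _ (cocycle_comp uS hf)).
have h2 : coboundary (fun x => f (u d (v d x)) - f x).
  by apply: (self_map_coboundary (phi := fun n => u n \o v n)) => //= [x|n x];
    rewrite ?u0 ?v0 // vS uS.
have psiL n : linear ((fun x => u n (phi n (v n x)) - phi' n x) : P' n -> restr sigma' (P' n)).
  move=> a x y; apply: (etrans (_ : _ = sigma' a *: (u n (phi n (v n x)) - phi' n x : P' n) +
    (u n (phi n (v n y)) - phi' n y))) => //.
  rewrite linearP (twisted_liftP _ _ _ hphi) (twisted_liftP _ _ _ hphi') linearP.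
  by rewrite opprD addrACA -scalerBr.
pose psi n := projT1 (cid (make_linear (@psiL n))).
have psiE n x : psi n x = u n (phi n (v n x)) - phi' n x.
  by rewrite /psi; case: cid => g ->.
have h3 : coboundary (fun x => (sigma (f (psi d x)) : A^o)).
  apply: (@homotopy_coboundary _ _ _ _ P' (restr_sequence sigma' P') psi d
    (fun x => (sigma (f x) : A^o))).
  - move=> x; rewrite psiE; apply: (etrans (linearB (res_aug P') _ _)).
    have [_ _ _ a1] := hphi; have [_ _ _ a2] := hphi'.
    by rewrite u0 a1 v0 a2 subrr.
  - move=> n x; rewrite !psiE; apply: (esym (etrans (linearB (res_diff P' n) _ _) _)).
    have [_ _ a1 _] := hphi; have [_ _ a2 _] := hphi'.
    by rewrite -uS -a1 -vS -a2.
  - move=> a x y; rewrite -[a *: x]/(sigma' a *: (x : P' d)) hf.1.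
    rewrite rmorphD; congr (_ + _).
    apply: (etrans (rmorphM sigma (sigma' a) (f x : A))).
    exact: (congr1 (fun z => z * sigma (f x)) (s'K a)).
  - by move=> x; rewrite -[es_diff _ _ _]/(res_diff P' d x) hf.2 rmorph0.
have := coboundaryD (coboundaryD h1 (coboundaryN h3)) (coboundaryZ c h2).
apply: coboundary_ext => x /=; rewrite psiE.
have [f' f'E] := make_linear hf.1.
rewrite -!f'E linearB rmorphB scalerBr opprB.
set a := sigma _; set b := c *: _; set a' := sigma _; set b' := c *: _.
by rewrite [a - b + _]addrC -!addrA !addKr.
Qed.

(** The existential in [hdet_scalar] can thus be tested on any one resolution and lift. *)
Lemma hdet_scalarP (P : resolution triv) phi d c : @twisted_lift P phi ->
  (hdet_scalar d sigma c <-> twisted_scalar phi d c).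
Proof.
move=> hphi; split=> [[P' [phi' [h1 h2 h3 h4 h5]]]|h].
  exact: (@twisted_scalar_transfer P' P phi' phi).
by have [h1 h2 h3 h4] := hphi; exists P, phi.
Qed.

End Independence.

(** * Reduction to resolutions of the trivial module *)

Lemma augmentation_scalar (k : fieldType) (A : gralg k) (c : k) :
  augmentation (c%:A : A) = c.
Proof. by apply: augmentation_uniq; rewrite subrr; apply: positive0. Qed.

Lemma augmentationZ (k : fieldType) (A : gralg k) (c : k) (a : A) :
  augmentation (c *: a) = c * augmentation a.
Proof. by rewrite -mulr_algl augmentationM augmentation_scalar. Qed.

Lemma augmentation0 (k : fieldType) (A : gralg k) : augmentation (0 : A) = 0.
Proof. by rewrite -[X in augmentation X](scale0r 1) augmentation_scalar. Qed.

Lemma morph_sum2 (U V : zmodType) (I J : finType) (h : U -> V) (X : I -> J -> U) :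
  {morph h : x y / x + y} -> h (\sum_i \sum_j X i j) = \sum_i \sum_j h (X i j).
Proof.
move=> hD; have h0 : h 0 = 0 by apply: (addrI (h 0)); rewrite -hD !addr0.
by rewrite (big_morph h hD h0); apply: eq_bigr => i _; rewrite (big_morph h hD h0).
Qed.

Section Reduction.
Variables (k : fieldType) (A : gralg k).
Local Notation Ae := (enveloping A).

Lemma reduction_ex : exists q : {rmorphism Ae -> A},
  forall a b, q (tensor a b) = augmentation b *: a.
Proof.
have [|q qE] := @tensor_lift k A A (fun a b => augmentation b *: a).
  split=> [b|a] c x y /=; first by rewrite scalerDr !scalerA mulrC.
  by rewrite augmentationD augmentationZ scalerDl scalerA.
have [x y|a b a' b'||q' q'E] := env_rmorphism (h := q); last by exists q' => a b; rewrite q'E qE.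
- by rewrite linearD.
- by rewrite !qE augmentationM -scalerAl -scalerAr scalerA mulrC.
- by rewrite qE augmentation1 scale1r.
Qed.

Lemma scalar_tensor_ex : exists i : {rmorphism k -> Ae}, forall c, i c = tensor c%:A 1.
Proof.
have [|||i iE] := @make_rmorphism k Ae (fun c => tensor c%:A 1).
- by move=> x y; rewrite scalerDl tensorDl.
- by move=> x y; rewrite tensorM mulr1 mulr_algl scalerA.
- by rewrite scale1r.
by exists i.
Qed.

Lemma tensor_scalar_comm (c : k) (t : Ae) : t * tensor c%:A 1 = tensor c%:A 1 * t.
Proof.
elim/env_ind: t => [|t u ht hu|a b]; first by rewrite mulr0 mul0r.
  by rewrite mulrDl mulrDr ht hu.
by rewrite !tensorM mulr1 mul1r mulr_algl mulr_algr.
Qed.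

Section SecondFactor.
Variables (side : bool) (q : {rmorphism Ae -> A}).
Hypothesis qE : forall a b, q (tensor a b) = augmentation b *: a.

(** The second factor acts on rows from the left and on columns from the right; [side] treats the
    resolution and its dual together. *)
Definition act2 (b : A) (t : Ae) := if side then tensor 1 b * t else t * tensor 1 b.
Local Notation f := act2.
Let g (b c : A) := if side then c * b else b * c.
Let fD b t u : f b (t + u) = f b t + f b u.
Proof. by rewrite /f; case: side; rewrite ?mulrDr ?mulrDl. Qed.
Let fDl b c t : f (b + c) t = f b t + f c t.
Proof. by rewrite /f tensorDr; case: side; rewrite ?mulrDr ?mulrDl. Qed.
Let fZr (c : k) b t : f b (tensor c%:A 1 * t) = tensor c%:A 1 * f b t.
Proof. by rewrite /f; case: side; rewrite !mulrA // tensor_scalar_comm. Qed.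
Let fZ (c : k) b t : f (c *: b) t = tensor c%:A 1 * f b t.
Proof. by rewrite /f tensorZr env_scaleE; case: side; rewrite !mulrA ?tensor_scalar_comm. Qed.
Let fE b a c : f b (tensor a c) = tensor a (g b c).
Proof. by rewrite /f /g; case: side; rewrite tensorM ?mul1r ?mulr1. Qed.
Let g1 c : g c 1 = c. Proof. by rewrite /g mul1r mulr1 if_same. Qed.
Let f1 t : f 1 t = t. Proof. by rewrite /f mul1r mulr1 if_same. Qed.
Let ff b c t : f b (f c t) = f (g b c) t.
Proof. by rewrite /f /g; case: side; [rewrite mulrA|rewrite -mulrA]; rewrite tensorM mul1r. Qed.

Definition mact b p r (M : 'M[Ae]_(p, r)) := map_mx (f b) M.

Definition cmap p r p' r' (h : 'M[Ae]_(p, r) -> 'M[Ae]_(p', r')) :=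
  {morph h : M N / M + N} /\ forall b M, h (mact b M) = mact b (h M).

Lemma cmap0 p r p' r' (h : 'M[Ae]_(p, r) -> 'M[Ae]_(p', r')) : cmap h -> h 0 = 0.
Proof. by move=> [hD _]; apply: (addrI (h 0)); rewrite -hD !addr0. Qed.

Lemma mactD b p r (M N : 'M[Ae]_(p, r)) : mact b (M + N) = mact b M + mact b N.
Proof. by apply/matrixP => i j; rewrite !mxE fD. Qed.
Lemma f0 b : f b 0 = 0. Proof. by apply: (addrI (f b 0)); rewrite -fD !addr0. Qed.
Lemma mact0 b p r : mact b (0 : 'M[Ae]_(p, r)) = 0.
Proof. by apply/matrixP => i j; rewrite !mxE f0. Qed.
Lemma mactN b p r (M : 'M[Ae]_(p, r)) : mact b (- M) = - mact b M.
Proof. by apply: (addrI (mact b M)); rewrite -mactD !subrr mact0. Qed.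

Lemma cmap_sub p r p' r' (h h' : 'M[Ae]_(p, r) -> 'M[Ae]_(p', r')) :
  cmap h -> cmap h' -> cmap (fun x => h x - h' x).
Proof.
move=> [hD hM] [hD' hM']; split=> [x y|b x]; first by rewrite hD hD' opprD addrACA.
by rewrite hM hM' mactD mactN.
Qed.

Lemma cmap_id p r : cmap (fun x : 'M[Ae]_(p, r) => x). Proof. by split. Qed.

Lemma cmap_comp p r p' r' p'' r'' (h : 'M[Ae]_(p, r) -> 'M[Ae]_(p', r'))
    (h' : 'M[Ae]_(p', r') -> 'M[Ae]_(p'', r'')) :
  cmap h -> cmap h' -> cmap (fun x => h' (h x)).
Proof. by move=> [hD hM] [hD' hM']; split=> [x y|b x]; rewrite ?hD ?hM ?hD' ?hM'. Qed.

Let single p r i j (t : Ae) : 'M[Ae]_(p, r) := t *: delta_mx i j.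

Let singleD p r i j t u : @single p r i j (t + u) = single i j t + single i j u.
Proof. exact: scalerDl. Qed.
Let mact_single b p r i j t : mact b (@single p r i j t) = single i j (f b t).
Proof.
apply/matrixP => i' j'; rewrite !mxE; case: eqP => _; case: eqP => _ /=;
  by rewrite ?(mulr1, mulr0, f0).
Qed.
Let sum_single p r (M : 'M[Ae]_(p, r)) : M = \sum_i \sum_j single i j (M i j).
Proof. exact: matrix_sum_delta. Qed.

(** Under [G] an entry [t] may be replaced by [q t (x) 1], since the second factor acts through the
    augmentation; so [G] depends only on [map_mx q M]. *)
Lemma reduction_factor (V : lmodType k) p r (G : 'M[Ae]_(p, r) -> V) M :
  {morph G : M N / M + N} -> (forall b M, G (mact b M) = augmentation b *: G M) ->
  map_mx q M = 0 -> G M = 0.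
Proof.
move=> GD GM qM.
have key i j t : G (single i j t) = G (single i j (tensor (q t) 1)).
  elim/env_ind: t => [|t u ht hu|a b].
  - by rewrite rmorph0 tensor0l.
  - by rewrite singleD GD ht hu -GD -singleD rmorphD tensorDl.
  rewrite qE tensorZ -{1}[b]g1 -fE -mact_single GM.
  by rewrite -[augmentation b *: 1]g1 -fE -mact_single GM augmentation_scalar.
rewrite [M]sum_single morph_sum2 // big1 // => i _; rewrite big1 // => j _; rewrite key.
have -> : q (M i j) = 0 by move/matrixP/(_ i j): qM; rewrite !mxE.
by rewrite tensor0l /single scale0r; apply: (addrI (G 0)); rewrite -GD !addr0.
Qed.

Lemma cmap_reduction p r p' r' (h : 'M[Ae]_(p, r) -> 'M[Ae]_(p', r')) M :
  (forall b t, q (f b t) = augmentation b *: q t) ->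
  cmap h -> map_mx q M = 0 -> map_mx q (h M) = 0.
Proof.
move=> qf [hD hM] qM; apply/matrixP => i j; rewrite [LHS]mxE [RHS]mxE.
apply: (@reduction_factor _ p r (fun M => q (h M i j))) qM => [x y|b x].
  by rewrite hD mxE rmorphD.
by rewrite hM mxE qf.
Qed.

(** [A^e] is free over its second factor, on the first one as a vector space: a lift is chosen
    linearly over [k] on the tensors [a (x) 1] and extended by the action. *)
Lemma cmap_lift p r p' r' p'' r'' (F : 'M[Ae]_(p, r) -> 'M[Ae]_(p'', r''))
    (D : 'M[Ae]_(p', r') -> 'M[Ae]_(p'', r'')) :
  cmap F -> cmap D -> (forall u, exists y, D y = F u) ->
  exists2 h, cmap h & forall u, D (h u) = F u.
Proof.
move=> [FD FM] hD FI; have [DD DM] := hD.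
have [iota iotaE] := scalar_tensor_ex.
pose X : lmodType k := restr iota 'M[Ae]_(p'', r'').
pose Y : lmodType k := restr iota 'M[Ae]_(p', r').
have scaleE p1 r1 c (N : 'M[Ae]_(p1, r1)) : tensor c%:A 1 *: N = mact c%:A N.
  by apply/matrixP => i j; rewrite !mxE fZ f1.
have DL : linear (D : Y -> X).
  move=> c x y; rewrite -[c *: x]/(iota c *: (x : 'M[Ae]_(p', r'))) iotaE.
  by rewrite scaleE DD DM -scaleE -iotaE.
have [D' D'E] := make_linear DL.
have FL i j : linear ((fun a => F (single i j (tensor a 1))) : A -> X).
  move=> c x y; rewrite tensorDl singleD FD; congr (_ + _).
  have -> : tensor (c *: x) 1 = f c%:A (tensor x 1).
    by rewrite fZ f1 tensorM mulr1 mulr_algl.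
  by rewrite -mact_single FM -scaleE -iotaE.
have lam_ex i j : exists lam : {linear A -> Y}, forall a, D (lam a) = F (single i j (tensor a 1)).
  have [F' F'E] := make_linear (FL i j).
  have [|lam lamE] := @linear_lifting k A X Y D' F'.
    by move=> a; have [y yE] := FI (single i j (tensor a 1)); exists y; rewrite D'E F'E.
  by exists lam => a; rewrite -D'E lamE F'E.
pose lam i j := projT1 (cid (lam_ex i j)).
have lamE i j a : D (lam i j a) = F (single i j (tensor a 1)) by rewrite /lam; case: cid.
have L_ex i j : exists L : {linear Ae -> Y}, forall a c, L (tensor a c) = mact c (lam i j a).
  apply: (@tensor_lift k A Y (fun a c => mact c (lam i j a))).
  split=> [b|a] c x y.
    rewrite linearP -[c *: lam i j x]/(iota c *: (lam i j x : 'M[Ae]_(p', r'))).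
    rewrite -[RHS]/(iota c *: mact b (lam i j x) + mact b (lam i j y)) mactD iotaE.
    congr (_ + _); apply/matrixP => i' j'.
    by rewrite !mxE fZr.
  rewrite -[RHS]/(iota c *: mact x (lam i j a) + mact y (lam i j a)) iotaE.
  by apply/matrixP => i' j'; rewrite !mxE fDl fZ.
pose L i j := projT1 (cid (L_ex i j)).
have LE i j a c : L i j (tensor a c) = mact c (lam i j a) by rewrite /L; case: cid.
have Lf i j b t : L i j (f b t) = mact b (L i j t).
  elim/env_ind: t => [|t u ht hu|a c]; first by rewrite f0 linear0 mact0.
    by rewrite fD !linearD ht hu mactD.
  by rewrite fE !LE; apply/matrixP => i' j'; rewrite !mxE ff.
have DLE i j t : D (L i j t) = F (single i j t).
  elim/env_ind: t => [|t u ht hu|a c].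
  - by rewrite linear0 /single scale0r (cmap0 hD) (cmap0 (conj FD FM)).
  - by rewrite linearD DD ht hu singleD FD.
  - by rewrite LE DM lamE -FM mact_single fE g1.
exists (fun M => \sum_i \sum_j L i j (M i j) : 'M[Ae]_(p', r')).
  split=> [M N|b M].
    rewrite -big_split /=; apply: eq_bigr => i _; rewrite -big_split /=.
    by apply: eq_bigr => j _; rewrite mxE linearD.
  rewrite (morph_sum2 _ (@mactD b _ _)); apply: eq_bigr => i _; apply: eq_bigr => j _.
  by rewrite mxE Lf.
move=> M; rewrite [in RHS](sum_single M) !morph_sum2 //.
by apply: eq_bigr => i _; apply: eq_bigr => j _.
Qed.

End SecondFactor.
End Reduction.

Section ReducedComplex.
Variables (k : fieldType) (A : gralg k).
Local Notation Ae := (enveloping A).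
Variables (q : {rmorphism Ae -> A}) (qE : forall a b, q (tensor a b) = augmentation b *: a).
Variables (b : nat -> nat) (e : forall n, 'I_(b n) -> int)
  (d : forall n, 'M[Ae]_(b n.+1, b n)) (al : 'I_(b 0) -> regular_bimodule A).
Hypothesis res : mx_resolution e d al.

Let mactl c p r (M : 'M[Ae]_(p, r)) : mact true c M = tensor 1 c *: M.
Proof. by apply/matrixP => i j; rewrite !mxE. Qed.
Let mactr c p r (M : 'M[Ae]_(p, r)) : mact false c M = M *m (tensor 1 c)%:M.
Proof. by apply/matrixP => i j; rewrite mulmx_scalarE !mxE. Qed.

Let dd : forall n, d n.+1 *m d n = 0 := exact_complex (@mxr_exactS _ _ _ _ _ _ res).

Definition previous_zero n : 'rV[Ae]_(b n) -> Prop :=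
  match n with 0 => fun x => comb al x = 0 | n'.+1 => fun x => x *m d n' = 0 end.

Let combZ c (x : 'rV[Ae]_(b 0)) : (comb al (tensor 1 c *: x) : A) = (comb al x : A) * c.
Proof. by rewrite linearZ /= tensor_scale mul1r. Qed.

Let previous_zero0 s1 (x : 'rV[Ae]_(b 0)) : comb al s1 = (1 : A) ->
  previous_zero (x - tensor 1 (comb al x : A) *: s1).
Proof. by move=> s1E; rewrite /= linearB /= combZ s1E mul1r subrr. Qed.

Let previous_zeroS n h (x : 'rV[Ae]_(b n.+1)) :
  (forall z : 'rV[Ae]_(b n), previous_zero z -> h z *m d n = z) ->
  previous_zero (x - h (x *m d n)).
Proof.
move=> hE; rewrite /= mulmxBl hE ?subrr //; case: (n) x => [|n'] x /=.
  by apply/(mxr_exact0 res); exists x.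
by rewrite -mulmxA dd mulmx0.
Qed.

(* The resolution splits as a sequence of right A-modules. *)
Lemma row_contraction n : exists2 h : 'rV[Ae]_(b n) -> 'rV[Ae]_(b n.+1), cmap true h
  & forall x, previous_zero x -> h x *m d n = x.
Proof.
have dmap i : cmap true (fun x : 'rV[Ae]_(b i.+1) => x *m d i).
  by split=> [x y|c x]; rewrite ?mulmxDl // !mactl scalemxAl.
elim: n => [|n [h hh hE]].
  have [s1 s1E] := mxr_surj res (1 : A).
  (* As [s1] lies over 1, this is a projector onto the kernel of the augmentation. *)
  have hF : cmap true (fun x : 'rV[Ae]_(b 0) => x - tensor 1 (comb al x : A) *: s1).
    split=> [x y|c x].
      by rewrite linearD tensorDr scalerDl opprD addrACA.
    by rewrite !mactl combZ scalerBr scalerA tensorM mulr1.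
  have [|h hh hE] := cmap_lift hF (dmap 0%N).
    by move=> x; have /(mxr_exact0 res)[z zE] := previous_zero0 x s1E; exists z.
  exists h => // x x0; rewrite hE; have -> : (comb al x : A) = 0 by exact: x0.
  by rewrite tensor0r scale0r subr0.
(* [x - h (x d)] is a projector onto the kernel of [d n]. *)
have hF := cmap_sub (cmap_id A true 1 (b n.+1)) (cmap_comp (dmap n) hh).
have [|h' hh' hE'] := cmap_lift hF (dmap n.+1).
  by move=> x; have /(mxr_exactS res)[z zE] := previous_zeroS x hE; exists z.
by exists h' => // x x0; rewrite hE' x0 (cmap0 hh) subr0.
Qed.

Definition reduced_d n := map_mx q (d n).
Definition reduced_aug (i : 'I_(b 0)) : trivial_module A := augmentation (al i : A).

Lemma reduced_augE (x : 'rV[Ae]_(b 0)) :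
  comb reduced_aug (map_mx q x) = augmentation (comb al x : A) :> k.
Proof.
have augD : {morph @augmentation k A : x y / x + y} by move=> u v; apply: augmentationD.
rewrite /comb (big_morph _ augD (augmentation0 A)).
apply: eq_bigr => i _; rewrite mxE -[LHS]/(trivial_scale _ _) /trivial_scale /reduced_aug.
elim/env_ind: (x 0 i) => [|t u ht hu|a c].
- by rewrite rmorph0 scale0r augmentation0 mul0r.
- by rewrite rmorphD augmentationD mulrDl ht hu -augmentationD scalerDl.
by rewrite qE augmentationZ tensor_scale !augmentationM -mulrA mulrC.
Qed.

Lemma map_surj p r (x : 'M[A]_(p, r)) : exists X, map_mx q X = x.
Proof.
by apply: map_mx_lift => a; exists (tensor a 1); rewrite qE augmentation1 scale1r.
Qed.

Lemma reduced_surj c : exists x, comb reduced_aug x = c.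
Proof.
have [x xE] := mxr_surj res ((c : k)%:A : A); exists (map_mx q x).
by apply: (etrans (reduced_augE x)); rewrite xE augmentation_scalar.
Qed.

Let reduce_h p r p' r' (h : 'M[Ae]_(p, r) -> 'M[Ae]_(p', r')) M :
  cmap true h -> map_mx q M = 0 -> map_mx q (h M) = 0.
Proof. by apply: (cmap_reduction qE) => c t; rewrite rmorphM qE mulr_algl. Qed.

(** A contraction commuting with the second factor descends through [q], so exactness survives
    tensoring with [k]; the next lemma uses the same in higher degrees. *)
Lemma reduced_exact0 x : comb reduced_aug x = 0 <-> exists z, x = z *m reduced_d 0.
Proof.
split=> [h|[z ->]].
  have [X XE] := map_surj x; move: h; rewrite -XE => /(etrans (esym (reduced_augE X))) a0.
  have [h hh hE] := row_contraction 0.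
  have [s1 s1E] := mxr_surj res (1 : A).
  pose a : A := comb al X.
  have /hE e1 := previous_zero0 X s1E.
  exists (map_mx q (h (X - tensor 1 a *: s1))); rewrite -map_mxM e1 map_mxB map_mxZ qE.
  by rewrite a0 scale0r scale0r subr0.
have [Z ZE] := map_surj z; rewrite -ZE -map_mxM; apply: (etrans (reduced_augE _)).
have -> : comb al (Z *m d 0%N) = 0 by apply/(mxr_exact0 res); exists Z.
exact: augmentation0.
Qed.

Lemma reduced_exactS n (x : 'rV[A]_(b n.+1)) :
  x *m reduced_d n = 0 <-> exists z, x = z *m reduced_d n.+1.
Proof.
split=> [|[z ->]]; last by rewrite -mulmxA -map_mxM dd map_mx0 mulmx0.
have [X <-] := map_surj x; rewrite -map_mxM => hX.
have [h hh hE] := row_contraction n; have [h' hh' hE'] := row_contraction n.+1.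
have e1 := previous_zeroS X hE.
exists (map_mx q (h' (X - h (X *m d n)))); rewrite -map_mxM hE' //.
by rewrite map_mxB (reduce_h hh hX) subr0.
Qed.

Section Ext.
Variables (dim : nat) (nu : {lrmorphism A -> A}) (l : int) (Phi : 'cV[Ae]_(b dim) -> A).
Hypotheses (ext : mx_ext e d nu l Phi)
  (aug_nu : forall a, augmentation (nu a) = augmentation a).

(** Descending induction from the bound [N], beyond which all terms vanish; in degrees above [dim]
    the dual complex is exact. *)
Let column_contraction n : (dim <= n)%N ->
  exists2 h : 'cV[Ae]_(b n.+1) -> 'cV[Ae]_(b n), cmap false h
  & forall z, d n.+1 *m z = 0 -> d n *m h z = z.
Proof.
have dmap i : cmap false (fun z : 'cV[Ae]_(b i) => d i *m z).
  by split=> [x y|c x]; rewrite ?mulmxDr // !mactr mulmxA.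
have [N hN] := mxr_fin res.
have main j : forall i, (N < i.+1 + j)%N -> (dim <= i)%N ->
    exists2 h : 'cV[Ae]_(b i.+1) -> 'cV[Ae]_(b i), cmap false h
    & forall z, d i.+1 *m z = 0 -> d i *m h z = z.
  elim: j => [|j IH] i Ni di.
    exists (fun=> 0); first by split=> [x y|c x]; rewrite ?addr0 // mact0.
    move=> z _; rewrite mulmx0; apply/matrixP => r; have := ltn_ord r.
    by rewrite [X in (_ < X)%N]hN //; rewrite addn0 in Ni.
  have [||h hh hE] := IH i.+1; first by rewrite addSnnS.
    exact: leqW.
  have hF := cmap_sub (cmap_id A false (b i.+1) 1) (cmap_comp (dmap i.+1) hh).
  have [|h' hh' hE'] := cmap_lift hF (dmap i).
    move=> z; have : d i.+1 *m (z - h (d i.+1 *m z)) = 0.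
      by rewrite mulmxBr hE ?subrr // mulmxA dd mul0mx.
    have nd : i.+1 != dim by rewrite neq_ltn ltnS di orbT.
    by move=> /(mxe_vanish ext nd)[y yE]; exists y.
  by exists h' => // z z0; rewrite hE' z0 (cmap0 hh) subr0.
by apply: (main N); rewrite addSn ltnS leq_addl.
Qed.

(** The cocycle of class 1 stays nontrivial. The projector [T] onto cocycles extends the
    augmentation of [Phi] to all columns; this extension factors through [q] and takes the value
    1. *)
Lemma reduced_ext_neq0 : exists2 g, reduced_d dim *m g = 0 & ~ cobd reduced_d g.
Proof.
have [f hf fE] := mxe_surj ext 1.
exists (map_mx q f); first by rewrite -map_mxM hf map_mx0.
move=> hcob.
(* If the reduction were a coboundary, subtracting a lifted coboundary would leave a cocycle of
   class 1 with zero reduction. *)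
have [f' [hf' f'E qf']] : exists f', [/\ d dim *m f' = 0, Phi f' = 1 & map_mx q f' = 0].
  suff [u [hu uE]] : exists u, cobd d u /\ map_mx q u = map_mx q f.
    have cu : d dim *m u = 0.
      move: hu; case: (dim) u {uE} => [|n] u /=; first by move=> ->; rewrite mulmx0.
      by move=> [w ->]; rewrite mulmxA dd mul0mx.
    have cu' : d dim *m (f - u) = 0 by rewrite mulmxBr hf cu subrr.
    exists (f - u); split=> //; last by rewrite map_mxB uE subrr.
    have /(mxe_ker ext cu) u0 := hu.
    by have := mxe_add ext cu' cu; rewrite subrK fE u0 addr0 => <-.
  move: hcob; case: (dim) f {hf fE} => [|n] f /=; first by move=> ->; exists 0; rewrite map_mx0.
  by move=> [w wE]; have [W WE] := map_surj w; exists (d n *m W); split;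
    [exists W|rewrite map_mxM WE].
have [h hh hE] := column_contraction (leqnn dim).
have dmap : cmap false (fun z : 'cV[Ae]_(b dim) => d dim *m z).
  by split=> [x y|c x]; rewrite ?mulmxDr // !mactr mulmxA.
have [TD TM] := cmap_sub (cmap_id A false (b dim) 1) (cmap_comp dmap hh).
pose T z := z - h (d dim *m z).
have TZ z : d dim *m T z = 0 by rewrite mulmxBr hE ?subrr // mulmxA dd mul0mx.
have GD x y : augmentation (Phi (T (x + y))) =
    augmentation (Phi (T x)) + augmentation (Phi (T y)).
  rewrite -augmentationD -(mxe_add ext) ?TZ //.
  by congr (augmentation (Phi _)); apply: TD.
have GM c M : augmentation (Phi (T (mact false c M))) =
    augmentation c * augmentation (Phi (T M)).
  have := mxe_mul ext (TZ M) 1 c; rewrite mulr1 => e1.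
  rewrite -(aug_nu c) -augmentationM -e1 -mactr.
  by congr (augmentation (Phi _)); apply: TM.
pose G z : k^o := augmentation (Phi (T z)).
have := @reduction_factor k A false q qE k^o _ _ G f' GD GM qf'.
rewrite /G /T hf' (cmap0 hh) subr0 f'E augmentation1 => /eqP.
by rewrite oner_eq0.
Qed.

End Ext.
End ReducedComplex.

(** * The homological determinant *)

Section TwistedMatrix.
Variables (k : fieldType) (A : gralg k) (sigma sigma' : {lrmorphism A -> A}).
Hypotheses (sK : cancel sigma sigma') (s'K : cancel sigma' sigma).
Variables (P : resolution (trivial_module A)) (b : nat -> nat)
  (v : forall n, 'I_(b n) -> P n) (crd : forall n, {linear P n -> 'rV[A]_(b n)}).
Hypotheses (crdK : forall n, cancel (@crd n) (comb (@v n)))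
  (combK : forall n, cancel (comb (@v n)) (@crd n)).

Definition kscale (c : k) p r (M : 'M[A]_(p, r)) := map_mx ( *:%R c) M.

Lemma mulmx_kscale (c : k) p r t (M : 'M[A]_(p, r)) (N : 'M[A]_(r, t)) :
  M *m kscale c N = kscale c (M *m N).
Proof.
apply/matrixP => i j; rewrite !mxE scaler_sumr; apply: eq_bigr => l _.
by rewrite mxE scalerAr.
Qed.

Lemma cobd_kscale (c : k) (d : forall n, 'M[A]_(b n.+1, b n)) n (f : 'cV[A]_(b n)) :
  cobd d f -> cobd d (kscale c f).
Proof.
case: n f => [|n] f /=; first by move=> ->; apply/matrixP => i j; rewrite !mxE scaler0.
by move=> [g ->]; exists (kscale c g); rewrite mulmx_kscale.
Qed.

Definition twist_mx (phi : forall n, P n -> P n) n : 'M[A]_(b n) :=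
  \matrix_i crd n (phi n (v i)).

Lemma twist_mxE phi n x : twisted_lift sigma phi ->
  crd n (phi n x) = map_mx sigma' (crd n x) *m twist_mx phi n.
Proof.
move=> hphi; have hP a y z := @twisted_liftP _ _ _ _ s'K P phi n a y z hphi.
have phi0 : phi n 0 = 0 by have [h _ _ _] := hphi; apply: (addrI (phi n 0)); rewrite -h !addr0.
rewrite -{1}[x]crdK /comb mulmx_sum_row.
rewrite (_ : phi n (\sum_i crd n x 0 i *: v i) = \sum_i sigma' (crd n x 0 i) *: phi n (v i)).
  by rewrite linear_sum; apply: eq_bigr => i _; rewrite linearZ rowK !mxE.
elim: (index_enum _) => [|i r IH]; first by rewrite !big_nil phi0.
by rewrite !big_cons hP IH.
Qed.

Lemma twist_mx_chain phi n : twisted_lift sigma phi ->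
  map_mx sigma' (basis_mx v crd n) *m twist_mx phi n =
  twist_mx phi n.+1 *m basis_mx v crd n.
Proof.
move=> hphi; apply/row_matrixP => i; rewrite !row_mul -map_row !rowK.
rewrite -(twist_mxE _ hphi); have [_ _ -> _] := hphi.
by rewrite (basis_mxE crdK).
Qed.

Lemma twisted_scalar_mx phi d c : twisted_lift sigma phi ->
  twisted_scalar sigma phi d c <->
  forall g, basis_mx v crd d *m g = 0 ->
    cobd (basis_mx v crd) (map_mx sigma (twist_mx phi d *m g) - kscale c g).
Proof.
move=> hphi.
have key g : (fun x => (sigma (colfun crd g (phi d x)) - c *: (colfun crd g x : A) : A) : A^o) =
    colfun crd (map_mx sigma (twist_mx phi d *m g) - kscale c g).
  apply: funext => x; rewrite /colfun mulmxBr mulmx_kscale (twist_mxE _ hphi).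
  have e : crd d x *m map_mx sigma (twist_mx phi d *m g) =
      map_mx sigma (map_mx sigma' (crd d x) *m twist_mx phi d *m g).
    rewrite -[map_mx sigma' (crd d x) *m _ *m _]mulmxA [in RHS]map_mxM; congr (_ *m _).
    by apply/matrixP => i j; rewrite !mxE; apply: (esym (s'K _)).
  by rewrite e [in RHS]mxE; congr (_ + _); rewrite !mxE.
split=> [h g hg|h f /(colfun_ex crdK)[g hg ->]].
  apply/(colfun_coboundary crdK combK); rewrite -key; apply: h.
  exact/(colfun_cocycle crdK).
rewrite key; apply/(colfun_coboundary crdK combK); exact: h.
Qed.

Lemma twisted_lift_of_mx (T : forall n, 'M[A]_(b n)) :
  (forall n, map_mx sigma' (basis_mx v crd n) *m T n = T n.+1 *m basis_mx v crd n) ->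
  (forall x : 'rV_(b 0), res_aug P (comb (@v 0%N) (map_mx sigma' x *m T 0%N)) =
     res_aug P (comb (@v 0%N) x)) ->
  exists2 phi : forall n, P n -> P n, twisted_lift sigma phi & forall n, twist_mx phi n = T n.
Proof.
move=> TS T0; exists (fun n x => comb (@v n) (map_mx sigma' (crd n x) *m T n)); last first.
  move=> n; apply/row_matrixP => i; rewrite rowK combK (crd_v combK) rowE.
  by congr (_ *m _); apply/matrixP => j l; rewrite !mxE; case: (_ && _); rewrite ?rmorph1 ?rmorph0.
split=> [n x y|n a x|n x|x].
- by rewrite linearD map_mxD mulmxDl linearD.
- rewrite linearZ /=; apply: (etrans _ (linearZ_LR (comb (@v n)) a _)); congr (comb _ _).
  rewrite scalemxAl; congr (_ *m _).
  by apply/matrixP => i j; rewrite !mxE rmorphM; congr (_ * _); apply: sK.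
- by rewrite -[RHS]crdK !(basis_mxE crdK) combK map_mxM -!mulmxA TS.
- by rewrite T0 crdK.
Qed.

End TwistedMatrix.

(** * Semilinear chain maps on the cone *)

Section TwistedCone.
Variables (R : nzRingType) (w lam : R) (th sg : {rmorphism R -> R}).
Hypotheses (wE : forall x, w * x = th x * w) (wreg : regular_elt w)
  (sgw : sg w = lam * w).
Variables (b : nat -> nat) (d : forall n, 'M[R]_(b n.+1, b n))
  (s : forall n, 'M[R]_(b n.+2, b n)) (T : forall n, 'M[R]_(b n)).
Hypotheses (hs : forall n, d n.+1 *m d n = - (s n *m w%:M)).
Variable U : forall n, 'M[R]_(b n.+1, b n).
Hypothesis hU : forall n, map_mx sg (d n) *m T n = T n.+1 *m d n + U n *m w%:M.

Definition cone_V n : 'M[R]_(shift_dim b n) :=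
  match n with 0 => 0 | n'.+1 => lam *: map_mx th (T n') end.
Definition cone_U n : 'M[R]_(b n, shift_dim b n) :=
  match n with 0 => 0 | n'.+1 => U n' end.
(* The [sg]-semilinear chain map of the cone induced by [T]; the factor [lam] of its
   lower block is what relates the two homological determinants. *)
Definition cone_T n : 'M[R]_(cone_dim b n) := block_mx (T n) (cone_U n) 0 (cone_V n).

Let Vw n : cone_V n.+1 *m w%:M = map_mx sg w%:M *m T n.
Proof.
rewrite map_scalar_mx sgw /= -scalemxAl -(mulmx_twist _ wE) scalar_mxM.
by rewrite -[RHS]mulmxA [RHS]mul_scalar_mx.
Qed.

Let tw n : cone_t th d n.+1 *m w%:M = - (w%:M *m d n).
Proof. by rewrite /= mulNmx -(mulmx_twist _ wE). Qed.

Let rcancel p r (M N : 'M[R]_(p, r)) : M *m w%:M = N *m w%:M -> M = N.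
Proof. by apply: mx_rreg; have [] := wreg. Qed.

(** The blocks of the second column are compared after right multiplication by [w], where [hs] and
    [hU] reduce them to identities between [d] and [T]. *)
Lemma cone_T_chain n :
  map_mx sg (cone_d w th d s n) *m cone_T n = cone_T n.+1 *m cone_d w th d s n.
Proof.
rewrite /cone_d /cone_T map_block_mx !mulmx_block !mulmx0 !mul0mx !addr0 !add0r.
have BL : map_mx sg w%:M *m T n = cone_V n.+1 *m w%:M by rewrite Vw.
congr block_mx => //.
- case: n {BL} => [|n]; first by apply/matrixP => i [].
  apply: rcancel; rewrite !mulmxDl -!mulmxA tw Vw /= mulmxN.
  have -> : U n *m w%:M = map_mx sg (d n) *m T n - T n.+1 *m d n by rewrite hU addrC addKr.
  rewrite mulmxBr [map_mx sg (s n) *m _]mulmxA -map_mxM.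
  have -> : s n *m w%:M = - (d n.+1 *m d n) by rewrite hs opprK.
  rewrite map_mxN map_mxM mulNmx -!mulmxA addrAC subrr add0r.
  have -> : U n.+1 *m (w%:M *m d n) = (map_mx sg (d n.+1) *m T n.+1 - T n.+2 *m d n.+1) *m d n.
    by rewrite hU [_ + U _ *m _]addrC addrK mulmxA.
  by rewrite mulmxBl mulmxN opprB -!mulmxA addKr.
- case: n {BL} => [|n]; first by apply/matrixP => i [].
  apply: rcancel; rewrite !mulmxDl -!mulmxA tw Vw mulmxN [cone_V _ *m (_ *m _)]mulmxA Vw /=.
  have -> : U n *m w%:M = map_mx sg (d n) *m T n - T n.+1 *m d n by rewrite hU addrC addKr.
  rewrite mulmxBr [map_mx sg (- _) *m _]mulmxA -map_mxM.
  have -> : - map_mx th (d n) *m w%:M = - (w%:M *m d n) by exact: tw.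
  by rewrite map_mxN map_mxM mulNmx -!mulmxA addrAC subrr add0r.
Qed.

End TwistedCone.

Lemma kscale_mul (k : fieldType) (A : gralg k) (c : k) p r t (M : 'M[A]_(p, r)) (N : 'M[A]_(r, t)) :
  kscale c M *m N = kscale c (M *m N).
Proof.
apply/matrixP => i j; rewrite !mxE scaler_sumr; apply: eq_bigr => l _.
by rewrite mxE scalerAl.
Qed.

Lemma map_kscale (k : fieldType) (A B : gralg k) (f : {lrmorphism A -> B}) (c : k) p r
    (M : 'M[A]_(p, r)) :
  map_mx f (kscale c M) = kscale c (map_mx f M).
Proof. by apply/matrixP => i j; rewrite !mxE linearZ. Qed.

Section HomologicalDeterminant.
Variables (k : fieldType) (D A : gralg k) (Omega : D)
  (Omega_normal : normal_elt Omega) (Omega_regular : regular_elt Omega)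
  (pi : {lrmorphism D -> A})
  (pi_hom : forall n x, gcomp D n x -> gcomp A n (pi x))
  (pi_surj : forall a, exists x, pi x = a)
  (pi_ker : forall x, pi x = 0 <-> two_sided_ideal (eq Omega) x).
Variables (tau tau' : {lrmorphism D -> D}).
Hypotheses (tauK : cancel tau tau') (tau'K : cancel tau' tau)
  (tauE : forall x, Omega * x = tau x * Omega).
Variables (sigma sigma' : {lrmorphism D -> D}) (sigmaA sigmaA' : {lrmorphism A -> A})
  (lambda : k).
Hypotheses (sK : cancel sigma sigma') (s'K : cancel sigma' sigma)
  (sAK : cancel sigmaA sigmaA') (sA'K : cancel sigmaA' sigmaA)
  (sAE : forall x, sigmaA (pi x) = pi (sigma x))
  (sA'E : forall x, sigmaA' (pi x) = pi (sigma' x))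
  (sA_aug : forall x, augmentation (sigmaA' x) = augmentation x)
  (lambda0 : lambda != 0) (sO : sigma Omega = lambda *: Omega).
Local Notation kerP := (pi_kerP Omega_normal pi_ker).

(** [sigma] only rescales [Omega], and the scalar cancels from the relation that defines [tau]. *)
Lemma sigma_tau x : sigma (tau' x) = tau' (sigma x).
Proof.
apply: (can_inj tauK); rewrite tau'K; apply: Omega_regular.2; rewrite /= -tauE.
have e : sigma Omega * sigma (tau' x) = sigma x * sigma Omega.
  by rewrite -!rmorphM tauE tau'K.
by apply: (scalerI lambda0); rewrite scalerAl scalerAr -sO.
Qed.

Lemma sigma'_Omega : sigma' Omega = (lambda^-1)%:A * Omega.
Proof.
by rewrite mulr_algl; apply: (can_inj sK); rewrite s'K linearZ /= sO scalerA mulVf ?scale1r.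
Qed.

Variables (b : nat -> nat) (d : forall n, 'M[A]_(b n.+1, b n))
  (al : 'I_(b 0) -> trivial_module A).
Hypotheses (al_surj : forall c, exists x, comb al x = c)
  (ex0 : forall x, comb al x = 0 <-> exists z, x = z *m d 0)
  (exS : forall n (x : 'rV[A]_(b n.+1)), x *m d n = 0 <-> exists z, x = z *m d n.+1).

(** The determinant is the inverse of the scalar, which is why [lambda] multiplies the scalar on the
    side of [A] here and the determinant of [A] in (3). *)
Lemma hdet_scalar_quotient dim c :
  hdet_scalar dim.+1 sigma c <-> hdet_scalar dim sigmaA (lambda * c).
Proof.
have [PA [vA [crdA [crdAK combAK bmA augA]]]] := free_resolution_ex al_surj ex0 exS.
have [phiA hphiA] := twisted_lift_ex sAK sA_aug PA.
pose T n := twist_mx vA crdA phiA n.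
have TS n : map_mx sigmaA' (d n) *m T n = T n.+1 *m d n.
  by rewrite -bmA; apply: (twist_mx_chain sA'K crdAK).
have lift p r (M : 'M[A]_(p, r)) := map_mx_lift M pi_surj.
pose dh n : 'M[D]_(b n.+1, b n) := projT1 (cid (lift _ _ (d n))).
have dhE n : map_mx pi (dh n) = d n by rewrite /dh; case: cid.
pose Th n : 'M[D]_(b n) := projT1 (cid (lift _ _ (T n))).
have ThE n : map_mx pi (Th n) = T n by rewrite /Th; case: cid.
have dd := exact_complex exS.
have s_ex n : exists s : 'M[D]_(b n.+2, b n), dh n.+1 *m dh n = - (s *m Omega%:M).
  have /(map_mx_ker _ kerP)[s sE] : map_mx pi (dh n.+1 *m dh n) = 0.
    by rewrite map_mxM !dhE dd.
  by exists (- s); rewrite mulNmx opprK.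
pose s n := projT1 (cid (s_ex n)).
have hs n : dh n.+1 *m dh n = - (s n *m Omega%:M) by rewrite /s; case: cid.
have pis' p r (M : 'M[D]_(p, r)) : map_mx pi (map_mx sigma' M) = map_mx sigmaA' (map_mx pi M).
  by apply/matrixP => i j; rewrite !mxE sA'E.
(* [Th] commutes with the lifted differentials only modulo [Omega]; [U] records the error. *)
have U_ex n : exists U : 'M[D]_(b n.+1, b n),
    map_mx sigma' (dh n) *m Th n = Th n.+1 *m dh n + U *m Omega%:M.
  have /(map_mx_ker _ kerP)[U UE] : map_mx pi (map_mx sigma' (dh n) *m Th n - Th n.+1 *m dh n) = 0.
    by rewrite map_mxB !map_mxM pis' !ThE !dhE TS subrr.
  by exists U; rewrite -UE addrC subrK.
pose U n := projT1 (cid (U_ex n)).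
have hU n : map_mx sigma' (dh n) *m Th n = Th n.+1 *m dh n + U n *m Omega%:M.
  by rewrite /U; case: cid.
pose C := cone_d Omega tau dh s.
pose That := cone_T (lambda^-1)%:A tau Th U.
have chain n : map_mx sigma' (C n) *m That n = That n.+1 *m C n.
  exact: (cone_T_chain tauE Omega_regular sigma'_Omega hs hU).
pose alD (i : 'I_(cone_dim b 0)) : trivial_module D :=
  match split i with inl j => (al j : k) | inr _ => 0 end.
have pi_aug := graded_augmentation pi_hom.
have combD (x : 'rV[D]_(cone_dim b 0)) :
    comb alD x = comb al (map_mx pi (lsubmx x)) :> k.
  rewrite /comb big_split_ord /= big_ord0 addr0; apply: eq_bigr => i _.
  rewrite !mxE -[LHS]/(trivial_scale _ _) -[RHS]/(trivial_scale _ _) /trivial_scale pi_aug.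
  by rewrite /alD -[lshift _ i]/(unsplit (inl _ i)) unsplitK.
have d1E' : (fun n => map_mx pi (dh n)) = d by apply: functional_extensionality_dep.
have alD_surj c' : exists x, comb alD x = c'.
  have [x xE] := al_surj c'; have [X XE] := lift _ _ x.
  exists (row_mx X 0); apply: (etrans (combD _)); by rewrite row_mxKl XE.
have exD0 (x : 'rV[D]_(cone_dim b 0)) : comb alD x = 0 <-> exists z, x = z *m C 0%N.
  rewrite -(@cone_exact0 _ _ Omega tau pi pi_surj kerP b dh s (fun x => comb al x = 0)).
    by split=> [h|h]; [apply: (etrans (esym (combD x)))|apply: (etrans (combD x))].
  by move=> z; rewrite dhE; apply: ex0.
have exDS n (x : 'rV[D]_(cone_dim b n.+1)) : x *m C n = 0 <-> exists z, x = z *m C n.+1.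
  apply: (@cone_exactS _ _ Omega tau pi) => //; first exact: kerP.
  by move=> n' z; rewrite !dhE; apply: exS.
have [PC [vC [crdC [crdCK combCK bmC augC]]]] := free_resolution_ex alD_surj exD0 exDS.
have [||phiC hphiC phiCE] := @twisted_lift_of_mx _ _ sigma sigma' sK PC _ vC crdC crdCK combCK That.
- by move=> n; rewrite bmC; apply: chain.
- move=> x; rewrite !augC !combCK; apply: (etrans (combD _)); apply: (etrans _ (esym (combD _))).
  have -> : lsubmx (map_mx sigma' x *m That 0%N) = map_mx sigma' (lsubmx x) *m Th 0%N.
    rewrite /That /cone_T -[map_mx sigma' x]hsubmxK mul_row_block row_mxKl mulmx0 addr0.
    by rewrite map_lsubmx.
  rewrite map_mxM pis' ThE; set y := map_mx pi (lsubmx x).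
  have [_ _ _ h] := hphiA; have := h (comb (vA 0%N) y).
  by rewrite !augA (twist_mxE sA'K crdAK _ hphiA) !combAK.
rewrite (hdet_scalarP s'K _ _ hphiC) (hdet_scalarP sA'K _ _ hphiA).
rewrite (twisted_scalar_mx s'K crdCK combCK _ _ hphiC) (twisted_scalar_mx sA'K crdAK combAK _ _ hphiA).
rewrite bmA bmC phiCE -/(T dim).
(* The lower corner of [That] contributes [lambda^-1]; factoring it out turns [c] into
   [lambda * c]. *)
have psiE (h : 'cV[D]_(cone_dim b dim.+1)) :
    cone_psi tau' pi (map_mx sigma (That dim.+1 *m h) - kscale c h) =
    kscale lambda^-1 (map_mx sigmaA (T dim *m cone_psi tau' pi h) -
      kscale (lambda * c) (cone_psi tau' pi h)).
  have pisg p r (M : 'M[D]_(p, r)) : map_mx pi (map_mx tau' (map_mx sigma M)) =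
      map_mx sigmaA (map_mx pi (map_mx tau' M)).
    by apply/matrixP => i j; rewrite !mxE -sigma_tau sAE.
  have e1 : dsubmx (That dim.+1 *m h) = kscale lambda^-1 (map_mx tau (Th dim) *m dsubmx h).
    rewrite /That /cone_T -{1}[h]vsubmxK mul_block_col col_mxKd mul0mx add0r /=.
    by rewrite -kscale_mul; congr (_ *m _); apply/matrixP => i j; rewrite !mxE mulr_algl.
  have e2 : dsubmx (map_mx sigma (That dim.+1 *m h) - kscale c h) =
      map_mx sigma (dsubmx (That dim.+1 *m h)) - kscale c (dsubmx h).
    by rewrite linearB /= /kscale !map_dsubmx.
  rewrite /cone_psi e2 e1.
  rewrite !map_mxB pisg !map_kscale map_mxM (map_th'K tauK) map_mxM ThE.
  by apply/matrixP => i j; rewrite !mxE scalerBr scalerA mulKf.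
have Ccoc h : C dim.+1 *m h = 0 -> C dim.+1 *m (map_mx sigma (That dim.+1 *m h) - kscale c h) = 0.
  move=> hh; rewrite mulmxBr mulmx_kscale hh.
  have -> : C dim.+1 *m map_mx sigma (That dim.+1 *m h) =
      map_mx sigma (map_mx sigma' (C dim.+1) *m (That dim.+1 *m h)).
    rewrite [RHS]map_mxM; congr (_ *m _).
    by apply/matrixP => i j; rewrite !mxE; apply: (esym (s'K _)).
  rewrite mulmxA chain -mulmxA hh mulmx0 map_mx0 sub0r.
  by apply/matrixP => i j; rewrite !mxE scaler0 oppr0.
have psi_cobd (h : 'cV[D]_(cone_dim b dim.+1)) : C dim.+1 *m h = 0 ->
    (cobd C h <-> cobd d (cone_psi tau' pi h)).
  by move=> hh; rewrite (cone_psi_cobd tauK tau'K tauE Omega_regular pi_surj kerP hs hh) d1E'.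
split=> [H g hg|H h hh].
  have [|h hh hE] := @cone_psi_surj _ _ Omega tau tau' pi tauK tau'K tauE Omega_regular
    pi_surj kerP b dh s hs dim g; first by rewrite dhE.
  have /psi_cobd := H h hh; rewrite psiE hE => /(_ (Ccoc _ _ hh)) /(cobd_kscale lambda).
  congr (cobd _ _); apply/matrixP => i j; by rewrite !mxE scalerA mulfV // scale1r.
apply/psi_cobd; first exact: Ccoc.
rewrite psiE; apply: cobd_kscale; apply: H.
rewrite -dhE; apply: cone_psi_cocycle hh => //; exact: kerP.
Qed.

End HomologicalDeterminant.

(** Two different scalars would make a nonzero multiple of a nontrivial class a coboundary. *)
Lemma hdet_scalar_unique (k : fieldType) (A : gralg k) dim (nu sigma sigma' : {lrmorphism A -> A})
    c c' :
  nakayama dim nu -> cancel sigma sigma' -> cancel sigma' sigma ->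
  (forall x, augmentation (sigma' x) = augmentation x) ->
  hdet_scalar dim sigma c -> hdet_scalar dim sigma c' -> c = c'.
Proof.
move=> hnu sK s'K aug_s'.
have nug := hnu.1.
have [b [e [d [al [l [Phi [res ext]]]]]]] := nakayama_mx hnu.
have [q qE] := reduction_ex A.
have [P [v [crd [crdK combK bm aug]]]] := free_resolution_ex
  (reduced_surj qE res) (reduced_exact0 qE res) (reduced_exactS qE res).
have [phi hphi] := twisted_lift_ex sK aug_s' P.
have [g hg ng] := reduced_ext_neq0 qE res ext (graded_augmentation nug.2).
have sc x : hdet_scalar dim sigma x -> cobd (reduced_d q d)
    (map_mx sigma (twist_mx v crd phi dim *m g) - kscale x g).
  by rewrite (hdet_scalarP s'K _ _ hphi) (twisted_scalar_mx s'K crdK combK _ _ hphi) bm; apply.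
move=> /sc hc /sc hc'; apply: contrapT => /eqP cc'; apply: ng.
have cN n (f : 'cV[A]_(b n)) : cobd (reduced_d q d) f -> cobd (reduced_d q d) (- f).
  by case: n f => [|n] f /= => [->|[z ->]]; [rewrite oppr0|exists (- z); rewrite mulmxN].
have h : cobd (reduced_d q d) (kscale (c' - c) g).
  have := cobdD hc (cN _ _ hc'); congr (cobd _ _).
  by rewrite opprB addrC addrA subrK; apply/matrixP => i j; rewrite !mxE scalerBl.
have := cobd_kscale (c' - c)^-1 h; congr (cobd _ _).
by apply/matrixP => i j; rewrite !mxE scalerA mulVf ?scale1r // subr_eq0 eq_sym.
Qed.

Theorem theorem1p7 (k : fieldType) (D A : gralg k)
    (D_fp : finitely_presented D) (D_gen : generated_in_degree_one D)
    (Omega : D) (m : nat) (m_ge2 : (2 <= m)%N) (Omega_hom : gcomp D m Omega)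
    (Omega_normal : normal_elt Omega) (Omega_regular : regular_elt Omega)
    (pi : {lrmorphism D -> A})
    (pi_hom : forall n x, gcomp D n x -> gcomp A n (pi x))
    (pi_surj : forall a, exists x, pi x = a)
    (pi_ker : forall x, pi x = 0 <-> two_sided_ideal (eq Omega) x) :
  twisted_CY A ->
  twisted_CY D /\
  forall (dA dD : nat) (nuA : {lrmorphism A -> A}) (nuD : {lrmorphism D -> D}),
    nakayama dA nuA -> nakayama dD nuD ->
    [/\ exists tau tauV : {lrmorphism D -> D},
          [/\ cancel tau tauV, cancel tauV tau,
              forall x, Omega * x = tau x * Omega,
              forall tau' : {lrmorphism D -> D}, bijective tau' ->
                (forall x, Omega * x = tau' x * Omega) -> tau' =1 tau
            & forall x, gcomp D 1 x -> nuA (pi x) = pi (tauV (nuD x))],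
        Omega != 0 /\ exists c : k, nuD Omega = c *: Omega
      & forall (sigma : {lrmorphism D -> D}) (lambda : k),
          graded_aut sigma -> sigma Omega = lambda *: Omega ->
          exists sigmaA : {lrmorphism A -> A},
            [/\ graded_aut sigmaA, forall x, sigmaA (pi x) = pi (sigma x)
              & hdet dD sigma = lambda * hdet dA sigmaA]].
Proof.
have m_gt0 : (0 < m)%N by apply: leq_trans m_ge2.
have [tau [tauV [tauK tauVK tauE tau_hom tauV_hom]]] :=
  tau_exists Omega_hom Omega_normal Omega_regular.
have kerP := pi_kerP Omega_normal pi_ker.
have O0 := Omega_neq0 Omega_regular.
have pi_ann (s : {lrmorphism D -> D}) (c : k) : s Omega = c *: Omega ->
    forall x, pi x = 0 -> pi (s x) = 0.
  move=> sO x /kerP[z ->]; apply/kerP; exists (c *: s z).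
  by rewrite rmorphM /= sO -scalerAr -scalerAl.
(* [Omega * Omega = tau Omega * Omega], so [tau] fixes [Omega] and descends to [A]. *)
have tauO : tau Omega = 1 *: Omega by rewrite scale1r; apply: Omega_regular.2; rewrite /= -tauE.
have tauVO : tauV Omega = 1 *: Omega by rewrite scale1r -{1}[Omega]scale1r -tauO tauK.
have [tauA [tauAV [tauAK tauAVK tauAE tauAVE]]] :=
  induced_automorphism pi_surj tauK tauVK (pi_ann _ _ tauO) (pi_ann _ _ tauVO).
have lift dA (nuA : {lrmorphism A -> A}) : nakayama dA nuA ->
    exists nu : {lrmorphism D -> D}, [/\ nakayama dA.+1 nu,
      forall x, pi (nu x) = tauA (nuA (pi x)) & exists c : k, nu Omega = c *: Omega].
  move=> hA; have [b [e [d [al [l [Phi [res ext]]]]]]] := nakayama_mx hA.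
  exact: (lift_nakayama m_gt0 Omega_hom Omega_normal Omega_regular pi_hom pi_surj pi_ker
    D_gen m_ge2 tauK tauVK tauE tau_hom tauV_hom tauAK tauAVK tauAE tauAVE hA.1 res ext).
move=> [d0 [nu0 h0]]; split.
  by have [nu [hnu _ _]] := lift _ _ h0; exists d0.+1, nu.
move=> dA dD nuA nuD hA hD.
have [nu [hnu nuE [c nuO]]] := lift _ _ hA.
(* Uniqueness carries the properties of the constructed [nu] to the given [nuD] and shows that [dD]
   is [dA.+1]. *)
have [dE nE] := nakayama_unique hD hnu.
split.
- exists tau, tauV; split=> //.
    by move=> t _ tE x; apply: Omega_regular.2; rewrite /= -tE tauE.
  by move=> x _; rewrite -tauAVE nE nuE tauAK.
- by split=> //; exists c; rewrite nE.
move=> sigma lambda [sbij sg] sO.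
have [sigma' [sK s'K]] := inverse_lrmorphism sbij.
have l0 : lambda != 0.
  apply: contraNneq O0 => l0; apply/eqP/(can_inj sK).
  by rewrite sO l0 scale0r rmorph0.
have s'O : sigma' Omega = lambda^-1 *: Omega.
  by apply: (can_inj sK); rewrite s'K linearZ /= sO scalerA mulVf ?scale1r.
have [sA [sA' [sAK sA'K sAE sA'E]]] :=
  induced_automorphism pi_surj sK s'K (pi_ann _ _ sO) (pi_ann _ _ s'O).
have sAg n a : gcomp A n a -> gcomp A n (sA a).
  move=> ha; have [x hx <-] := pi_lift pi_hom pi_surj (ha : gcomp_int n%:Z a).
  by rewrite sAE; apply: pi_hom; apply: sg.
exists sA; split=> //; first by split=> //; exists sA'.
have aug_sA' := graded_augmentation (inverse_graded sAK sA'K sAg).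
have eqv x : hdet_scalar dD sigma x <-> hdet_scalar dA sA (lambda * x).
  have [b [e [d [al [l [Phi [res ext]]]]]]] := nakayama_mx hA.
  have [q qE] := reduction_ex A.
  rewrite dE; exact: (hdet_scalar_quotient Omega_normal Omega_regular pi_hom pi_surj pi_ker
    tauK tauVK tauE sK s'K sAK sA'K sAE sA'E aug_sA' l0 sO
    (reduced_surj qE res) (reduced_exact0 qE res) (reduced_exactS qE res)).
(* [xget] defaults to 0 when no scalar exists; by [eqv] this happens on both sides at once, and then
   both determinants are [0^-1 = 0]. *)
rewrite /hdet; case: (xgetP 0 (hdet_scalar dA sA)) => [x _ hx|nx].
  case: xgetP => [z _ /eqv hz|nz]; last first.
    by case: (nz (lambda^-1 * x)); apply/eqv; rewrite mulrA mulfV // mul1r; exact: hx.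
  rewrite -(hdet_scalar_unique hA sAK sA'K aug_sA' hz hx) invfM mulrA mulfV // mul1r //.
case: xgetP => [z _ /eqv /nx //|_]; by rewrite invr0 mulr0.
Qed.
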